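(* Let $0<p,q,u,v<\infty$ and $\alpha,\beta\in\mathbb{R}$. Then $\mathcal{F}_{q,\alpha}^{p}\subseteq\mathcal{F}_{u,\beta}^{v}$ if and only if one of the following conditions holds: (i) $p<v$ and $\frac1p-\frac1v-\alpha+\beta\le0$; (ii) $p\ge v$ and either $-\alpha+\beta<0$, or [$-\alpha+\beta=0$ and $q\le u$].
   Context: $\mathbb{D}$ is the open unit disk, $\mathbb{T}$ the unit circle, $|d\xi|$ Lebesgue (arc length) measure on $\mathbb{T}$, $dA$ Euclidean area measure on $\mathbb{D}$, and $H(\mathbb{D})$ the space of analytic functions on $\mathbb{D}$. For $\xi\in\mathbb{T}$ let $\Gamma(\xi)=\{z\in\mathbb{D}: |1-z\bar\xi|<1-|z|^2\}$. Tent spaces: for $0<p,q<\infty$ and $\alpha\in\mathbb{R}$, $\mathcal{T}_{q,\alpha}^p$ is the space of measurable functions $g$ on $\mathbb{D}$ with $$\|g\|_{\mathcal{T}_{q,\alpha}^p}^p=\int_{\mathbb{T}}\left(\int_{\Gamma(\xi)}|g(z)|^q(1-|z|^2)^\alpha\,dA(z)\right)^{p/q}|d\xi|<\infty .$$ Flett fractional operator: for $f(z)=\sum_{n\ge0}a_nz^n\in H(\mathbb{D})$ and $t\in\mathbb{C}$, $\mathfrak{I}_t^{\mathrm{F}}f(z)=\sum_{n=0}^\infty (n+1)^{-t}a_nz^n$. Analytic Triebel--Lizorkin spaces: for $0<p,q<\infty$ and $\alpha\in\mathbb{R}$, $$\mathcal{F}_{q,\alpha}^p=\left\{f\in H(\mathbb{D}):\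 (1-|z|)^{s-\alpha}\,\mathfrak{I}_{-s}^{\mathrm{F}}f\in\mathcal{T}_{q,-2}^p\ \text{for some real } s>\alpha\right\}.$$ *)

(* Defs.v *)
From HB Require Import structures.
From mathcomp Require Import all_boot all_order all_algebra.
From mathcomp Require Import complex.
From mathcomp Require Import all_classical all_reals all_analysis.

Set Implicit Arguments.
Unset Strict Implicit.
Unset Printing Implicit Defensive.

Import Order.TTheory GRing.Theory Num.Theory.
Import numFieldNormedType.Exports.

Local Open Scope classical_set_scope.
Local Open Scope ring_scope.
Local Open Scope complex_scope.

(* The real-valued modulus; the norm `|z| of R[i] takes its values in R[i]. *)
Definition cmod (R : realType) (z : R[i]) : R := complex.Re `|z|.

Definition disk (R : realType) : set R[i] := [set z | cmod z < 1].

Definition cexp_i (R : realType) (theta : R) : R[i] := cos theta +i* sin theta.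

Definition Gamma (R : realType) (xi : R[i]) : set R[i] :=
  [set z | disk z /\ cmod (1 - z * xi^*) < 1 - cmod z ^+ 2].

(* H(D); elements are total functions on R[i] of which only the restriction
   to the disk matters. Derivability is over the field R[i], hence complex;
   R[i]^o is R[i] with its topology and its normed module structure over
   itself. *)
Definition analytic_on_disk (R : realType) : set (R[i] -> R[i]) :=
  [set f | forall z : R[i], disk z -> derivable (f : R[i]^o -> R[i]^o) z 1].

(* The measure-theoretic notions live on the plane R * R, with its product
   sigma-algebra, and are transported along (x, y) |-> x + iy. *)
Definition to_complex (R : realType) (w : R * R) : R[i] := w.1 +i* w.2.

Definition measurable_on_disk (R : realType) (g : R[i] -> R[i]) : Prop :=
  measurable_fun (@to_complex R @^-1` @disk R)
    (fun w : R * R => complex.Re (g (to_complex w))) /\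
  measurable_fun (@to_complex R @^-1` @disk R)
    (fun w : R * R => complex.Im (g (to_complex w))).

Definition area_integral (R : realType) (A : set R[i]) (h : R[i] -> \bar R) :
    \bar R :=
  (\int[(@lebesgue_measure R \x @lebesgue_measure R)%E]_(w in
     @to_complex R @^-1` A) h (to_complex w))%E.

Definition circle_integral (R : realType) (h : R[i] -> \bar R) : \bar R :=
  (\int[@lebesgue_measure R]_(theta in `[0%R, (2 * pi)%R[)
     h (cexp_i theta))%E.

(* The p-th power of the norm of T_{q,alpha}^p. *)
Definition tent_normp (R : realType) (p q alpha : R) (g : R[i] -> R[i]) :
    \bar R :=
  circle_integral (fun xi : R[i] =>
    (area_integral (Gamma xi) (fun z : R[i] =>
      (cmod (g z) `^ q * (1 - cmod z ^+ 2) `^ alpha)%:E) `^ (p / q))%E).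

Definition tent (R : realType) (p q alpha : R) : set (R[i] -> R[i]) :=
  [set g | measurable_on_disk g /\ (tent_normp p q alpha g < +oo)%E].

(* (n+1)^w for a complex exponent w, i.e. exp (w ln (n+1)). *)
Definition succn_cpow (R : realType) (n : nat) (w : R[i]) : R[i] :=
  (expR (complex.Re w * ln n.+1%:R))%:C * cexp_i (complex.Im w * ln n.+1%:R).

Definition power_series_on_disk (R : realType) (a : nat -> R[i])
    (f : R[i] -> R[i]) : Prop :=
  forall z : R[i], disk z ->
    series (fun n => a n * z ^+ n) @ \oo --> (f z : R[i]^o).

(* g is the Flett transform of order t of f on the disk. An analytic f has
   exactly one coefficient sequence a there, and the transformed series
   converges on the disk, so g is determined by f on the disk. *)
Definition flett (R : realType) (t : R[i]) (f g : R[i] -> R[i]) : Prop :=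
  exists2 a : nat -> R[i], power_series_on_disk a f &
    power_series_on_disk (fun n => succn_cpow n (- t) * a n) g.

Definition triebel_lizorkin (R : realType) (p q alpha : R) :
    set (R[i] -> R[i]) :=
  [set f | analytic_on_disk f /\
    exists s : R, alpha < s /\
    exists g : R[i] -> R[i], flett (- s%:C) f g /\
      tent p q (- 2) (fun z => ((1 - cmod z) `^ (s - alpha))%:C * g z)].

(* Main.v *)
(* Write W = (1-|z|)^(s-alpha) |I_(-s) f|, I_(-s) f being the transform of
   order -s. By the submean value property of |I_(-s) f|^q, the value W(z)^q is
   bounded by a multiple of the q-th power area functional at every point of an
   arc of length comparable to 1-|z|. The weak type inequality for the
   Hardy-Littlewood maximal function, applied to the indicators of the superlevel
   sets of the area functional, then shows that the p-th power of the supremum of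
   W over the approach regions is integrable, while integrating over the arc
   bounds W^p (1-|z|). The embeddings follow by splitting powers of W between
   these bounds and the area functional.
   Conversely, a transform of (1-z)^(-K) tests the index
   1/p - 1/v - alpha + beta, and for u < q a super-lacunary series with
   coefficients (k+1)^(-1/u) N_k^(-alpha), which are q-summable but not
   u-summable after normalisation, lies in every F^p_(q,alpha) and in no
   F^v_(u,alpha). When alpha < beta, the space F^v_(u,beta) embeds in
   F^v_(q/2,alpha), which reduces to this last case. *)

Require Import Defs.
From HB Require Import structures.
From mathcomp Require Import all_boot all_order all_algebra.
From mathcomp Require Import complex.
From mathcomp Require Import all_classical all_reals all_analysis.
From mathcomp Require Import measurable_realfun ring lra.

Set Implicit Arguments.
Unset Strict Implicit.
Unset Printing Implicit Defensive.

Import Order.TTheory GRing.Theory Num.Theory.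
Import numFieldNormedType.Exports.

Local Open Scope classical_set_scope.
Local Open Scope ring_scope.
Local Open Scope complex_scope.

(** * Modulus *)

(** All exponents may be less than 1, so the estimates go through pointwise bounds for W rather than
    through convexity or duality. The weak type inequality is applied to indicators because X, a
    multiple of the p-th power of the area functional, is merely integrable, and the maximal
    function of X itself need not be. An indicator gives |{sup W^p > k}| <= C |{X > k}| with the
    same level on both sides, and these inequalities can be summed over the integers k. The submean
    value property rests on an exact identity for polynomials: the values P(z + root * w), summed
    over the N-th roots of unity, give N P(z) when deg P < N. Integrating in w over a disc then uses
    only the rotation invariance of area. Membership asks for some order s, and source and target
    may use different ones. The embeddings keep the order of the source. A test function has to fail
    for every order allowed in the target; hence the test functions are given by coefficients whose
    transform of each real order is again explicit: binomial coefficients times a power of n+1, and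
    lacunary coefficients. *)

Section modulus.
Variable R : realType.
Implicit Types (z w : R[i]) (x : R).

Lemma normC_cmod z : `|z| = (cmod z)%:C.
Proof. by case: z => a b; rewrite /cmod normc_def. Qed.

Lemma cmodE (a b : R) : cmod (a +i* b) = Num.sqrt (a ^+ 2 + b ^+ 2).
Proof. by rewrite /cmod normc_def. Qed.

Lemma cmod_ge0 z : 0 <= cmod z.
Proof. by case: z => a b; rewrite cmodE sqrtr_ge0. Qed.

Lemma cmodM z w : cmod (z * w) = cmod z * cmod w.
Proof.
have := normrM z w; rewrite !normC_cmod => h; apply: complexI.
by rewrite h rmorphM.
Qed.

Lemma cmodD z w : cmod (z + w) <= cmod z + cmod w.
Proof. by have := ler_normD z w; rewrite !normC_cmod -rmorphD /= lecR. Qed.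

Lemma cmodN z : cmod (- z) = cmod z.
Proof. by rewrite /cmod normrN. Qed.

Lemma cmodB z w : cmod (z - w) = cmod (w - z).
Proof. by rewrite /cmod distrC. Qed.

Lemma cmod_real x : cmod x%:C = `|x|.
Proof. by rewrite cmodE expr0n addr0 sqrtr_sqr. Qed.

Lemma cmod0 : cmod (0 : R[i]) = 0.
Proof. by rewrite /cmod normr0. Qed.

Lemma cmod1 : cmod (1 : R[i]) = 1.
Proof. by rewrite /cmod normr1. Qed.

Lemma cmod_eq0 z : (cmod z == 0) = (z == 0).
Proof. by rewrite -(normr_eq0 z) normC_cmod -(inj_eq (@complexI R)). Qed.

Lemma cmodX z n : cmod (z ^+ n) = cmod z ^+ n.
Proof.
by elim: n => [|n ih]; rewrite ?expr0 ?cmod1 // !exprS cmodM ih.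
Qed.

Lemma cmodV z : cmod z^-1 = (cmod z)^-1.
Proof.
apply: complexI; rewrite -normC_cmod normfV normC_cmod.
by rewrite fmorphV.
Qed.

Lemma cmod_sum (I : Type) (r : seq I) (P : pred I) (F : I -> R[i]) :
  cmod (\sum_(i <- r | P i) F i) <= \sum_(i <- r | P i) cmod (F i).
Proof.
elim/big_rec2: _ => [|i x y _ h]; first by rewrite cmod0.
by rewrite (le_trans (cmodD _ _))// lerD2l.
Qed.

Lemma cmod_sub_le z w : cmod z - cmod w <= cmod (z - w).
Proof. by rewrite lerBlDr -{1}(subrK w z) cmodD. Qed.

Lemma cmod_dist u z w : cmod (z - w) <= cmod (z - u) + cmod (u - w).
Proof. by rewrite -{1}(subrK u z) -addrA cmodD. Qed.

Lemma Re_le_cmod z : `|complex.Re z| <= cmod z.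
Proof.
case: z => a b; rewrite cmodE /= -sqrtr_sqr ler_wsqrtr// lerDl sqr_ge0 //.
Qed.

Lemma Im_le_cmod z : `|complex.Im z| <= cmod z.
Proof.
case: z => a b; rewrite cmodE /= -sqrtr_sqr ler_wsqrtr// lerDr sqr_ge0 //.
Qed.

Lemma cmod_le_ReIm z : cmod z <= `|complex.Re z| + `|complex.Im z|.
Proof.
case: z => a b; rewrite cmodE /= -[leRHS]ger0_norm ?addr_ge0// -[leRHS]sqrtr_sqr ler_wsqrtr//.
rewrite sqrrD !real_normK ?num_real// lerD2r lerDl mulrn_wge0// mulr_ge0.
Qed.

Lemma sqr_cmod (a b : R) : cmod (a +i* b) ^+ 2 = a ^+ 2 + b ^+ 2.
Proof. by rewrite cmodE sqr_sqrtr// addr_ge0// sqr_ge0. Qed.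

Lemma cmod_cexp_i x : cmod (cexp_i x) = 1.
Proof. by rewrite cmodE cos2Dsin2 sqrtr1. Qed.

Lemma cexp_i0 : cexp_i (0 : R) = 1.
Proof. by rewrite /cexp_i cos0 sin0. Qed.

Lemma cexp_iD x y : cexp_i (x + y) = cexp_i x * cexp_i y.
Proof.
rewrite /cexp_i cosD sinD; simpc; congr (_ +i* _).
by rewrite addrC.
Qed.

Lemma cexp_iMn x n : cexp_i (x *+ n) = cexp_i x ^+ n.
Proof.
by elim: n => [|n ih]; rewrite ?mulr0n ?cexp_i0 ?expr0 // mulrS cexp_iD ih exprS.
Qed.

Lemma cexp_i_conj x : (cexp_i x)^* = cexp_i (- x).
Proof. by rewrite /cexp_i cosN sinN. Qed.

Lemma cexp_iNK x : cexp_i x * cexp_i (- x) = 1.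
Proof. by rewrite -cexp_iD subrr cexp_i0. Qed.

End modulus.

Section complex_limits.
Variable R : realType.

Lemma cvg_complexP (u : nat -> R[i]) (l : R[i]) :
  (u @ \oo --> (l : R[i]^o)) <->
  forall e : R, 0 < e -> exists N : nat, forall n, (N <= n)%N -> cmod (u n - l) < e.
Proof.
split=> [ul e e0|h].
- have := @cvgrPdist_lt _ _ _ (\oo) _ (u : nat -> R[i]^o) (l : R[i]^o).
  move=> [+ _] => /(_ ul e%:C); rewrite ltcR => /(_ e0) [N _ hN].
  exists N => n Nn; have := hN n Nn; rewrite /= normC_cmod ltcR.
  by rewrite cmodB.
- apply/(@cvgrPdist_lt _ _ _ (\oo) _ (u : nat -> R[i]^o) (l : R[i]^o)) => e e0.
  have er : e = (complex.Re e)%:C.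
    by move: e0; case: e => a b; rewrite ltcE /= => /andP[/eqP -> _].
  have e0' : 0 < complex.Re e by move: e0; rewrite er ltcR.
  have [N hN] := h _ e0'.
  exists N => // n /= Nn; rewrite er normC_cmod ltcR cmodB.
  exact: hN.
Qed.

End complex_limits.

(** * Power series *)

Section real_sequences.
Variable R : realType.

Lemma eq_le_refl (x y : R) : x = y -> x <= y.
Proof. by move=> ->. Qed.

Lemma powRD_gt0 (x a b : R) : 0 < x -> x `^ (a + b) = x `^ a * x `^ b.
Proof. by move=> x0; rewrite powRD// (gt_eqF x0) implybT. Qed.

Lemma sum_geometric_le (x : R) n m : 0 <= x -> x < 1 ->
  \sum_(n <= k < m) x ^+ k <= x ^+ n / (1 - x).
Proof.
move=> x0 x1; have x10 : 0 < 1 - x by rewrite subr_gt0.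
rewrite ler_pdivlMr// mulrC.
have [nm|mn] := leqP n m; last first.
  by rewrite big_geq ?mulr0 ?exprn_ge0// ltnW.
suff -> : (1 - x) * \sum_(n <= k < m) x ^+ k = x ^+ n - x ^+ m.
  by rewrite gerBl exprn_ge0.
elim: m nm => [|m ih]; first by rewrite leqn0 => /eqP ->; rewrite big_geq// mulr0 subrr.
rewrite leq_eqVlt => /predU1P[->|]; first by rewrite big_geq// mulr0 subrr.
rewrite ltnS => nm; rewrite big_nat_recr//= mulrDr ih// exprS; ring.
Qed.

Lemma geometric_lt (x K e : R) : 0 <= x -> x < 1 -> 0 < e ->
  exists N : nat, forall n, (N <= n)%N -> K * x ^+ n < e.
Proof.
move=> x0 x1 e0.
have : (fun n => K * x ^+ n) @ \oo --> (0 : R).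
  have -> : (0 : R) = K * 0 by rewrite mulr0.
  by apply: cvgMl_tmp; apply: cvg_expr; rewrite ger0_norm.
move/cvgrPdist_lt => /(_ e e0) [N _ hN].
exists N => n Nn; have := hN n Nn; rewrite /= sub0r normrN.
exact/le_lt_trans/ler_norm.
Qed.

(** Raise [y / K <= expR (y / K)] to the power [K]. *)
Lemma powR_expRN_le (K y : R) : 0 < K -> 0 < y -> y `^ K * expR (- y) <= K `^ K.
Proof.
move=> K0 y0.
have h : y / K <= expR (y / K) by rewrite (le_trans _ (expR_ge1Dx _))// lerDr.
have : (y / K) `^ K <= expR y.
  rewrite -{2}[y](@divfK _ K) ?gt_eqF// expRM ge0_ler_powR ?nnegrE ?expR_ge0 ?(ltW K0)//.
  by rewrite divr_ge0// ltW.
rewrite powRM ?(ltW y0) ?invr_ge0 ?(ltW K0)// => h2.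
have E0 := expR_gt0 y; have P0 := powR_gt0 K K0.
rewrite expRN ler_pdivrMr//; apply: (@le_trans _ _ (K `^ K * (y `^ K * K^-1 `^ K))).
  rewrite mulrCA -powRM ?invr_ge0 ?(ltW K0)// mulfV ?gt_eqF// powR1 mulr1//.
by rewrite ler_wpM2l// ltW.
Qed.

Lemma powR_geometric_bounded (s t : R) : 0 <= t -> t < 1 ->
  exists2 C, 0 < C & forall n : nat, n.+1%:R `^ s * t ^+ n <= C.
Proof.
move=> t0 t1.
have [->|tn0] := eqVneq t 0.
  exists 1 => // -[|n]; first by rewrite expr0 powR1 mulr1.
  by rewrite expr0n mulr0.
have tgt0 : 0 < t by rewrite lt0r tn0.
have [s0|s0] := leP s 0.
  exists 1 => // n; rewrite mulr_ile1 ?powR_ge0 ?exprn_ge0 ?exprn_ile1 ?(ltW t1)//.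
  by rewrite -[leRHS](powRr0 n.+1%:R) ler_powR// ler1n.
(* With t = exp(-y), [powR_expRN_le] is used at (n+1) y; the factor [expR y] turns t^(n+1) back into
   t^n. *)
pose y := - ln t; have y0 : 0 < y by rewrite oppr_gt0 ln_lt0// tgt0.
have D0 : 0 < expR y * y `^ (- s) by rewrite mulr_gt0 ?expR_gt0 ?powR_gt0.
exists (s `^ s * (expR y * y `^ (- s))); first by rewrite mulr_gt0 ?powR_gt0.
move=> n; have n0 : 0 < n.+1%:R * y by rewrite mulr_gt0.
have := ler_wpM2r (ltW D0) (powR_expRN_le s0 n0); congr (_ <= _).
have -> : t ^+ n = expR (- (n.+1%:R * y)) * expR y.
  rewrite -expRD -natr1 mulrDl mul1r opprD subrK -mulrN opprK mulrC expRM lnK//.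
  by rewrite powR_mulrn.
rewrite powRM ?(ltW y0)//.
have yy : y `^ s * y `^ (- s) = 1 by rewrite -powRD ?subrr ?powRr0// (gt_eqF y0) implybT.
by rewrite -[RHS]mulr1 -yy; ring.
Qed.

(** One square root of [r] absorbs the power of n+1, the other one tends to 0. *)
Lemma powR_geometric_lt (s r e : R) : 0 <= r -> r < 1 -> 0 < e ->
  exists N : nat, forall n, (N <= n)%N -> n.+1%:R `^ s * r ^+ n < e.
Proof.
move=> r0 r1 e0; pose t := Num.sqrt r.
have t0 : 0 <= t by exact: sqrtr_ge0.
have t1 : t < 1 by rewrite -sqrtr1 ltr_sqrt.
have [C C0 hC] := powR_geometric_bounded s t0 t1.
have [N hN] := geometric_lt C t0 t1 e0.
exists N => n Nn; apply: le_lt_trans (hN n Nn).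
by rewrite -(sqr_sqrtr r0) -/t exprAC expr2 mulrA ler_wpM2r ?exprn_ge0.
Qed.

(** This is r <= exp(-(1-r)) raised to the power n. The factor [expR 1] pays for n+1 in place of n
    in the exponent, n+1 being the quantity on which the Flett transform acts. *)
Lemma expr_le_expR (r : R) n : 0 <= r -> r <= 1 ->
  r ^+ n <= expR 1 * expR (- (n.+1%:R * (1 - r))).
Proof.
move=> r0 r1; rewrite -expRD.
have h : r ^+ n <= expR (- (n%:R * (1 - r))).
  rewrite -mulrN mulrC expRM powR_mulrn ?expR_ge0// lerXn2r ?nnegrE ?expR_ge0//.
  by apply: le_trans (expR_ge1Dx _); lra.
by apply: le_trans h _; rewrite ler_expR -natr1; lra.
Qed.

Lemma bernoulli (y : R) n : 0 <= y <= 1 -> 1 - n%:R * y <= (1 - y) ^+ n.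
Proof.
move=> /andP[y0 y1]; elim: n => [|n ih]; first by rewrite mul0r subr0 expr0.
have n0 : 0 <= n%:R :> R by [].
rewrite exprSr -natr1; apply: (@le_trans _ _ ((1 - n%:R * y) * (1 - y))).
  by have : 0 <= n%:R * y ^+ 2 by [rewrite mulr_ge0// sqr_ge0]; rewrite expr2; nra.
by rewrite ler_wpM2r// subr_ge0.
Qed.

Lemma sum_min_inv_le (x : nat -> R) n : (forall k, 0 < x k) -> (forall k, 2 * x k <= x k.+1) ->
  \sum_(0 <= k < n) Num.min (x k) (x k)^-1 <= 4.
Proof.
move=> x0 x2.
(* The invariant follows the two geometric sums: up to the value 1 the terms at least double, so the
   last one controls the sum; beyond it the remaining slack [(x m)^-1] is at least halved at each
   step. *)
suff h m : \sum_(0 <= k < m.+1) Num.min (x k) (x k)^-1 <=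
    if x m <= 1 then 2 * x m else 4 - (x m)^-1.
  case: n => [|n]; first by rewrite big_nil.
  apply: le_trans (h n) _; case: ifP => xn; first by lra.
  by have := x0 n; rewrite -invr_gt0; lra.
have minE k : Num.min (x k) (x k)^-1 = if x k <= 1 then x k else (x k)^-1.
  have [h|h] := leP (x k) 1.
    by rewrite min_l// (le_trans h)// invf_ge1.
  by rewrite min_r// ltW// (lt_trans _ h)// invf_lt1.
elim: m => [|m ih].
  rewrite big_nat1 minE; have := x0 0; case: ifP => [h|/negbT]; first by lra.
  by rewrite -ltNge => h; have : (x 0)^-1 < 1; [rewrite invf_lt1|lra].
rewrite big_nat_recr//= minE; apply: le_trans (lerD ih (lexx _)) _.
have h0 := x0 m; have h1 := x0 m.+1; have h2 := x2 m.
case: (leP (x m.+1) 1) => c1.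
  rewrite ifT; first by lra.
  by lra.
have i1 : (x m.+1)^-1 <= 1 by rewrite invf_le1// ltW.
case: (leP (x m) 1) => c0; first by lra.
have : (x m.+1)^-1 <= (2 * x m)^-1 by rewrite lef_pV2 ?posrE// mulr_gt0.
rewrite invfM; lra.
Qed.

(** A telescoping form of the integral test: with d = a - 1, the term (n+1)^(-a) is at most 1/d
    times n^(-d) - (n+1)^(-d). After division by (n+1)^(-d) this is exp(-d ln(x/y)) >= 1 - d ln(x/y)
    >= 1 + d/y with x = y - 1. *)
Lemma sum_powR_bounded (a : R) : 1 < a ->
  exists2 B, 0 <= B & forall n, \sum_(0 <= k < n) k.+1%:R `^ (- a) <= B.
Proof.
move=> a1; pose d := a - 1; have d0 : 0 < d by rewrite subr_gt0.
have id0 : 0 < d^-1 by rewrite invr_gt0.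
exists (1 + d^-1); first by rewrite addr_ge0// ltW.
suff h n : \sum_(0 <= k < n.+1) k.+1%:R `^ (- a) <= 1 + d^-1 - d^-1 * n.+1%:R `^ (- d).
  case=> [|n]; first by rewrite big_nil addr_ge0// ltW.
  by apply: le_trans (h n) _; rewrite gerBl mulr_ge0 ?powR_ge0// ltW.
elim: n => [|n ih]; first by rewrite big_nat1 !powR1 mulr1 addrK.
rewrite big_nat_recr//=; apply: le_trans (lerD ih (lexx _)) _.
set y : R := n.+2%:R; set x : R := n.+1%:R.
have x0 : 0 < x by rewrite ltr0n.
have y0 : 0 < y by rewrite ltr0n.
have xy : x = y - 1 by rewrite /x /y -(natr1 n.+1) addrK.
suff : d * y `^ (- a) <= x `^ (- d) - y `^ (- d).
  move=> h; have : y `^ (- a) <= d^-1 * (x `^ (- d) - y `^ (- d)).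
    by rewrite mulrC ler_pdivlMr// mulrC.
  by rewrite mulrBr; lra.
have -> : - a = - d + - 1 by rewrite /d; ring.
rewrite (powRD_gt0 _ _ y0).
rewrite powR_inv1 ?(ltW y0)//.
have -> : x `^ (- d) = y `^ (- d) * (x / y) `^ (- d).
  rewrite -powRM ?(ltW y0) ?divr_ge0 ?(ltW x0) ?(ltW y0)//.
  by rewrite mulrCA mulfV ?gt_eqF// mulr1.
suff h : 1 + d / y <= (x / y) `^ (- d).
  have := ler_wpM2l (powR_ge0 y (- d)) h; rewrite mulrDr mulr1 => h'.
  by rewrite (_ : d * (_ / y) = y `^ (- d) * (d / y)); [rewrite lerBrDl|ring].
have xy0 : 0 < x / y by rewrite divr_gt0.
rewrite /powR gt_eqF//; apply: le_trans (expR_ge1Dx _); rewrite lerD2l mulNr -mulrN.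
rewrite ler_wpM2l ?(ltW d0)//.
have e1 : x / y = 1 + - y^-1 by rewrite xy mulrBl mulfV ?gt_eqF// mul1r.
rewrite e1 lerNr; apply: le_ln1Dx.
by rewrite ltrN2 invf_lt1// ltr1n.
Qed.

Lemma dyadic_below (d r : R) : 0 < d -> d < r ->
  exists k, r * 2^-1 ^+ k.+1 <= d < 2 * (r * 2^-1 ^+ k.+1).
Proof.
move=> d0 dr.
have ex : exists k, r * 2^-1 ^+ k.+1 <= d.
  have [||N hN] := @geometric_lt 2^-1 r d _ _ d0; [lra|lra|].
  by exists N; rewrite ltW// hN.
case: (ex_minnP ex) => k hk kmin; exists k; rewrite hk/=.
case: k hk kmin => [|k] hk kmin; first by rewrite expr1; lra.
have : ~~ (r * 2^-1 ^+ k.+1 <= d) by apply/negP => /kmin; rewrite ltnn.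
rewrite -ltNge => h; apply: lt_le_trans h _.
by rewrite [X in _ <= 2 * (r * X)]exprS; lra.
Qed.

Lemma half_powR_lt1 (a : R) : 0 < a -> 0 <= 2^-1 `^ a < 1.
Proof.
move=> a0; have := gt0_ltr_powR a0 (x := 2^-1) (y := 1); rewrite !nnegrE powR1.
by move=> ->; rewrite ?powR_ge0//; lra.
Qed.

End real_sequences.

Section power_series.
Variable R : realType.
Implicit Types (a b : nat -> R[i]) (f g : R[i] -> R[i]) (z w : R[i]) (r : R).

Definition psum a n z := \sum_(0 <= k < n) a k * z ^+ k.

Lemma psumS a n z : psum a n.+1 z = psum a n z + a n * z ^+ n.
Proof. by rewrite /psum big_nat_recr. Qed.

Lemma power_seriesP a f : power_series_on_disk a f <->
  forall z, disk z -> forall e, 0 < e ->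
    exists N : nat, forall n, (N <= n)%N -> cmod (psum a n z - f z) < e.
Proof.
split=> h z hz; first exact/cvg_complexP/h.
exact/cvg_complexP/h.
Qed.

(** Radius of convergence at least 1. Being a condition on the coefficients alone, it passes to the
    Flett transforms and to coefficientwise dominated sequences. *)
Definition fast_decay a :=
  forall r, 0 <= r -> r < 1 -> exists K, forall n, cmod (a n) * r ^+ n <= K.

Lemma power_series_fast_decay a f : power_series_on_disk a f -> fast_decay a.
Proof.
move=> /power_seriesP af r r0 r1.
have rd : disk r%:C by rewrite /disk /= cmod_real ger0_norm.
have [N hN] := af _ rd 1 ltr01.
(* From [N] on a term is the difference of two partial sums, each within 1 of the limit; the earlier
   terms are bounded by their sum. *)
exists (2 + \sum_(0 <= k < N) cmod (a k) * r ^+ k) => n.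
have S0 (m : nat) : 0 <= \sum_(0 <= k < m) cmod (a k) * r ^+ k.
  by apply: sumr_ge0 => k _; rewrite mulr_ge0 ?cmod_ge0 ?exprn_ge0.
have [Nn|nN] := leqP N n.
- apply: (@le_trans _ _ 2); last by rewrite lerDl.
  have -> : cmod (a n) * r ^+ n = cmod (psum a n.+1 r%:C - psum a n r%:C).
    by rewrite psumS addrAC subrr add0r cmodM cmodX cmod_real ger0_norm.
  rewrite (le_trans (cmod_dist (f r%:C) _ _))//.
  have h1 := hN _ Nn; have h2 := hN n.+1 (leqW Nn).
  rewrite [X in _ + X]cmodB; lra.
- apply: (@le_trans _ _ (\sum_(0 <= k < N) cmod (a k) * r ^+ k)); last by rewrite lerDr.
  rewrite (bigD1_seq n) ?iota_uniq//=; last by rewrite mem_index_iota.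
  rewrite lerDl sumr_ge0// => k _; rewrite mulr_ge0 ?cmod_ge0 ?exprn_ge0//.
Qed.

(** The factor [(cmod z / s) ^+ n] is kept in place of the uniform (r/s)^n: its vanishing order at 0
    is what gives the uniqueness of the coefficients. *)
Lemma psum_tail a r s K : 0 < s -> r < s ->
  (forall n, cmod (a n) * s ^+ n <= K) ->
  forall (z : R[i]) (n m : nat), cmod z <= r -> (n <= m)%N ->
    cmod (psum a m z - psum a n z) <= K / (1 - r / s) * (cmod z / s) ^+ n.
Proof.
move=> s0 rs hK z n m zr nm.
have K0 : 0 <= K by apply: le_trans (hK 0%N); rewrite mulr_ge0 ?cmod_ge0 ?exprn_ge0// ltW.
have -> : psum a m z - psum a n z = \sum_(n <= k < m) a k * z ^+ k.
  by rewrite /psum (big_cat_nat (leq0n n) nm) addrAC subrr add0r.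
have t0 : 0 <= cmod z / s by rewrite divr_ge0 ?cmod_ge0// ltW.
have tr : cmod z / s <= r / s by rewrite ler_pM2r ?invr_gt0.
have r1 : r / s < 1 by rewrite ltr_pdivrMr ?mul1r.
rewrite (le_trans (cmod_sum _ _ _))//.
apply: (@le_trans _ _ (\sum_(n <= k < m) K * (cmod z / s) ^+ k)).
  apply: ler_sum => k _; rewrite cmodM cmodX expr_div_n mulrA mulrAC.
  rewrite ler_wpM2r ?exprn_ge0 ?cmod_ge0//.
  by rewrite ler_pdivlMr ?exprn_gt0.
rewrite -mulr_sumr mulrAC -mulrA ler_wpM2l//.
rewrite (le_trans (sum_geometric_le _ _ _ _))//; first exact: le_lt_trans r1.
rewrite ler_wpM2l ?exprn_ge0// lef_pV2 ?posrE ?subr_gt0//; last exact: le_lt_trans r1.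
by rewrite lerB.
Qed.

Lemma power_series_tail a f r : power_series_on_disk a f -> 0 <= r -> r < 1 ->
  exists K : R, exists2 s, r < s < 1 & forall z n, cmod z <= r ->
    cmod (f z - psum a n z) <= K * (cmod z / s) ^+ n.
Proof.
move=> af r0 r1.
pose s := (r + 1) / 2.
have rs : r < s by rewrite /s; lra.
have s1 : s < 1 by rewrite /s; lra.
have [K hK] := power_series_fast_decay af (ltW (le_lt_trans r0 rs)) s1.
exists (K / (1 - r / s)), s; first by rewrite rs.
move=> z n zr; apply/ler_addgt0Pl => e e0.
have /power_seriesP/(_ z) := af; rewrite /disk /= => /(_ (le_lt_trans zr r1) e e0)[N hN].
rewrite (le_trans (cmod_dist (psum a (maxn N n) z) _ _))// lerD//.
  by rewrite cmodB ltW// hN// leq_maxl.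
by apply: (psum_tail (le_lt_trans r0 rs) rs hK) => //; rewrite leq_maxr.
Qed.

Lemma power_series_uniform a f r : power_series_on_disk a f -> 0 <= r -> r < 1 ->
  forall e, 0 < e -> exists N, forall n z, (N <= n)%N -> cmod z <= r ->
    cmod (f z - psum a n z) <= e.
Proof.
move=> af r0 r1 e e0.
have [K [s /andP[rs s1] hK]] := power_series_tail af r0 r1.
have s0 := le_lt_trans r0 rs.
have [||N hN] := @geometric_lt _ (r / s) `|K| e _ _ e0.
- by rewrite divr_ge0// ltW.
- by rewrite ltr_pdivrMr ?mul1r.
exists N => n z Nn zr; rewrite (le_trans (hK _ _ zr))// (le_trans _ (ltW (hN n Nn)))//.
have t0 : 0 <= cmod z / s by rewrite divr_ge0 ?cmod_ge0// ltW.
apply: (@le_trans _ _ (`|K| * (cmod z / s) ^+ n)).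
  by rewrite ler_wpM2r ?exprn_ge0// ler_norm.
rewrite ler_wpM2l// lerXn2r ?nnegrE//; first by rewrite divr_ge0// ltW.
by rewrite ler_pM2r// invr_gt0.
Qed.

Lemma power_series_bounded a f r : power_series_on_disk a f -> r < 1 ->
  exists2 B, 0 <= B & forall z, cmod z <= r -> cmod (f z) <= B.
Proof.
move=> af r1; have [r0|r0] := leP 0 r; last first.
  exists 0 => // z zr; have := cmod_ge0 z; lra.
have [K [s _ hK]] := power_series_tail af r0 r1.
exists `|K| => // z zr.
have := hK z 0%N zr; rewrite /psum big_geq// subr0 expr0 mulr1 => h.
exact: le_trans h (ler_norm _).
Qed.

Lemma fast_decay_power_series a : fast_decay a -> exists f, power_series_on_disk a f.
Proof.
move=> da.
suff h z : exists l, disk z -> forall e, 0 < e ->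
    exists N : nat, forall n, (N <= n)%N -> cmod (psum a n z - l) < e.
  have [f hf] := choice h.
  by exists f; apply/power_seriesP => z hz; apply: hf.
have [hz|] := pselect (disk z); last by exists 0.
pose s := (cmod z + 1) / 2.
have z1 : cmod z < 1 by exact: hz.
have zs : cmod z < s by rewrite /s; lra.
have s1 : s < 1 by rewrite /s; lra.
have s0 : 0 < s := le_lt_trans (cmod_ge0 z) zs.
have [K hK] := da _ (ltW s0) s1.
have t0 : 0 <= cmod z / s by rewrite divr_ge0 ?cmod_ge0// ltW.
have t1 : cmod z / s < 1 by rewrite ltr_pdivrMr ?mul1r.
(* [p] stands for the real or the imaginary part; each gives an absolutely convergent real
   series. *)
have cau (p : R[i] -> R) : (forall w, `|p w| <= cmod w) ->
    {morph p : x y / x + y} -> p 0 = 0 ->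
    cvgn (fun n => p (psum a n z)).
  move=> pb pD p0.
  have -> : (fun n => p (psum a n z)) = series (fun k => p (a k * z ^+ k)).
    by apply/funext => n; rewrite /series /psum /= (big_morph p pD p0).
  apply: normed_cvg.
  apply: (@series_le_cvg _ _ (fun k => K * (cmod z / s) ^+ k)).
  - by move=> n /=.
  - by move=> n; rewrite (le_trans (normr_ge0 (p (a n * z ^+ n))))// (le_trans (pb _))//
      cmodM cmodX expr_div_n mulrA mulrAC ler_wpM2r ?exprn_ge0 ?cmod_ge0// ler_pdivlMr ?exprn_gt0.
  - move=> n /=; rewrite (le_trans (pb _))//.
    by rewrite cmodM cmodX expr_div_n mulrA mulrAC ler_wpM2r ?exprn_ge0 ?cmod_ge0// ler_pdivlMr ?exprn_gt0.
  - by apply: is_cvg_geometric_series; rewrite ger0_norm.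
have cR : cvgn (fun n => complex.Re (psum a n z)).
  by apply: cau => // [w|x y]; [exact: Re_le_cmod|case: x; case: y].
have cI : cvgn (fun n => complex.Im (psum a n z)).
  by apply: cau => // [w|x y]; [exact: Im_le_cmod|case: x; case: y].
exists (limn (fun n => complex.Re (psum a n z)) +i* limn (fun n => complex.Im (psum a n z))).
move=> _ e e0; have e2 : 0 < e / 2 by lra.
move/cvgrPdist_lt : cR => /(_ _ e2) [N1 _ h1].
move/cvgrPdist_lt : cI => /(_ _ e2) [N2 _ h2].
exists (maxn N1 N2) => n; rewrite geq_max => /andP[n1 n2].
have := h1 _ n1; have := h2 _ n2 => /= {}h2 {}h1.
apply: le_lt_trans (cmod_le_ReIm _) _.
rewrite (splitr e) ltrD//.
- by move: h1; rewrite distrC; case: (psum a n z).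
- by move: h2; rewrite distrC; case: (psum a n z).
Qed.

End power_series.

(** * Termwise differentiation and uniqueness of the coefficients *)

Section power_series_derivation.
Variable R : realType.
Implicit Types (a b : nat -> R[i]) (f g : R[i] -> R[i]) (z w h : R[i]) (r : R).

(** The remainder for k+1 is z + h times the one for k plus a term of second order. The factor
    [r ^+ 2] on the left stands for r^(k-2) on the right, which avoids a negative exponent for k <
    2. *)
Lemma expr_taylor1 z h (r : R) k : 0 <= r -> cmod z <= r -> cmod (z + h) <= r ->
  cmod ((z + h) ^+ k - z ^+ k - k%:R * h * z ^+ k.-1) * r ^+ 2 <=
  k%:R ^+ 2 * cmod h ^+ 2 * r ^+ k.
Proof.
move=> r0 zr zhr; elim: k => [|k ih].
  by rewrite !expr0 subrr !mul0r subrr cmod0 mul0r expr0n !mul0r.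
pose E := (z + h) ^+ k - z ^+ k - k%:R * h * z ^+ k.-1.
have -> : (z + h) ^+ k.+1 - z ^+ k.+1 - k.+1%:R * h * z ^+ k.+1.-1 =
    (z + h) * E + k%:R * h ^+ 2 * z ^+ k.-1.
  rewrite /E /= !exprS -natr1; case: k {ih E} => [|k]; first by rewrite !expr0; ring.
  rewrite [k.+1.-1]/= !exprS; ring.
rewrite (le_trans (ler_wpM2r _ (cmodD _ _)))// ?exprn_ge0// mulrDl.
have h1 : cmod ((z + h) * E) * r ^+ 2 <= k%:R ^+ 2 * cmod h ^+ 2 * r ^+ k.+1.
  rewrite cmodM -mulrA (le_trans (ler_pM _ _ zhr ih))//.
  - exact: cmod_ge0.
  - by rewrite mulr_ge0 ?cmod_ge0 ?exprn_ge0.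
  - by rewrite (exprS r) mulrCA.
have h2 : cmod (k%:R * h ^+ 2 * z ^+ k.-1) * r ^+ 2 <= k%:R * cmod h ^+ 2 * r ^+ k.+1.
  rewrite !cmodM !cmodX -?expr2; case: (posnP k) => [->|k0].
    by rewrite [X in cmod X]mulr0n cmod0 !mul0r.
  have -> : cmod (k%:R : R[i]) = k%:R by rewrite -(rmorph_nat (@real_complex R)) cmod_real ger0_norm.
  have -> : r ^+ k.+1 = r ^+ k.-1 * r ^+ 2 by rewrite -exprD -{1}(prednK k0) addn2.
  rewrite mulrA ler_wpM2r ?exprn_ge0// ler_wpM2l ?mulr_ge0 ?exprn_ge0 ?cmod_ge0//.
  by rewrite lerXn2r ?nnegrE ?cmod_ge0.
apply: le_trans (lerD h1 h2) _.
rewrite -!mulrDl ler_wpM2r ?exprn_ge0// ler_wpM2r ?exprn_ge0 ?cmod_ge0//.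
rewrite -natr1; set x := k%:R; have : 0 <= x by rewrite ler0n.
nra.
Qed.

Lemma fast_decay_powR a s : fast_decay a ->
  fast_decay (fun n => (n.+1%:R `^ s)%:C * a n).
Proof.
move=> da r r0 r1.
pose t := (r + 1) / 2.
have rt : r < t by rewrite /t; lra.
have t1 : t < 1 by rewrite /t; lra.
have t0 : 0 < t := le_lt_trans r0 rt.
have [K hK] := da _ (ltW t0) t1.
have q0 : 0 <= r / t by rewrite divr_ge0// ltW.
have q1 : r / t < 1 by rewrite ltr_pdivrMr ?mul1r.
have [C C0 hC] := powR_geometric_bounded s q0 q1.
exists (C * K) => n; rewrite cmodM cmod_real ger0_norm ?powR_ge0//.
have -> : r = (r / t) * t by rewrite divfK// gt_eqF.
by rewrite exprMn mulrACA ler_pM// ?mulr_ge0 ?powR_ge0 ?exprn_ge0 ?cmod_ge0// (ltW t0).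
Qed.

Lemma fast_decay_le a b (C : R) : (forall n, cmod (b n) <= C * cmod (a n)) ->
  fast_decay a -> fast_decay b.
Proof.
move=> ba da r r0 r1; have [K hK] := da r r0 r1.
have C0 : 0 <= `|C| by [].
exists (`|C| * K) => n; rewrite (le_trans _ (ler_wpM2l C0 (hK n)))// mulrA.
by rewrite ler_wpM2r ?exprn_ge0// (le_trans (ba n))// ler_wpM2r ?cmod_ge0// ler_norm.
Qed.

(** The remainder is estimated on partial sums, uniformly in their length, and the limit is taken at
    fixed h. The sequence [b] holds the coefficients of the derivative, with n+1 written as a power
    so that [fast_decay_powR] applies to it; the quadratic constant is finite because (k+1)^2 |a_k|
    t^k is bounded for some t > r. *)
Lemma power_series_taylor1 a f z r : power_series_on_disk a f ->
  cmod z < r -> r < 1 ->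
  exists (g : R[i]) (K : R), forall h, cmod (z + h) <= r ->
    cmod (f (z + h) - f z - h * g) <= K * cmod h ^+ 2.
Proof.
move=> af zr r1.
have r0 : 0 < r := le_lt_trans (cmod_ge0 z) zr.
have da := power_series_fast_decay af.
pose b n := (n.+1%:R `^ 1)%:C * a n.+1.
have [t /andP[rt t1]] : exists t, r < t < 1.
  by exists ((r + 1) / 2); apply/andP; split; lra.
have t0 := lt_trans r0 rt.
have db : fast_decay b.
  apply: (@fast_decay_powR (fun n => a n.+1) 1) => u u0 u1.
  have [->|un0] := eqVneq u 0.
    exists (cmod (a 1%N)) => -[|n]; first by rewrite expr0 mulr1.
    by rewrite expr0n mulr0 cmod_ge0.
  have [K hK] := da u u0 u1.
  have ugt0 : 0 < u by rewrite lt0r un0.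
  by exists (K / u) => n; rewrite ler_pdivlMr// -mulrA -exprSr.
have [g hg] := fast_decay_power_series db.
pose c n := (n.+1%:R `^ 2)%:C * a n.
have [K hK] := fast_decay_powR 2 da (ltW t0) t1.
have q0 : 0 <= r / t by rewrite divr_ge0// ltW.
have q1 : r / t < 1 by rewrite ltr_pdivrMr ?mul1r.
exists (g z), (K / (1 - r / t) / r ^+ 2) => h zhr.
apply/ler_addgt0Pl => e e0.
have z1 : disk z by exact: (lt_trans zr r1).
have zh1 : disk (z + h) by exact: (le_lt_trans zhr r1).
move/power_seriesP : (af) => /[dup] /(_ _ z1) A /(_ _ zh1) B.
move/power_seriesP : (hg) => /(_ _ z1) D.
have h1 : 0 < 1 + cmod h by rewrite ltr_wpDr ?cmod_ge0.
have e3 : 0 < e / (3 * (1 + cmod h)) by rewrite divr_gt0// mulr_gt0.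
have [N1 A1] := A _ e3; have [N2 B2] := B _ e3; have [N3 D3] := D _ e3.
pose n := maxn N1 (maxn N2 N3).
have {}A1 := A1 n.+1 (leqW (leq_maxl _ _)).
have {}B2 : cmod (psum a n.+1 (z + h) - f (z + h)) < e / (3 * (1 + cmod h)).
  by apply: B2; apply: leqW; rewrite /n !leq_max leqnn orbT.
have {}D3 : cmod (psum b n z - g z) < e / (3 * (1 + cmod h)).
  by apply: D3; rewrite /n !leq_max leqnn !orbT.
pose P := psum a n.+1 (z + h) - psum a n.+1 z - h * psum b n z.
have -> : f (z + h) - f z - h * g z = (f (z + h) - psum a n.+1 (z + h)) +
  ((psum a n.+1 z - f z) + (h * (psum b n z - g z) + P)).
  rewrite /P; ring.
have hP : cmod P <= K / (1 - r / t) / r ^+ 2 * cmod h ^+ 2.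
  have PE : P = \sum_(0 <= k < n.+1) a k * ((z + h) ^+ k - z ^+ k - k%:R * h * z ^+ k.-1).
    rewrite /P; have -> : h * psum b n z = \sum_(0 <= k < n.+1) a k * (k%:R * h * z ^+ k.-1).
      rewrite big_nat_recl// [X in X + _](_ : _ = 0); last first.
        by rewrite mulr0n !mul0r mulr0.
      rewrite add0r /psum mulr_sumr; apply: eq_bigr => k _.
      rewrite /b powRr1// rmorph_nat; ring.
    rewrite /psum -!sumrB; apply: eq_bigr => k _; ring.
  rewrite PE (le_trans (cmod_sum _ _ _))//.
  rewrite mulrAC ler_pdivlMr ?exprn_gt0// mulr_suml.
  apply: (@le_trans _ _ (\sum_(0 <= k < n.+1) K * cmod h ^+ 2 * (r / t) ^+ k)).
    apply: ler_sum => k _; rewrite cmodM -[leLHS]mulrA.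
    rewrite (le_trans (ler_wpM2l (cmod_ge0 _) (expr_taylor1 k (ltW r0) (ltW zr) zhr)))//.
    have := hK k; rewrite cmodM cmod_real ger0_norm ?powR_ge0// powR_mulrn// => hk.
    have tk : 0 < t ^+ k by rewrite exprn_gt0.
    rewrite expr_div_n [leRHS]mulrA ler_pdivlMr//.
    have -> : K * cmod h ^+ 2 * r ^+ k = cmod h ^+ 2 * r ^+ k * K by ring.
    have -> : cmod (a k) * (k%:R ^+ 2 * cmod h ^+ 2 * r ^+ k) * t ^+ k =
      (cmod h ^+ 2 * r ^+ k) * (k%:R ^+ 2 * cmod (a k) * t ^+ k) by ring.
    rewrite ler_wpM2l ?mulr_ge0 ?exprn_ge0 ?cmod_ge0 ?(ltW r0)//.
    rewrite (le_trans _ hk)// ler_wpM2r ?(ltW tk)// ler_wpM2r ?cmod_ge0//.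
    by rewrite lerXn2r ?nnegrE// ler_nat.
  have K0 : 0 <= K.
    by apply: le_trans (hK 0%N); rewrite mulr_ge0 ?cmod_ge0 ?exprn_ge0// ltW.
  rewrite -mulr_sumr [leRHS]mulrAC -[leRHS]mulrA mulrA ler_wpM2l ?mulr_ge0 ?exprn_ge0 ?cmod_ge0//.
  by rewrite (le_trans (sum_geometric_le _ _ _ _))// expr0 mul1r.
have e4 : (1 + cmod h) * (e / (3 * (1 + cmod h))) = e / 3.
  by field; rewrite gt_eqF.
have cc : cmod (f (z + h) - psum a n.+1 (z + h)) + (cmod (psum a n.+1 z - f z)
   + cmod h * cmod (psum b n z - g z)) <= e.
  rewrite [X in X + _]cmodB.
  have d1 := ltW A1; have d2 := ltW B2; have d3 := ler_wpM2l (cmod_ge0 h) (ltW D3).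
  have c0 := cmod_ge0 h.
  have e5 : e / (3 * (1 + cmod h)) <= e / 3.
    by rewrite -e4 [leRHS]mulrDl mul1r lerDl mulr_ge0// ltW.
  have e6 : cmod h * (e / (3 * (1 + cmod h))) <= e / 3.
    by rewrite -e4 [leRHS]mulrDl mul1r lerDr ltW.
  lra.
rewrite (le_trans (cmodD _ _))// (le_trans (lerD (lexx _) (cmodD _ _)))//.
rewrite (le_trans (lerD (lexx _) (lerD (lexx _) (cmodD _ _))))//.
rewrite [X in _ + (_ + (X + _))]cmodM.
lra.
Qed.

Lemma power_series_analytic a f : power_series_on_disk a f -> analytic_on_disk f.
Proof.
move=> af z z1.
have [r /andP[zr r1]] : exists r, cmod z < r < 1.
  by exists ((cmod z + 1) / 2); move: z1; rewrite /disk /= => z1; apply/andP; split; lra.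
have [g [K hK]] := power_series_taylor1 af zr r1.
apply/cvg_ex; exists (g : R[i]^o).
apply/cvgrPdist_le => e e0.
have er : e = (complex.Re e)%:C.
  by move: e0; case: e => p q; rewrite ltcE /= => /andP[/eqP -> _].
have e0' : 0 < complex.Re e by move: e0; rewrite er ltcR.
pose d := Num.min (r - cmod z) (complex.Re e / (`|K| + 1)).
have K1 : 0 < `|K| + 1 by rewrite ltr_wpDl.
have d0 : 0 < d by rewrite lt_min subr_gt0 zr divr_gt0.
near=> h.
have hn0 : h != 0 by near: h; exact: nbhs_dnbhs_neq.
have hd : cmod h < d.
  rewrite -ltcR -normC_cmod; near: h.
  by apply: dnbhs0_lt; rewrite ltcR.
have := hd; rewrite lt_min => /andP[h1 h2].
have zh : cmod (z + h) <= r.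
  by rewrite (le_trans (cmodD _ _))//; lra.
rewrite er normC_cmod lecR.
have -> : (g : R[i]^o) - (h^-1 *: ((f : R[i]^o -> R[i]^o) (h *: (1 : R[i]^o) + z) - f z) : R[i]^o) =
   - (h^-1 * (f (z + h) - f z - h * g)) :> R[i].
  rewrite -[_ *: _]/(h^-1 * _ : R[i]) -[h *: _]/(h * 1 : R[i]) mulr1 (addrC h z).
  by rewrite [in RHS]mulrBr mulKf// opprB.
rewrite cmodN cmodM cmodV.
rewrite ler_pdivrMl ?lt0r ?cmod_eq0 ?hn0 ?cmod_ge0//.
rewrite (le_trans (hK h zh))// expr2 mulrCA ler_wpM2l ?cmod_ge0//.
move: h2; rewrite ltr_pdivlMr// => h2; rewrite (le_trans _ (ltW h2))// mulrC.
rewrite ler_wpM2l ?cmod_ge0// (le_trans (ler_norm _))// lerDl //.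
Unshelve. all: by end_near.
Qed.

(** If the coefficients below n agree, then (a_n - b_n) x^n is a difference of two tails, which are
    O(x^(n+1)) as x tends to 0. *)
Lemma power_series_unique a b f : power_series_on_disk a f ->
  power_series_on_disk b f -> a = b.
Proof.
move=> af bf; apply/funext; elim/ltn_ind => n ih.
have half0 : 0 <= 2^-1 :> R by rewrite invr_ge0.
have half1 : 2^-1 < 1 :> R by lra.
have [K1 [s1 /andP[hs1 _] h1]] := power_series_tail af half0 half1.
have [K2 [s2 /andP[hs2 _] h2]] := power_series_tail bf half0 half1.
have s10 : 0 < s1 by lra.
have s20 : 0 < s2 by lra.
apply/eqP; rewrite -subr_eq0 -cmod_eq0 eq_le cmod_ge0 andbT.
pose C := `|K1| / s1 ^+ n.+1 + `|K2| / s2 ^+ n.+1.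
have C0 : 0 <= C by rewrite addr_ge0// divr_ge0// exprn_ge0// ltW.
suff h (x : R) : 0 < x -> x <= 2^-1 -> cmod (a n - b n) <= C * x.
  apply/ler_addgt0Pl => e e0; rewrite addr0.
  pose x := Num.min 2^-1 (e / (C + 1)).
  have x0 : 0 < x by rewrite lt_min invr_gt0 ltr0n/= divr_gt0// ltr_wpDl.
  rewrite (le_trans (h x x0 _)) ?ge_min ?lexx//.
  have : x <= e / (C + 1) by rewrite ge_min lexx orbT.
  rewrite ler_pdivlMr ?ltr_wpDl// => h3.
  by rewrite (le_trans _ h3)// mulrC ler_wpM2l ?(ltW x0)// lerDl.
move=> x0 xh.
have xc : cmod x%:C = x by rewrite cmod_real gtr0_norm.
have := h1 x%:C n.+1; have := h2 x%:C n.+1; rewrite xc => /(_ xh) {}h2 /(_ xh) {}h1.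
rewrite -(ler_pM2r (exprn_gt0 n x0)).
have -> : cmod (a n - b n) * x ^+ n = cmod ((f x%:C - psum b n.+1 x%:C) - (f x%:C - psum a n.+1 x%:C)).
  rewrite !psumS.
  have -> : psum a n x%:C = psum b n x%:C.
    by rewrite /psum !big_mkord; apply: eq_bigr => k _; rewrite ih.
  rewrite -{1}xc -cmodX -cmodM; congr cmod; ring.
rewrite (le_trans (cmodD _ _))// cmodN addrC (le_trans (lerD h1 h2))//.
rewrite -mulrA -exprS mulrDl !expr_div_n.
by rewrite lerD// mulrAC -mulrA ler_wpM2r// ?divr_ge0 ?exprn_ge0 ?ler_norm// ltW.
Qed.

End power_series_derivation.

(** * Area integrals *)

Section complex_measurability.
Variable R : realType.
Context d (T : measurableType d).
Implicit Types (D : set T) (g h : T -> R[i]).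

Definition cmeasurable D g :=
  measurable_fun D (fun t => complex.Re (g t)) /\ measurable_fun D (fun t => complex.Im (g t)).

Lemma cmeasurable_cst D (z : R[i]) : cmeasurable D (cst z).
Proof. by split; exact: measurable_cst. Qed.

Lemma cmeasurableD D g h : cmeasurable D g -> cmeasurable D h ->
  cmeasurable D (fun t => g t + h t).
Proof.
move=> [g1 g2] [h1 h2]; split.
- have -> : (fun t => complex.Re (g t + h t)) = (fun t => complex.Re (g t)) \+ (fun t => complex.Re (h t)).
    by apply/funext => t /=; case: (g t); case: (h t).
  exact: measurable_funD.
- have -> : (fun t => complex.Im (g t + h t)) = (fun t => complex.Im (g t)) \+ (fun t => complex.Im (h t)).
    by apply/funext => t /=; case: (g t); case: (h t).
  exact: measurable_funD.
Qed.

Lemma cmeasurableM D g h : cmeasurable D g -> cmeasurable D h ->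
  cmeasurable D (fun t => g t * h t).
Proof.
move=> [g1 g2] [h1 h2]; split.
- have -> : (fun t => complex.Re (g t * h t)) =
     ((fun t => complex.Re (g t)) \* (fun t => complex.Re (h t))) \- ((fun t => complex.Im (g t)) \* (fun t => complex.Im (h t))).
    by apply/funext => t /=; case: (g t); case: (h t).
  by apply: measurable_funB; apply: measurable_funM.
- have -> : (fun t => complex.Im (g t * h t)) =
     ((fun t => complex.Re (g t)) \* (fun t => complex.Im (h t))) \+ ((fun t => complex.Im (g t)) \* (fun t => complex.Re (h t))).
    by apply/funext => t /=; case: (g t); case: (h t).
  by apply: measurable_funD; apply: measurable_funM.
Qed.

Lemma cmeasurableN D g : cmeasurable D g -> cmeasurable D (fun t => - g t).
Proof.
move=> mg; have -> : (fun t => - g t) = (fun t => cst (-1) t * g t).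
  by apply/funext => t; rewrite /= mulN1r.
by apply: cmeasurableM => //; exact: cmeasurable_cst.
Qed.

Lemma cmeasurableX D g n : cmeasurable D g -> cmeasurable D (fun t => g t ^+ n).
Proof.
move=> mg; elim: n => [|n ih].
  rewrite (_ : (fun _ => _) = cst 1); last by apply/funext => t; rewrite expr0.
  exact: cmeasurable_cst.
rewrite (_ : (fun _ => _) = (fun t => g t * g t ^+ n)).
  exact: cmeasurableM.
by apply/funext => t; rewrite exprS.
Qed.

Lemma cmeasurable_real D (u : T -> R) : measurable_fun D u ->
  cmeasurable D (fun t => (u t)%:C).
Proof. by move=> mu; split => //=; exact: measurable_cst. Qed.

Lemma measurable_cmod D g : cmeasurable D g -> measurable_fun D (fun t => cmod (g t)).
Proof.
move=> [g1 g2].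
rewrite (_ : (fun _ => _) = Num.sqrt \o ((fun t => complex.Re (g t) ^+ 2) \+
    (fun t => complex.Im (g t) ^+ 2))); last first.
  by apply/funext => t /=; case: (g t) => a b; rewrite cmodE.
apply: measurableT_comp; first by apply: continuous_measurable_fun; exact: sqrt_continuous.
by apply: measurable_funD; apply: measurable_funX.
Qed.

Lemma measurable_cmod_ltr (g : T -> R[i]) (u : T -> R) : cmeasurable setT g ->
  measurable_fun setT u -> measurable [set t | cmod (g t) < u t].
Proof.
move=> mg mu; have := measurable_fun_ltr (measurable_cmod mg) mu.
move=> /(_ measurableT [set true] I).
by rewrite setTI.
Qed.

End complex_measurability.

(** * Plane measure: translations, shears, rotations, area of discs *)

Section plane.
Variable R : realType.
Notation mu := (@lebesgue_measure R).
Notation mu2 := (mu \x mu)%E.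
Implicit Types (h : R[i] -> \bar R) (z w : R[i]) (r : R) (A : set R[i]).

Lemma cmeasurable_to_complex : cmeasurable setT (@to_complex R).
Proof. by split; [exact: measurable_fst|exact: measurable_snd]. Qed.

Lemma measurable_fun_to_complex_comp d d' (T : measurableType d)
    (U : measurableType d') (h : R[i] -> U) (g : T -> R[i]) :
  measurable_fun setT (h \o @to_complex R) -> cmeasurable setT g ->
  measurable_fun setT (fun t => h (g t)).
Proof.
move=> mh [g1 g2].
have mg := measurable_fun_pair g1 g2.
have := measurableT_comp mh mg.
rewrite (_ : _ \o _ = fun t => h (g t))//.
by apply/funext => t /=; congr h; rewrite /to_complex /=; case: (g t).
Qed.

Definition disc z r : set R[i] := [set w | cmod (w - z) < r].

Lemma measurable_disc z r : measurable (@to_complex R @^-1` disc z r).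
Proof.
rewrite /disc /preimage /=.
have h : cmeasurable setT (fun w : R * R => to_complex w - z).
  apply: cmeasurableD; first exact: cmeasurable_to_complex.
  exact: cmeasurable_cst.
exact: (measurable_cmod_ltr h (measurable_cst r)).
Qed.

Lemma disk_disc : @disk R = disc 0 1.
Proof. by apply/seteqP; split => z; rewrite /disk /disc /= subr0. Qed.

Lemma measurable_disk : measurable (@to_complex R @^-1` @disk R).
Proof. by rewrite disk_disc; exact: measurable_disc. Qed.

(** The image of Lebesgue measure under a translation agrees with it on half-open intervals, hence
    on all measurable sets. *)
Lemma ge0_integral_shift (f : R -> \bar R) (c : R) : measurable_fun setT f ->
  (forall x, (0 <= f x)%E) -> (\int[mu]_x f (x + c)%R = \int[mu]_x f x)%E.
Proof.
move=> mf f0.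
pose phi : measurableTypeR R -> measurableTypeR R := fun x => x + c.
have mphi : measurable_fun setT phi.
  by apply: measurable_funD => //; exact: measurable_cst.
have := ge0_integral_pushforward mphi mu measurableT mf (fun y _ => f0 y).
rewrite preimage_setT => h; rewrite -[LHS]h.
apply: eq_measure_integral => A mA _.
apply/esym; move: A mA; apply: lebesgue_measure_unique => _ [[a b]] _ <-.
rewrite /pushforward.
rewrite -[RHS]/(mu (phi @^-1` `]a, b])).
have -> : phi @^-1` `]a, b] = `]a - c, b - c]%classic.
  by apply/seteqP; split => x /=; rewrite /phi !in_itv/= ltrBlDr lerBrDr.
rewrite !lebesgue_measure_itv/= !lte_fin ltrD2r.
by case: ifP => // _; rewrite -!EFinD; congr EFin; rewrite opprD addrACA subrr addr0.
Qed.

Lemma plane_fubini1 (f : R * R -> \bar R) : measurable_fun setT f ->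
  (forall x, (0 <= f x)%E) ->
  (\int[mu2]_w f w = \int[mu]_x \int[mu]_y f (x, y))%E.
Proof. by move=> mf f0; exact: fubini_tonelli1. Qed.

Lemma plane_fubini2 (f : R * R -> \bar R) : measurable_fun setT f ->
  (forall x, (0 <= f x)%E) ->
  (\int[mu2]_w f w = \int[mu]_y \int[mu]_x f (x, y))%E.
Proof. by move=> mf f0; exact: fubini_tonelli2. Qed.

(** By Tonelli a shear is a translation on each horizontal line. *)
Lemma ge0_integral_shear1 (f : R * R -> \bar R) (c : R) : measurable_fun setT f ->
  (forall x, (0 <= f x)%E) ->
  (\int[mu2]_w f (w.1 + c * w.2, w.2)%R = \int[mu2]_w f w)%E.
Proof.
move=> mf f0.
have ms : measurable_fun setT (fun w : R * R => (w.1 + c * w.2, w.2)).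
  apply: measurable_fun_pair => //=.
  apply: measurable_funD => //; apply: measurable_funM => //; exact: measurable_cst.
have mfs : measurable_fun setT (fun w : R * R => f (w.1 + c * w.2, w.2)).
  exact: (measurableT_comp mf ms).
rewrite (plane_fubini2 mfs (fun _ => f0 _)) (plane_fubini2 mf f0).
apply: eq_integral => y _ /=.
apply: (@ge0_integral_shift (fun x => f (x, y))) => //.
exact: measurableT_comp.
Qed.

Lemma ge0_integral_shear2 (f : R * R -> \bar R) (c : R) : measurable_fun setT f ->
  (forall x, (0 <= f x)%E) ->
  (\int[mu2]_w f (w.1, w.2 + c * w.1)%R = \int[mu2]_w f w)%E.
Proof.
move=> mf f0.
have ms : measurable_fun setT (fun w : R * R => (w.1, w.2 + c * w.1)).
  apply: measurable_fun_pair => //=.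
  apply: measurable_funD => //; apply: measurable_funM => //; exact: measurable_cst.
have mfs : measurable_fun setT (fun w : R * R => f (w.1, w.2 + c * w.1)).
  exact: (measurableT_comp mf ms).
rewrite (plane_fubini1 mfs (fun _ => f0 _)) (plane_fubini1 mf f0).
apply: eq_integral => x _ /=.
apply: (@ge0_integral_shift (fun y => f (x, y))) => //.
exact: measurableT_comp.
Qed.

Lemma area_integral_mkcond A h : area_integral A h = area_integral setT (h \_ A).
Proof.
by rewrite /area_integral integral_mkcond preimage_setT.
Qed.

Lemma area_integral_translation h z : measurable_fun setT (h \o @to_complex R) ->
  (forall w, (0 <= h w)%E) ->
  area_integral setT (fun w => h (z + w)) = area_integral setT h.
Proof.
move=> mh h0; rewrite /area_integral preimage_setT; case: z => a b.
pose f (w : R * R) := h (to_complex w).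
have -> : (fun w : R * R => h (a +i* b + to_complex w)) = (fun w : R * R => f (w.1 + a, w.2 + b)).
  apply/funext => w; rewrite /f /to_complex /=; congr h; simpc.
  by rewrite (addrC a) (addrC b).
have mx : measurable_fun setT (fun w : R * R => (w.1 + a, w.2 + b)).
  apply: measurable_fun_pair => //=; apply: measurable_funD => //; exact: measurable_cst.
have mfs : measurable_fun setT (fun w : R * R => f (w.1 + a, w.2 + b)).
  exact: (measurableT_comp (mh : measurable_fun setT f) mx).
rewrite (plane_fubini1 mfs (fun _ => h0 _)) [RHS](plane_fubini1 mh (fun _ => h0 _)).
pose F x := (\int[mu]_y f (x, y))%E.
have mF : measurable_fun setT F.
  exact: (@measurable_fun_fubini_tonelli_F _ _ _ _ R mu f mh (fun _ => h0 _)).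
have F0 x : (0 <= F x)%E by apply: integral_ge0 => y _; exact: h0.
rewrite -[RHS](ge0_integral_shift a mF F0); apply: eq_integral => x _ /=.
have mf : measurable_fun setT (fun y => f (x + a, y)).
  exact: (measurableT_comp mh).
exact: (ge0_integral_shift b mf (fun _ => h0 _)).
Qed.

(* A rotation which is not a homothety is a product of three shears. *)
Lemma area_integral_rotation h w : measurable_fun setT (h \o @to_complex R) ->
  (forall w, (0 <= h w)%E) -> cmod w = 1 -> complex.Im w != 0 ->
  area_integral setT (fun z => h (w * z)) = area_integral setT h.
Proof.
move=> mh h0; rewrite /area_integral preimage_setT; case: w => c s /= w1 s0.
have cs : c ^+ 2 + s ^+ 2 = 1 by rewrite -sqr_cmod w1 expr1n.
pose a := (c - 1) / s.
pose f (w : R * R) := h (to_complex w).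
have mf : measurable_fun setT f by [].
have ms1 : measurable_fun setT (fun w : R * R => (w.1 + a * w.2, w.2)).
  apply: measurable_fun_pair => //=.
  apply: measurable_funD => //; apply: measurable_funM => //; exact: measurable_cst.
have ms2 : measurable_fun setT (fun w : R * R => (w.1, w.2 + s * w.1)).
  apply: measurable_fun_pair => //=.
  apply: measurable_funD => //; apply: measurable_funM => //; exact: measurable_cst.
have mf1 : measurable_fun setT (fun w : R * R => f (w.1 + a * w.2, w.2)).
  exact: (measurableT_comp mf ms1).
have mf2 : measurable_fun setT (fun w : R * R =>
    f (w.1 + a * (w.2 + s * w.1), w.2 + s * w.1)).
  exact: (measurableT_comp mf1 ms2).
rewrite -(ge0_integral_shear1 a mf (fun _ => h0 _)).
rewrite -(ge0_integral_shear2 s mf1 (fun _ => h0 _)).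
rewrite -(ge0_integral_shear1 a mf2 (fun _ => h0 _)).
apply: eq_integral => -[x y] _; rewrite /f /to_complex /=; congr h; simpc.
have e1 : a * s = c - 1 by rewrite divfK.
have e2 : y + s * (x + a * y) = s * x + c * y.
  rewrite mulrDr mulrA (mulrC s a) e1; ring.
congr (_ +i* _); last by rewrite e2 addrC.
rewrite e2; apply: (mulIf s0).
have -> : (x + a * y + a * (s * x + c * y)) * s =
   x * s + (a * s) * y + (a * s) * (s * x + c * y) by ring.
rewrite e1; have : s ^+ 2 = 1 - c ^+ 2 by rewrite -cs; ring.
by rewrite expr2 => s2; rewrite mulrBl -(mulrA s) (mulrC y) mulrA s2; ring.
Qed.

(** A square of side [r] fits inside the disc, and one of side [2 * r] contains it. The constants 1
    and 4 stand in for pi, since only the order of magnitude of an area enters the estimates. *)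
Lemma disc_area_ge z r : 0 < r -> ((r ^+ 2)%:E <= mu2 (@to_complex R @^-1` disc z r))%E.
Proof.
move=> r0; case: z => a b.
pose I (x : R) := `](x - r / 2), (x + r / 2)[%classic.
have muI x : mu (I x) = r%:E.
  rewrite lebesgue_measure_itv/= lte_fin ifT; last by lra.
  by rewrite -EFinD; congr EFin; lra.
have -> : (r ^+ 2)%:E = mu2 (I a `*` I b).
  transitivity (mu (I a) * mu (I b))%E; first by rewrite !muI -EFinM expr2.
  by apply/esym/product_measure1E; exact: measurable_itv.
apply: le_measure; rewrite ?inE.
- by apply: measurableX; exact: measurable_itv.
- exact: measurable_disc.
move=> [x y] [] /=; rewrite /I /= !in_itv /= => /andP[x1 x2] /andP[y1 y2].
rewrite /disc /to_complex /=; simpc.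
rewrite -(ltr_pXn2r (n := 2)) ?nnegrE ?cmod_ge0 ?(ltW r0)// sqr_cmod.
have : (x - a) ^+ 2 <= (r / 2) ^+ 2 by rewrite -ler_sqrt ?sqr_ge0// !sqrtr_sqr ler_norml (ger0_norm (_ : 0 <= r / 2)); lra.
have : (y - b) ^+ 2 <= (r / 2) ^+ 2 by rewrite -ler_sqrt ?sqr_ge0// !sqrtr_sqr ler_norml (ger0_norm (_ : 0 <= r / 2)); lra.
have : 0 < r ^+ 2 by rewrite exprn_gt0.
have -> : (r / 2) ^+ 2 = r ^+ 2 / 4 by field.
lra.
Qed.

Lemma disc_area_le z r : 0 < r -> (mu2 (@to_complex R @^-1` disc z r) <= (4 * r ^+ 2)%:E)%E.
Proof.
move=> r0; case: z => a b.
pose I (x : R) := `](x - r), (x + r)[%classic.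
have muI x : mu (I x) = (2 * r)%:E.
  rewrite lebesgue_measure_itv/= lte_fin ifT; last by lra.
  by rewrite -EFinD; congr EFin; lra.
have -> : (4 * r ^+ 2)%:E = mu2 (I a `*` I b).
  transitivity (mu (I a) * mu (I b))%E.
    by rewrite !muI -EFinM; congr EFin; ring.
  by apply/esym/product_measure1E; exact: measurable_itv.
apply: le_measure; rewrite ?inE.
- exact: measurable_disc.
- by apply: measurableX; exact: measurable_itv.
move=> [x y]; rewrite /disc /to_complex /=; simpc => h.
have := le_lt_trans (Re_le_cmod _) h; have := le_lt_trans (Im_le_cmod _) h.
rewrite /= !ltr_norml => /andP[h1 h2] /andP[h3 h4].
by split; rewrite /I /= in_itv /=; apply/andP; split; lra.
Qed.

End plane.

(** * Mean values over roots of unity *)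

Section mean_value.
Variable R : realType.
Implicit Types (a : nat -> R[i]) (f : R[i] -> R[i]) (z w : R[i]) (r : R).

Definition rootC (N : nat) : R[i] := cexp_i (2 * pi / N%:R).

Lemma rootC_unity N : (0 < N)%N -> rootC N ^+ N = 1.
Proof.
move=> N0; rewrite -cexp_iMn -[_ *+ N]mulr_natr divfK ?pnatr_eq0 -?lt0n//.
by rewrite /cexp_i mulr_natl cos2pi sin2pi.
Qed.

(** The real part of the power is 1 - 2 sin(x/2)^2 with 0 < x/2 < pi, hence less than 1. *)
Lemma rootC_neq1 N i : (0 < i < N)%N -> rootC N ^+ i != 1.
Proof.
move=> /andP[i0 iN]; have N0 : (0 < N)%N by exact: ltn_trans iN.
rewrite -cexp_iMn; set x := _ *+ i.
have N0' : 0 < N%:R :> R by rewrite ltr0n.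
have xE : x / 2 = pi * (i%:R / N%:R) by rewrite /x -mulr_natr; field; rewrite gt_eqF.
have s0 : 0 < sin (x / 2).
  apply: sin_gt0_pi; rewrite xE mulr_gt0 ?pi_gt0 ?divr_gt0 ?ltr0n//=.
  by rewrite gtr_pMr ?pi_gt0// ltr_pdivrMr// mul1r ltr_nat.
apply/negP => /eqP[] hx _.
have : cos x = 1 - (sin (x / 2)) ^+ 2 *+ 2.
  have -> : cos x = cos ((x / 2) *+ 2) by rewrite -[_ *+ 2]mulr_natr divfK.
  rewrite cos_mulr2n cos2sin2; ring.
rewrite hx; have : 0 < sin (x / 2) ^+ 2 by rewrite exprn_gt0.
lra.
Qed.

Lemma sum_rootC N i : (0 < i < N)%N -> \sum_(j < N) rootC N ^+ (j * i) = 0.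
Proof.
move=> iN; have N0 : (0 < N)%N by case/andP: iN => _; exact: leq_ltn_trans.
have := subrX1 (rootC N ^+ i) N.
rewrite -exprM mulnC exprM rootC_unity// expr1n subrr => /esym/eqP.
rewrite mulf_eq0 subr_eq0 (negbTE (rootC_neq1 iN)) /= => /eqP h.
by rewrite -[RHS]h; apply: eq_bigr => j _; rewrite -exprM mulnC.
Qed.

(** In the binomial expansion every power w^i with 0 < i < N is cancelled by the sum over the roots
    of unity. This is an exact discrete mean value property for polynomials of degree less than
    [N]. *)
Lemma mean_monomial N n z w : (n < N)%N ->
  \sum_(j < N) (z + rootC N ^+ j * w) ^+ n = N%:R * z ^+ n.
Proof.
move=> nN.
under eq_bigr do rewrite exprDn.
rewrite exchange_big /= big_ord_recl /= [X in _ + X](_ : _ = 0); last first.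
  apply: big1 => -[i /= ni] _; rewrite /bump /= add1n.
  under eq_bigr do rewrite exprMn -exprM mulrCA -mulrnAr.
  rewrite -mulr_suml sum_rootC ?mul0r//.
  by rewrite /= (leq_ltn_trans _ nN).
rewrite addr0 (eq_bigr (fun _ => z ^+ n)); last first.
  by move=> j _; rewrite expr0 mulr1 subn0 bin0 mulr1n.
by rewrite sumr_const card_ord mulr_natl.
Qed.

Lemma mean_psum a N n z w : (n <= N)%N ->
  \sum_(j < N) psum a n (z + rootC N ^+ j * w) = N%:R * psum a n z.
Proof.
move=> nN; rewrite /psum exchange_big /= mulr_sumr.
rewrite !big_mkord; apply: eq_bigr => k _.
by rewrite -mulr_sumr mean_monomial ?(leq_trans (ltn_ord k))// mulrCA.
Qed.

Lemma cmeasurable_psum a n : cmeasurable setT (fun w : R * R => psum a n (to_complex w)).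
Proof.
elim: n => [|n ih].
  rewrite (_ : (fun _ => _) = cst 0); last by apply/funext => w; rewrite /psum big_geq.
  exact: cmeasurable_cst.
rewrite (_ : (fun _ => _) = (fun w : R * R => psum a n (to_complex w) +
    cst (a n) w * to_complex w ^+ n)); last by apply/funext => w; rewrite psumS.
apply: cmeasurableD => //; apply: cmeasurableM; first exact: cmeasurable_cst.
by apply: cmeasurableX; exact: cmeasurable_to_complex.
Qed.

Lemma power_series_measurable a f : power_series_on_disk a f -> measurable_on_disk f.
Proof.
move=> /power_series_uniform af.
have key (p : R[i] -> R) : (forall w, `|p w| <= cmod w) -> {morph p : x y / x - y} ->
   (forall n, measurable_fun setT (fun w : R * R => p (psum a n (to_complex w)))) ->
   measurable_fun (@to_complex R @^-1` @disk R) (fun w : R * R => p (f (to_complex w))).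
  move=> pb pB mp.
  apply: (@measurable_fun_cvg _ _ _ _ (fun n (w : R * R) => p (psum a n (to_complex w)))).
  - by move=> n; exact: measurable_funTS.
  - move=> w wd; apply/cvgrPdist_le => e e0.
    have [N hN] := af _ (cmod_ge0 _) wd _ e0.
    exists N => // n /= Nn; rewrite -pB (le_trans (pb _))//.
    exact: hN.
split.
- apply: key; [exact: Re_le_cmod|by case=> ? ? []|].
  by move=> n; have [] := cmeasurable_psum a n.
- apply: key; [exact: Im_le_cmod|by case=> ? ? []|].
  by move=> n; have [] := cmeasurable_psum a n.
Qed.

Lemma measurable_fun_patch_plane (A : set R[i]) (h : R[i] -> \bar R) :
  measurable (@to_complex R @^-1` A) ->
  measurable_fun (@to_complex R @^-1` A) (h \o @to_complex R) ->
  measurable_fun setT ((h \_ A) \o @to_complex R).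
Proof.
move=> mA mh.
rewrite (_ : _ \o _ = (h \o @to_complex R) \_ (@to_complex R @^-1` A)).
  by apply/(measurable_restrictT _ _).1.
by apply/funext => w; rewrite /patch /= /preimage; congr (if _ then _ else _);
  apply/idP/idP; rewrite !inE.
Qed.

(** The rotation by [w ^+ j] is carried out one factor [w] at a time, because [w ^+ j] may be real
    while [area_integral_rotation] asks for a nonreal multiplier. *)
Lemma area_integral_disc_rotation a n z w r : cmod w = 1 -> complex.Im w != 0 ->
  forall j : nat,
  area_integral (disc 0 r) (fun x => (cmod (psum a n (z + w ^+ j * x)))%:E) =
  area_integral (disc z r) (fun x => (cmod (psum a n x))%:E).
Proof.
move=> w1 w0 j.
pose H := (fun x => (cmod (psum a n x))%:E) \_ (disc z r).
have mH : measurable_fun setT (H \o @to_complex R).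
  apply: measurable_fun_patch_plane; first exact: measurable_disc.
  apply: measurable_funTS; apply/measurable_EFinP.
  by apply: measurable_cmod; exact: cmeasurable_psum.
have H0 x : (0 <= H x)%E.
  by rewrite /H /patch; case: ifP => // _; rewrite lee_fin cmod_ge0.
have mHz : measurable_fun setT ((fun x => H (z + x)) \o @to_complex R).
  apply: (measurable_fun_to_complex_comp mH); apply: cmeasurableD.
    exact: cmeasurable_cst.
  exact: cmeasurable_to_complex.
rewrite area_integral_mkcond [RHS]area_integral_mkcond -/H.
rewrite -(area_integral_translation z mH H0).
transitivity (area_integral setT (fun x => H (z + w ^+ j * x))).
  congr area_integral; apply/funext => x; rewrite /H /patch.
  have -> // : (x \in disc 0 r) = (z + w ^+ j * x \in disc z r).
  apply/idP/idP; rewrite !inE /disc /=;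
  by rewrite addrAC subrr add0r cmodM cmodX w1 expr1n mul1r subr0.
elim: j => [|j ih]; first by congr area_integral; apply/funext => x; rewrite expr0 mul1r.
rewrite -ih; under eq_fun do rewrite exprSr -mulrA.
have mHj : measurable_fun setT ((fun x => H (z + w ^+ j * x)) \o @to_complex R).
  have mc : cmeasurable setT (fun t : R * R => w ^+ j * to_complex t).
    by apply: cmeasurableM; [exact: cmeasurable_cst|exact: cmeasurable_to_complex].
  exact: (measurable_fun_to_complex_comp mHz mc).
exact: (area_integral_rotation mHj (fun _ => H0 _) w1 w0).
Qed.

End mean_value.

Section area_integrals.
Variable R : realType.
Notation mu := (@lebesgue_measure R).
Notation mu2 := (mu \x mu)%E.
Implicit Types (A B : set R[i]) (h : R[i] -> \bar R).

Definition area_set A := measurable (@to_complex R @^-1` A).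
Definition area_fun A h := measurable_fun (@to_complex R @^-1` A) (h \o @to_complex R).

Lemma area_funS A B h : area_set B -> A `<=` B -> area_fun B h -> area_fun A h.
Proof. by move=> mB AB; apply: measurable_funS => // w; exact: AB. Qed.

Lemma area_integral_ge0 A h : (forall z, A z -> (0 <= h z)%E) ->
  (0 <= area_integral A h)%E.
Proof. by move=> h0; apply: integral_ge0 => w; exact: h0. Qed.

Lemma le_area_integral A h k : area_set A -> area_fun A h -> area_fun A k ->
  (forall z, A z -> (0 <= h z)%E) -> (forall z, A z -> (h z <= k z)%E) ->
  (area_integral A h <= area_integral A k)%E.
Proof.
move=> mA mh mk h0 hk; apply: ge0_le_integral => //.
- by move=> w; exact: h0.
- by move=> w; exact: hk.
Qed.

Lemma eq_area_integral A h k : (forall z, A z -> h z = k z) ->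
  area_integral A h = area_integral A k.
Proof. by move=> hk; apply: eq_integral => w; rewrite inE => /hk. Qed.

Lemma area_integral_subset A B h : area_set A -> area_set B -> area_fun B h ->
  A `<=` B -> (forall z, B z -> (0 <= h z)%E) ->
  (area_integral A h <= area_integral B h)%E.
Proof.
move=> mA mB mh AB h0; apply: ge0_subset_integral => //.
- by move=> w; exact: h0.
- by move=> w; exact: AB.
Qed.

Lemma area_integral_cst A (c : R) :
  area_set A -> area_integral A (fun=> c%:E) = (c%:E * mu2 (@to_complex R @^-1` A))%E.
Proof. by move=> mA; rewrite /area_integral integral_cst. Qed.

Lemma area_integralZl A h (c : R) : area_set A -> area_fun A h -> 0 <= c ->
  (forall z, A z -> (0 <= h z)%E) ->
  area_integral A (fun z => (c%:E * h z)%E) = (c%:E * area_integral A h)%E.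
Proof.
by move=> mA mh c0 h0; rewrite /area_integral ge0_integralZl_EFin// => w; exact: h0.
Qed.

Lemma area_integralD A h k : area_set A -> area_fun A h -> area_fun A k ->
  (forall z, A z -> (0 <= h z)%E) -> (forall z, A z -> (0 <= k z)%E) ->
  area_integral A (fun z => (h z + k z)%E) = (area_integral A h + area_integral A k)%E.
Proof.
by move=> mA mh mk h0 k0; rewrite /area_integral ge0_integralD// => w; [exact: h0|exact: k0].
Qed.

Lemma area_set_disc z r : area_set (disc z r).
Proof. exact: measurable_disc. Qed.

Lemma area_set_disk : area_set (@disk R).
Proof. exact: measurable_disk. Qed.

Lemma area_fun_cmod A (f : R[i] -> R[i]) : area_set A -> measurable_on_disk f -> A `<=` @disk R ->
  measurable_fun (@to_complex R @^-1` A) (fun w => cmod (f (to_complex w))).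
Proof.
move=> mA [f1 f2] Ad; apply: measurable_cmod; split.
- by apply: measurable_funS f1 => [|w]; [exact: measurable_disk|exact: Ad].
- by apply: measurable_funS f2 => [|w]; [exact: measurable_disk|exact: Ad].
Qed.

Lemma disc_sub_disk z r : cmod z + r <= 1 -> disc z r `<=` @disk R.
Proof.
move=> zr w; rewrite /disc /disk /= => wz.
have := cmod_sub_le w z; lra.
Qed.

End area_integrals.

(** * Submean value property of powers of the modulus *)

Section subharmonicity.
Variable R : realType.
Notation mu := (@lebesgue_measure R).
Notation mu2 := (mu \x mu)%E.
Implicit Types (a : nat -> R[i]) (f : R[i] -> R[i]) (z w : R[i]) (r : R).

(** For each w in the disc, N |P(z)| is at most the sum of the |P(z + root * w)|; after integration
    in w the N integrals coincide by rotation. The bound [3 <= N] makes the chosen root of unity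
    nonreal. *)
Lemma mean_inequality_psum a N z r : (3 <= N)%N ->
  ((cmod (psum a N z))%:E * mu2 (@to_complex R @^-1` disc 0%R r) <=
   area_integral (disc z r) (fun x => (cmod (psum a N x))%:E))%E.
Proof.
move=> N3; have N0 : (0 < N)%N by exact: ltn_trans N3.
have NR : 0 < N%:R :> R by rewrite ltr0n.
have w1 : cmod (rootC R N) = 1 by exact: cmod_cexp_i.
have w0 : complex.Im (rootC R N) != 0.
  rewrite gt_eqF//= sin_gt0_pi// divr_gt0 ?mulr_gt0 ?pi_gt0//=.
  rewrite ltr_pdivrMr// mulrC ltr_pM2l ?pi_gt0//.
  by rewrite ltr_nat.
rewrite -(@lee_pmul2l _ N%:R%:E)//.
rewrite muleA -EFinM -area_integral_cst; last exact: area_set_disc.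
have mj (j : nat) : area_fun (disc 0 r) (fun x => (cmod (psum a N (z + rootC R N ^+ j * x)))%:E).
  apply: measurable_funTS; apply/measurable_EFinP.
  have mc : cmeasurable setT (fun t : R * R => z + rootC R N ^+ j * to_complex t).
    apply: cmeasurableD; first exact: cmeasurable_cst.
    by apply: cmeasurableM; [exact: cmeasurable_cst|exact: cmeasurable_to_complex].
  have mp := measurable_cmod (cmeasurable_psum a N).
  exact: (measurable_fun_to_complex_comp (h := fun x => cmod (psum a N x)) mp mc).
have -> : (N%:R%:E * area_integral (disc z r) (fun x => (cmod (psum a N x))%:E) =
    \sum_(j < N) area_integral (disc 0%R r)
      (fun x => (cmod (psum a N (z + rootC R N ^+ j * x)%R))%:E))%E.
  under eq_bigr do rewrite area_integral_disc_rotation//.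
  by rewrite sumr_const card_ord mule_natl.
rewrite /area_integral -ge0_integral_sum//; last 3 first.
- exact: area_set_disc.
- by move=> j; exact: (mj j).
- by move=> j w _; rewrite lee_fin cmod_ge0.
apply: ge0_le_integral => //.
- exact: area_set_disc.
- by move=> w _; rewrite lee_fin mulr_ge0// cmod_ge0.
- by apply: emeasurable_sum => j; exact: (mj j).
move=> w _; rewrite sumEFin lee_fin.
have -> : N%:R * cmod (psum a N z) = cmod (\sum_(j < N) psum a N (z + rootC R N ^+ j * to_complex w)).
  rewrite mean_psum// cmodM; congr (_ * _).
  by rewrite -(rmorph_nat (@real_complex R)) cmod_real ger0_norm.
exact: cmod_sum.
Qed.

Lemma mean_inequality a f z r : power_series_on_disk a f -> 0 < r -> cmod z + r < 1 ->
  ((cmod (f z) * r ^+ 2)%:E <= area_integral (disc z r) (fun w => (cmod (f w))%:E))%E.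
Proof.
move=> af r0 zr1; apply/lee_addgt0Pr => e' e0'.
(* Replacing f by a partial sum costs at most [e] times an area bounded by [4 * r ^+ 2], once under
   the integral and once at the centre. *)
pose e := e' / (8 * r ^+ 2).
have r20 : 0 < r ^+ 2 by rewrite exprn_gt0.
have e0 : 0 < e by rewrite divr_gt0// mulr_gt0.
have zr0 : 0 <= cmod z + r by rewrite addr_ge0 ?cmod_ge0// ltW.
have [n hn] := power_series_uniform af zr0 zr1 e0.
pose N := maxn n 3.
have {}hn x : cmod x <= cmod z + r -> cmod (f x - psum a N x) <= e.
  by apply: hn; rewrite leq_maxl.
have := mean_inequality_psum a z r (leq_maxr n 3); rewrite -/N.
set m := mu2 _; set IP := area_integral _ _; set If := area_integral _ _ => hP.
have m1 : ((r ^+ 2)%:E <= m)%E by exact: disc_area_ge.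
have m2 : (m <= (4 * r ^+ 2)%:E)%E by exact: disc_area_le.
have fm : m \is a fin_num.
  by rewrite ge0_fin_numE ?(le_trans _ m1) ?lee_fin ?ltW// (le_lt_trans m2)// ltry.
pose mr := fine m; have mE : m = mr%:E by rewrite fineK.
have {}m1 : r ^+ 2 <= mr by rewrite -lee_fin -mE.
have {}m2 : mr <= 4 * r ^+ 2 by rewrite -lee_fin -mE.
have ddk : disc z r `<=` @disk R by apply: disc_sub_disk; exact: ltW.
have md : measurable_on_disk f := power_series_measurable af.
have mf : area_fun (disc z r) (fun w => (cmod (f w))%:E).
  by apply/measurable_EFinP; apply: area_fun_cmod => //; exact: area_set_disc.
have hI : (IP <= If + (e * (4 * r ^+ 2))%:E)%E.
  apply: (@le_trans _ _ (area_integral (disc z r) (fun w => (cmod (f w))%:E + e%:E)%E)).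
    apply: le_area_integral.
    - exact: area_set_disc.
    - apply: measurable_funTS; apply/measurable_EFinP.
      by apply: measurable_cmod; exact: cmeasurable_psum.
    - by apply: emeasurable_funD => //; exact: measurable_cst.
    - by move=> w _; rewrite lee_fin cmod_ge0.
    - move=> w; rewrite /disc /= -EFinD lee_fin => wz.
      have /hn : cmod w <= cmod z + r by have := cmod_sub_le w z; lra.
      have := cmod_sub_le (psum a N w) (f w); rewrite (cmodB (psum a N w)); lra.
  rewrite area_integralD//.
  - rewrite area_integral_cst; last exact: area_set_disc.
    by apply: leeD2l; rewrite [leRHS]EFinM lee_pmul2l ?lte_fin//; exact: disc_area_le.
  - exact: area_set_disc.
  - exact: measurable_cst.
  - by move=> w _; rewrite lee_fin cmod_ge0.
  - by move=> w _; rewrite lee_fin ltW.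
have hz : cmod (f z) <= cmod (psum a N z) + e.
  have /hn : cmod z <= cmod z + r by rewrite lerDl ltW.
  by have := cmod_sub_le (f z) (psum a N z); lra.
apply: (@le_trans _ _ (((cmod (psum a N z) + e) * mr)%:E)).
  by rewrite lee_fin ler_pM ?cmod_ge0// ltW.
rewrite mulrDl EFinD EFinM -mE.
apply: (@le_trans _ _ (If + (e * (4 * r ^+ 2))%:E + (e * mr)%:E)%E).
  by rewrite leeD2r// (le_trans hP).
rewrite -addeA -EFinD; apply: leeD2l; rewrite lee_fin.
have -> : e' = e * (8 * r ^+ 2) by rewrite /e divfK// gt_eqF// mulr_gt0.
by rewrite -mulrDr ler_wpM2l ?(ltW e0)//; lra.
Qed.

Lemma area_fun_powR (A : set R[i]) a f q : power_series_on_disk a f -> area_set A ->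
  A `<=` @disk R -> area_fun A (fun w => (cmod (f w) `^ q)%:E).
Proof.
move=> af mA Ad; apply/measurable_EFinP.
apply: (measurableT_comp (measurable_powR q)).
exact: area_fun_cmod (power_series_measurable af) Ad.
Qed.

(** With L = |f(z)|/8, one has |f| <= L + L^(1-q) |f|^q everywhere. Over the disc the constant L
    contributes at most L 4 r^2, half of the left side of the mean inequality, and is absorbed
    there; multiplying by |f(z)|^(q-1) produces the factor 8^(q-1). *)
Lemma subharmonic_ge1 (q : R) a f z r : 1 <= q -> power_series_on_disk a f ->
  0 < r -> cmod z + r < 1 ->
  ((cmod (f z) `^ q * r ^+ 2)%:E <=
   (2 * 8 `^ (q - 1))%:E * area_integral (disc z r) (fun w => (cmod (f w) `^ q)%:E))%E.
Proof.
move=> q1 af r0 zr1.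
have q0 : 0 < q by exact: lt_le_trans q1.
have I0 : (0 <= area_integral (disc z r) (fun w => (cmod (f w) `^ q)%:E))%E.
  by apply: area_integral_ge0 => w _; rewrite lee_fin powR_ge0.
have [fz0|fz0] := eqVneq (cmod (f z)) 0.
  by rewrite fz0 powR0 ?gt_eqF// mul0r mule_ge0// lee_fin mulr_ge0// powR_ge0.
have fz : 0 < cmod (f z) by rewrite lt0r fz0 cmod_ge0.
pose L := cmod (f z) / 8.
have L0 : 0 < L by rewrite divr_gt0.
have ddk : disc z r `<=` @disk R by apply: disc_sub_disk; exact: ltW.
have mq := area_fun_powR q af (area_set_disc z r) ddk.
have m1 : area_fun (disc z r) (fun w => (cmod (f w))%:E).
  apply/measurable_EFinP; apply: area_fun_cmod => //; first exact: area_set_disc.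
  exact: power_series_measurable af.
have h1 := mean_inequality af r0 zr1.
have h2 : (area_integral (disc z r) (fun w => (cmod (f w))%:E) <=
    (L * (4 * r ^+ 2))%:E +
    (L `^ (1 - q))%:E * area_integral (disc z r) (fun w => (cmod (f w) `^ q)%:E))%E.
  apply: (@le_trans _ _ (area_integral (disc z r) (fun w => L%:E + (L `^ (1 - q))%:E * (cmod (f w) `^ q)%:E)%E)).
    apply: le_area_integral => //.
    - exact: area_set_disc.
    - apply: emeasurable_funD; first exact: measurable_cst.
      by apply: emeasurable_funM => //; exact: measurable_cst.
    - by move=> w _; rewrite lee_fin cmod_ge0.
    - move=> w _; rewrite -EFinM -EFinD lee_fin.
      have [wL|Lw] := leP (cmod (f w)) L.
        by rewrite (le_trans wL)// lerDl mulr_ge0 ?powR_ge0.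
      have w0 : 0 < cmod (f w) := lt_trans L0 Lw.
      rewrite [leLHS](_ : _ = cmod (f w) `^ (1 - q) * cmod (f w) `^ q); last first.
        by rewrite -powRD ?subrK ?powRr1 ?(ltW w0)// gt_eqF ?implybT.
      rewrite -[leLHS]add0r lerD ?(ltW L0)// ler_wpM2r ?powR_ge0//.
      have -> : 1 - q = - (q - 1) by rewrite opprB.
      rewrite !powRN lef_pV2 ?posrE ?powR_gt0//.
      by rewrite ge0_ler_powR ?subr_ge0 ?nnegrE ?(ltW L0) ?cmod_ge0 ?(ltW Lw).
  rewrite area_integralD//.
  - rewrite area_integral_cst; last exact: area_set_disc.
    rewrite area_integralZl//.
    + apply: leeD2r; rewrite [leRHS]EFinM lee_pmul2l ?lte_fin//; exact: disc_area_le.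
    + exact: area_set_disc.
    + exact: powR_ge0.
    + by move=> w _; rewrite lee_fin powR_ge0.
  - exact: area_set_disc.
  - exact: measurable_cst.
  - by apply: emeasurable_funM => //; exact: measurable_cst.
  - by move=> w _; rewrite lee_fin ltW.
  - by move=> w _; rewrite -EFinM lee_fin mulr_ge0// powR_ge0.
move: h2 I0; set I := area_integral _ (fun w => (_ `^ q)%:E).
case: I => [I| |] h2 I0 //; last first.
  by rewrite gt0_muley ?leey// lte_fin mulr_gt0// powR_gt0.
have := le_trans h1 h2; rewrite -!EFinM -EFinD !lee_fin => h3.
have h4 : cmod (f z) * r ^+ 2 <= 2 * (L `^ (1 - q) * I).
  have e : L * (4 * r ^+ 2) = cmod (f z) * r ^+ 2 / 2 by rewrite /L; field.
  by move: h3; rewrite e; lra.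
have -> : cmod (f z) `^ q = cmod (f z) `^ (q - 1) * cmod (f z).
  by rewrite -{3}(powRr1 (ltW fz)) -powRD ?subrK// fz0 implybT.
rewrite -mulrA (le_trans (ler_wpM2l (powR_ge0 _ _) h4))//.
have -> : 8 `^ (q - 1) = cmod (f z) `^ (q - 1) * L `^ (1 - q).
  have -> : cmod (f z) = 8 * L by rewrite /L mulrC divfK.
  have LL : L `^ (q - 1) * L `^ (1 - q) = 1.
    by rewrite -(powRD_gt0 _ _ L0)// addrA subrK subrr powRr0.
  by rewrite powRM ?(ltW L0)// -mulrA LL mulr1.
by apply: eq_le_refl; ring.
Qed.

(* Applied on smaller discs, the mean inequality bounds the supremum S of
   (r - |w - z|)^(2/q) |f w| by a multiple of S^(1-q) times the integral. *)
Lemma subharmonic_le1 (q : R) a f z r : 0 < q -> q <= 1 -> power_series_on_disk a f ->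
  0 < r -> cmod z + r < 1 ->
  ((cmod (f z) `^ q * r ^+ 2)%:E <=
   (2 `^ (2 / q))%:E * area_integral (disc z r) (fun w => (cmod (f w) `^ q)%:E))%E.
Proof.
move=> q0 q1 af r0 zr1.
have I0 : (0 <= area_integral (disc z r) (fun w => (cmod (f w) `^ q)%:E))%E.
  by apply: area_integral_ge0 => w _; rewrite lee_fin powR_ge0.
have ddk : disc z r `<=` @disk R by apply: disc_sub_disk; exact: ltW.
have mq := area_fun_powR q af (area_set_disc z r) ddk.
have [B B0 hB] := power_series_bounded af zr1.
move: I0; case IE : (area_integral _ _) => [I| |] I0 //; last first.
  by rewrite gt0_muley ?leey// lte_fin powR_gt0.
rewrite lee_fin in I0; rewrite -EFinM lee_fin.
pose k := 2 / q.
have k0 : 0 < k by rewrite divr_gt0.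
pose E := [set x : R | exists2 w, disc z r w & x = (r - cmod (w - z)) `^ k * cmod (f w)].
have zd : disc z r z by rewrite /disc /= subrr cmod0.
have Ez : E (r `^ k * cmod (f z)) by exists z => //; rewrite subrr cmod0 subr0.
have Eub : has_ubound E.
  exists (r `^ k * B) => _ [w wd ->].
  rewrite ler_pM ?powR_ge0 ?cmod_ge0//; last first.
    by apply: hB; have := cmod_sub_le w z; move: wd; rewrite /disc /=; lra.
  rewrite ge0_ler_powR ?nnegrE ?(ltW k0) ?(ltW r0)//.
    by move: wd; rewrite /disc /= subr_ge0 => /ltW.
  by rewrite gerBl cmod_ge0.
pose S := sup E.
have SE x : E x -> x <= S by move=> Ex; apply: ub_le_sup.
have S0 : 0 <= S by apply: le_trans (SE _ Ez); rewrite mulr_ge0 ?powR_ge0 ?cmod_ge0.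
have rk : (r `^ k) `^ q = r ^+ 2.
  by rewrite -powRrM /k divfK ?gt_eqF// powR_mulrn// ltW.
have main : S `^ q <= 2 `^ k * I.
  have [S00|Sn0] := eqVneq S 0.
    by rewrite S00 powR0 ?gt_eqF// mulr_ge0 ?powR_ge0.
  have Sp : 0 < S by rewrite lt0r Sn0.
  have : S <= 2 `^ k * S `^ (1 - q) * I.
    apply: ge_sup; first by exists (r `^ k * cmod (f z)).
    move=> _ [w wd ->]; pose p := (r - cmod (w - z)) / 2.
    have p0 : 0 < p by rewrite divr_gt0// subr_gt0.
    have wp1 : cmod w + p < 1.
      have := cmod_sub_le w z; have := cmod_ge0 (w - z); rewrite /p.
      by move: wd; rewrite /disc /=; lra.
    have dsub : disc w p `<=` disc z r.
      move=> x; rewrite /disc /= => xw.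
      by have := cmod_dist w x z; move: xw; rewrite /p; move: wd; rewrite /disc /=; lra.
    have mw := area_funS (area_set_disc z r) dsub mq.
    have mw1 : area_fun (disc w p) (fun w => (cmod (f w))%:E).
      apply/measurable_EFinP; apply: area_fun_cmod => //.
      + exact: area_set_disc.
      + exact: power_series_measurable af.
      + exact: subset_trans ddk.
    pose T := (S * p `^ (- k)) `^ (1 - q).
    have h1 := mean_inequality af p0 wp1.
    have h2 : (area_integral (disc w p) (fun w => (cmod (f w))%:E) <= (T * I)%:E)%E.
      apply: (@le_trans _ _ (area_integral (disc w p) (fun x => T%:E * (cmod (f x) `^ q)%:E)%E)).
        apply: le_area_integral => //.
        - exact: area_set_disc.
        - by apply: emeasurable_funM => //; exact: measurable_cst.
        - by move=> x _; rewrite lee_fin cmod_ge0.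
        - move=> x xw; rewrite -EFinM lee_fin.
          have [x0|xn0] := eqVneq (cmod (f x)) 0.
            by rewrite x0 mulr_ge0 ?powR_ge0.
          rewrite [leLHS](_ : _ = cmod (f x) `^ (1 - q) * cmod (f x) `^ q); last first.
            by rewrite -powRD ?subrK ?powRr1 ?cmod_ge0// xn0 implybT.
          rewrite ler_wpM2r ?powR_ge0// ge0_ler_powR ?nnegrE ?subr_ge0 ?mulr_ge0 ?powR_ge0 ?cmod_ge0//.
          rewrite powRN ler_pdivlMr ?powR_gt0// mulrC.
          apply: le_trans (SE _ _); last by exists x; [exact: dsub|reflexivity].
          rewrite ler_wpM2r ?cmod_ge0// ge0_ler_powR ?nnegrE ?(ltW k0) ?(ltW p0)//.
            by have := dsub _ xw; rewrite /disc /= subr_ge0 => /ltW.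
          by have := cmod_dist w x z; move: xw; rewrite /disc /= /p; lra.
      rewrite area_integralZl ?powR_ge0//; last 2 first.
      - exact: area_set_disc.
      - by move=> x _; rewrite lee_fin powR_ge0.
      rewrite EFinM -IE; apply: lee_wpmul2l; first by rewrite lee_fin powR_ge0.
      apply: area_integral_subset => //; [exact: area_set_disc|exact: area_set_disc|].
      by move=> x _; rewrite lee_fin powR_ge0.
    have := le_trans h1 h2; rewrite lee_fin => h3.
    have -> : r - cmod (w - z) = 2 * p by rewrite /p mulrC divfK.
    rewrite powRM ?(ltW p0)// -!mulrA ler_wpM2l ?powR_ge0//.
    have p2 : 0 < p ^+ 2 by rewrite exprn_gt0.
    rewrite -(ler_pM2r p2) -mulrA (le_trans (ler_wpM2l (powR_ge0 _ _) h3))//.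
    have -> : T = S `^ (1 - q) * p `^ (- k * (1 - q)).
      by rewrite /T powRM ?powR_ge0// powRrM.
    have pe : p `^ k * p `^ (- k * (1 - q)) = p ^+ 2.
      rewrite -(powRD_gt0 _ _ p0).
      rewrite -powR_mulrn ?(ltW p0)//; congr (_ `^ _).
      by rewrite /k; field; rewrite gt_eqF.
    by apply: eq_le_refl; rewrite -pe; ring.
  rewrite -{1}(powRr1 S0) -{1}(subrK q 1) powRD; last by rewrite Sn0 implybT.
  by rewrite -[_ * _ * I]mulrA [X in _ <= X]mulrCA ler_pM2l ?powR_gt0.
rewrite (le_trans _ main)// -rk mulrC -powRM ?powR_ge0 ?cmod_ge0//.
by rewrite ge0_ler_powR ?nnegrE ?(ltW q0) ?mulr_ge0 ?powR_ge0 ?cmod_ge0//; exact: SE.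
Qed.

Lemma subharmonic (q : R) : 0 < q -> exists2 C, 0 < C & forall a f z r,
  power_series_on_disk a f -> 0 < r -> cmod z + r < 1 ->
  ((cmod (f z) `^ q * r ^+ 2)%:E <=
   C%:E * area_integral (disc z r) (fun w => (cmod (f w) `^ q)%:E))%E.
Proof.
move=> q0; have [q1|q1] := leP q 1.
- exists (2 `^ (2 / q)); first by rewrite powR_gt0.
  by move=> a f z r; exact: subharmonic_le1.
- exists (2 * 8 `^ (q - 1)); first by rewrite mulr_gt0 ?powR_gt0.
  by move=> a f z r; apply: subharmonic_ge1; exact: ltW.
Qed.

End subharmonicity.

(** * Approach regions *)

Section trigonometry.
Variable R : realType.
Implicit Types x y : R.

Lemma contraction_of_derive (f df : R -> R) : (forall x, is_derive x 1 f (df x)) ->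
  (forall x, `|df x| <= 1) -> forall x y, `|f x - f y| <= `|x - y|.
Proof.
move=> dfx df1 x y.
wlog yx : x y / y <= x.
  move=> h; have [/h//|/ltW xy] := leP y x.
  by rewrite distrC [leRHS]distrC; exact: h.
have [|c _ ->] := MVT_segment yx (fun x _ => dfx x).
  apply: continuous_subspaceT => z; apply: differentiable_continuous.
  exact/derivable1_diffP/ex_derive.
by rewrite normrM ler_piMl.
Qed.

Lemma sin_contraction x y : `|sin x - sin y| <= `|x - y|.
Proof.
apply: (contraction_of_derive (df := cos)) => z; exact: cos_max.
Qed.

Lemma cos_contraction x y : `|cos x - cos y| <= `|x - y|.
Proof.
apply: (contraction_of_derive (df := fun z => - sin z)) => z.
by rewrite normrN sin_max.
Qed.

Lemma normr_atan_le x : `|atan x| <= `|x|.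
Proof.
rewrite -[atan x]subr0 -(@atan0 R) -[in leRHS](subr0 x).
apply: (contraction_of_derive (df := fun z => (1 + z ^+ 2)^-1)) => z.
have h : 0 < 1 + z ^+ 2 by rewrite ltr_pwDl ?sqr_ge0.
by rewrite gtr0_norm ?invr_gt0// invf_le1// lerDl sqr_ge0.
Qed.

Lemma cexp_i_lipschitz x y : cmod (cexp_i x - cexp_i y) <= 2 * `|x - y|.
Proof.
rewrite (le_trans (cmod_le_ReIm _))// mulr_natl mulr2n lerD//.
- exact: cos_contraction.
- exact: sin_contraction.
Qed.

(** The argument is the arctangent of Im z / Re z. Its linear bound in Im z places the argument of a
    point of an approach region within a multiple of 1-|z| of the vertex, once the vertex is rotated
    to 1. *)
Lemma polar_near_real (z : R[i]) : 0 < complex.Re z -> exists2 t : R,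
  `|t| <= `|complex.Im z| / complex.Re z & z = (cmod z)%:C * cexp_i t.
Proof.
case: z => x y /= x0; exists (atan (y / x)).
  by rewrite (le_trans (normr_atan_le _))// normrM normfV (gtr0_norm x0).
have c0 : 0 < 1 + (y / x) ^+ 2 by rewrite ltr_pwDl ?sqr_ge0.
have s0 : 0 < Num.sqrt (1 + (y / x) ^+ 2) by rewrite sqrtr_gt0.
have ct : cos (atan (y / x)) != 0 by rewrite cos_atan invr_eq0 gt_eqF.
have st : sin (atan (y / x)) = y / x * cos (atan (y / x)).
  by rewrite -{2}(atanK (y / x)) /tan divfK.
have cm : cmod (x +i* y) = x * Num.sqrt (1 + (y / x) ^+ 2).
  rewrite cmodE -{2}(ger0_norm (ltW x0)) -sqrtr_sqr -sqrtrM ?sqr_ge0//.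
  by congr Num.sqrt; field; rewrite gt_eqF.
rewrite /cexp_i st cos_atan cm; simpc.
have x0' : x != 0 by rewrite gt_eqF.
have s0' : Num.sqrt (1 + (y / x) ^+ 2) != 0 by rewrite gt_eqF.
by congr (_ +i* _); field; rewrite ?x0' ?s0'.
Qed.

End trigonometry.

Section approach_regions.
Variable R : realType.
Notation mu := (@lebesgue_measure R).
Notation mu2 := (mu \x mu)%E.
Implicit Types (z w : R[i]) (t u : R).

Definition Gam t : set R[i] := Gamma (cexp_i t).

Lemma GamE t z : Gam t z <-> disk z /\ cmod (cexp_i t - z) < 1 - cmod z ^+ 2.
Proof.
rewrite /Gam /Gamma /=.
suff -> : cmod (1 - z * (cexp_i t)^*) = cmod (cexp_i t - z) by [].
rewrite -[RHS]mulr1 -(cmod_cexp_i (- t)) -cmodM mulrBl cexp_iNK.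
by congr (cmod (1 - z * _)); rewrite -cexp_i_conj.
Qed.

Lemma Gam_disk t : Gam t `<=` @disk R.
Proof. by move=> z []. Qed.

Lemma Gam_dist t z : Gam t z -> cmod (cexp_i t - z) < 2 * (1 - cmod z).
Proof.
move=> /GamE[]; rewrite /disk /= => z1 h; apply: lt_le_trans h _.
have z0 := cmod_ge0 z; have -> : 1 - cmod z ^+ 2 = (1 - cmod z) * (1 + cmod z) by ring.
by rewrite mulrC ler_wpM2r; lra.
Qed.

Lemma area_set_Gam t : area_set (Gam t).
Proof.
have -> : Gam t = @disk R `&` [set z | cmod (cexp_i t - z) < 1 - cmod z ^+ 2].
  by apply/seteqP; split => z /GamE.
apply: measurableI; first exact: area_set_disk.
have mc : cmeasurable setT (fun w : R * R => cexp_i t - to_complex w).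
  apply: cmeasurableD; first exact: cmeasurable_cst.
  by apply: cmeasurableN; exact: cmeasurable_to_complex.
apply: (measurable_cmod_ltr mc).
apply: measurable_funB; first exact: measurable_cst.
by apply: measurable_funX; apply: measurable_cmod; exact: cmeasurable_to_complex.
Qed.

(** The domain depends on t, so the integral is written with the indicator of the measurable set of
    pairs (vertex, point); measurability in t is then part of Tonelli's theorem. *)
Lemma measurable_area_Gam (h : R[i] -> \bar R) :
  area_fun (@disk R) h -> (forall z, disk z -> (0 <= h z)%E) ->
  measurable_fun setT (fun t => area_integral (Gam t) h).
Proof.
move=> mh h0.
pose D := @to_complex R @^-1` @disk R.
have mD : measurable D by exact: measurable_disk.
pose h' := (h \o @to_complex R) \_ D.
have mh' : measurable_fun setT h' by apply/(measurable_restrictT _ _).1.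
have h'0 (w : R * R) : (0 <= h' w)%E.
  by rewrite /h' /patch; case: ifPn => //; rewrite inE => /h0.
pose G : set (R * (R * R)) := [set p | cmod (cexp_i p.1 - to_complex p.2) < 1 - cmod (to_complex p.2) ^+ 2].
have m1 : measurable_fun setT (fun p : R * (R * R) => p.1) by exact: measurable_fst.
have m2 : measurable_fun setT (fun p : R * (R * R) => p.2) by exact: measurable_snd.
have mtc : cmeasurable setT (fun p : R * (R * R) => to_complex p.2).
  by have [c1 c2] := @cmeasurable_to_complex R; split; apply: measurableT_comp m2.
have mG : measurable G.
  have mc : cmeasurable setT (fun p : R * (R * R) => cexp_i p.1 - to_complex p.2).
    apply: cmeasurableD; last exact: cmeasurableN.
    split; apply: measurableT_comp m1; apply: continuous_measurable_fun.
    - exact: continuous_cos.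
    - exact: continuous_sin.
  apply: (measurable_cmod_ltr mc).
  apply: measurable_funB; first exact: measurable_cst.
  by apply: measurable_funX; apply: measurable_cmod.
pose F (p : R * (R * R)) : \bar R := ((\1_G p)%:E * h' p.2)%E.
have mF : measurable_fun setT F.
  apply: emeasurable_funM; last exact: measurableT_comp m2.
  exact/measurable_EFinP/measurable_indic.
have F0 p : (0 <= F p)%E by rewrite mule_ge0// lee_fin.
have mI : measurable_fun setT (fun t => \int[mu2]_w F (t, w))%E.
  (* Regrouping (t, (x, y)) as ((t, x), y) lets the measurability of partial integrals be used
     twice, for y and then for x. *)
  pose F1 (p : (R * R) * R) := F (p.1.1, (p.1.2, p.2)).
  have mF1 : measurable_fun setT F1.
    apply: (measurableT_comp mF).
    have p1 : measurable_fun setT (fun p : (R * R) * R => p.1) by exact: measurable_fst.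
    have p2 : measurable_fun setT (fun p : (R * R) * R => p.2) by exact: measurable_snd.
    apply: measurable_fun_pair; first exact: (measurableT_comp measurable_fst p1).
    by apply: measurable_fun_pair => //; exact: (measurableT_comp measurable_snd p1).
  have mF2 := @measurable_fun_fubini_tonelli_F _ _ _ _ R mu F1 mF1 (fun _ => F0 _).
  have mF3 := @measurable_fun_fubini_tonelli_F _ _ _ _ R mu _ mF2
    (fun p => @integral_ge0 _ _ _ mu setT _ (fun y _ => F0 _)).
  apply: eq_measurable_fun mF3 => t _.
  rewrite (@plane_fubini1 R (fun w : R * R => F (t, w)))//.
  exact: (measurableT_comp mF).
apply: eq_measurable_fun mI => t _.
rewrite /area_integral [RHS]integral_mkcond.
apply: eq_integral => w _; rewrite /F /h' /patch indicE.
have [wG|] := boolP (w \in @to_complex R @^-1` Gam t).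
  have /GamE[wd wt] : Gam t (to_complex w) by move: wG; rewrite inE.
  have -> : w \in D by rewrite inE.
  by rewrite mem_set// mul1e.
move=> /negP wG; have [wD|] := boolP (w \in D); last by rewrite mule0.
rewrite memNset ?mul0e// => wt; apply: wG; rewrite inE; apply/GamE; split => //.
by move: wD; rewrite inE.
Qed.

Lemma area_integral_Gam_periodic h t : area_integral (Gam (t + pi *+ 2)) h = area_integral (Gam t) h.
Proof.
by rewrite /Gam /cexp_i cosD2pi sinD2pi.
Qed.

(* Here s is the argument of z. *)
Lemma Gam_arc t z : Gam t z -> 1 / 2 < cmod z -> exists2 s : R,
  `|s - t| <= 8 * (1 - cmod z) &
  forall u, `|u - s| < (1 - cmod z) / 20 ->
    disc z ((1 - cmod z) / 20) `<=` Gam u.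
Proof.
move=> zt z2; have [zd zt'] := (GamE t z).1 zt.
have z1 : cmod z < 1 by [].
pose w := z * cexp_i (- t).
have cw : cmod w = cmod z by rewrite cmodM cmod_cexp_i mulr1.
have w1 : cmod (1 - w) < 1 - cmod z ^+ 2.
  rewrite -(mulr1 (cmod _)) -(cmod_cexp_i t) -cmodM mulrBl mul1r /w.
  by rewrite -mulrA (mulrC (cexp_i (- t))) cexp_iNK mulr1 cmod_cexp_i.
have Rw : 1 / 4 <= complex.Re w.
  have := le_lt_trans (Re_le_cmod _) w1.
  have -> : complex.Re (1 - w) = 1 - complex.Re w by case: (w).
  move=> /(le_lt_trans (ler_norm _)) h.
  have : (1 / 2) ^+ 2 < cmod z ^+ 2 by rewrite ltr_pXn2r ?nnegrE ?cmod_ge0//; lra.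
  by rewrite expr2; lra.
have Iw : `|complex.Im w| <= 2 * (1 - cmod z).
  have := le_lt_trans (Im_le_cmod _) w1.
  have -> : complex.Im (1 - w) = - complex.Im w by case: (w) => a b /=; rewrite sub0r.
  rewrite normrN => /ltW h; apply: le_trans h _.
  have -> : 1 - cmod z ^+ 2 = (1 - cmod z) * (1 + cmod z) by ring.
  by rewrite mulrC ler_wpM2r; lra.
have [|s0 hs0 wE] := @polar_near_real R w; first by lra.
exists (s0 + t).
  rewrite addrK (le_trans hs0)// ler_pdivrMr; last by lra.
  rewrite (le_trans Iw)//.
  have : 0 <= (1 - cmod z) * (complex.Re w - 1 / 4) by rewrite mulr_ge0//; lra.
  lra.
have zE : z = (cmod z)%:C * cexp_i (s0 + t).
  by rewrite cexp_iD mulrA -cw -wE /w -mulrA (mulrC (cexp_i (- t))) cexp_iNK mulr1.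
move=> u us x; rewrite /disc /= => xz; apply/GamE.
have xm := cmod_sub_le x z; have xm' := cmod_sub_le z x.
rewrite cmodB in xm'.
have x1 : cmod x < 1 by lra.
split; first exact: x1.
have h1 : cmod (cexp_i u - cexp_i (s0 + t)) <= (1 - cmod z) / 10.
  apply: le_trans (cexp_i_lipschitz _ _) _.
  by move: (ltW us); lra.
have h2 : cmod (cexp_i (s0 + t) - z) = 1 - cmod z.
  rewrite {1}zE -{1}(mul1r (cexp_i _)) -mulrBl cmodM cmod_cexp_i mulr1.
  rewrite -[1 - _]/((1 : R)%:C - (cmod z)%:C) -rmorphB cmod_real.
  by rewrite ger0_norm// subr_ge0 ltW.
have h3 := cmod_dist (cexp_i (s0 + t)) (cexp_i u) x.
have h4 := cmod_dist z (cexp_i (s0 + t)) x.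
rewrite (cmodB z x) in h4.
have -> : 1 - cmod x ^+ 2 = (1 - cmod x) * (1 + cmod x) by ring.
have h5 : (1 - cmod z) * (19 / 20) * (1 + 1 / 2 - (1 - cmod z) / 20) <= (1 - cmod x) * (1 + cmod x).
  by apply: ler_pM; lra.
nra.
Qed.

End approach_regions.

(** * Discrete layer-cake sums *)

Section series_and_layers.
Variable R : realType.
Implicit Types (x : \bar R) (u : nat -> \bar R).
Local Open Scope ereal_scope.

Definition ebool (b : bool) : \bar R := b%:R%:E.

Lemma nneseries_le_bound u (M : \bar R) : (forall k, 0 <= u k) ->
  (forall n, \sum_(0 <= k < n) u k <= M) -> \sum_(0 <= k <oo) u k <= M.
Proof.
move=> u0 uM; apply: lime_le; first by apply: is_cvg_nneseries => k _ _; exact: u0.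
by apply: nearW => n; exact: uM.
Qed.

Lemma nneseries_ge_partial u n : (forall k, 0 <= u k) ->
  \sum_(0 <= k < n) u k <= \sum_(0 <= k <oo) u k.
Proof. by move=> u0; apply: nneseries_lim_ge => k _ _; exact: u0. Qed.

Lemma nneseries_ge_term u n : (forall k, 0 <= u k) -> u n <= \sum_(0 <= k <oo) u k.
Proof.
move=> u0; apply: le_trans (nneseries_ge_partial n.+1 u0).
by rewrite big_nat_recr//= leeDr// sume_ge0.
Qed.

Lemma nneseries_geometric_le (c t : R) : (0 <= c)%R -> (0 <= t < 1)%R ->
  \sum_(0 <= k <oo) (c * t ^+ k)%:E <= (c / (1 - t))%:E.
Proof.
move=> c0 /andP[t0 t1]; apply: nneseries_le_bound => [k|n].
  by rewrite lee_fin mulr_ge0// exprn_ge0.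
rewrite sumEFin lee_fin -mulr_sumr ler_wpM2l//.
by rewrite (le_trans (sum_geometric_le _ _ t0 t1))// expr0 mul1r.
Qed.

(** The sum counts the integers from [K] on that lie below [x]. The induction bounds the truncation
    of [x] at K + n, which also treats an infinite [x]. *)
Lemma le_layers x (K : nat) : 0 <= x ->
  x <= K%:R%:E + \sum_(0 <= k <oo) ebool ((K + k)%:R%:E < x).
Proof.
move=> x0; pose u k : \bar R := ebool ((K + k)%:R%:E < x).
have u0 k : 0 <= u k by rewrite lee_fin.
have h n : mine (K + n)%:R%:E x <= K%:R%:E + \sum_(0 <= k < n) u k.
  elim: n => [|n ih]; first by rewrite big_geq// adde0 addn0 ge_min lexx.
  rewrite big_nat_recr//= addeA {2}/u /ebool.
  have [nx|xn] := ltP (K + n)%:R%:E x.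
    rewrite (le_trans _ (leeD2r _ ih))// (min_l (ltW nx)).
    by rewrite ge_min -EFinD natr1 -addnS lexx.
  by rewrite adde0 (le_trans _ ih)// [leRHS]min_r// ge_min lexx orbT.
have {}h n : mine (K + n)%:R%:E x <= K%:R%:E + \sum_(0 <= k <oo) u k.
  by rewrite (le_trans (h n))// leeD2l//; exact: nneseries_ge_partial.
case: x x0 {u0} @u h => [r| |] // r0 u h.
- have [n rn] : exists n : nat, (r <= n%:R)%R.
    by exists (Num.truncn r).+1; rewrite ltW// truncnS_gt.
  rewrite (le_trans _ (h n))// le_min lexx andbT lee_fin.
  by rewrite (le_trans rn)// ler_nat leq_addl.
- rewrite leye_eq; apply/eqP/eqyP => A A0.
  have [n rn] : exists n : nat, (A <= n%:R)%R.
    by exists (Num.truncn A).+1; rewrite ltW// truncnS_gt.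
  rewrite (le_trans _ (h n))// le_min leey andbT lee_fin.
  by rewrite (le_trans rn)// ler_nat leq_addl.
Qed.

Lemma layers_le x : 0 <= x -> \sum_(0 <= k <oo) ebool (k.+1%:R%:E < x) <= x.
Proof.
move=> x0; pose u k : \bar R := ebool (k.+1%:R%:E < x).
have u0 k : 0 <= u k by rewrite lee_fin.
apply: nneseries_le_bound => // n.
suff : \sum_(0 <= k < n) u k <= mine n%:R%:E x by rewrite le_min => /andP[].
elim: n => [|n ih]; first by rewrite big_geq// le_min lexx.
rewrite big_nat_recr//= {2}/u /ebool; have [nx|xn] := ltP n.+1%:R%:E x.
  by rewrite -natr1 EFinD; apply: leeD => //; rewrite (le_trans ih)// ge_min lexx.
by rewrite adde0 (le_trans ih)// ge_min lexx orbT.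
Qed.

End series_and_layers.

Section covering.
Variable R : realType.

Lemma ge0_integral_cover d (T : measurableType d) (m : {measure set T -> \bar R})
    (A : set T) (F : nat -> set T) (h : T -> \bar R) : measurable A ->
  (forall k, measurable (F k)) -> A `<=` \bigcup_k F k ->
  measurable_fun A h -> (forall k, measurable_fun (F k) h) -> (forall x : T, (0 <= h x)%E) ->
  (\int[m]_(x in A) h x <= \sum_(0 <= k <oo) \int[m]_(x in F k) h x)%E.
Proof.
move=> mA mF AF mAh mFh h0.
have H0 B (x : T) : (0 <= (h \_ B) x)%E by rewrite /patch; case: ifP.
have mH B : measurable B -> measurable_fun B h -> measurable_fun setT (h \_ B).
  by move=> mB; apply: (measurable_restrictT _ mB).1.
rewrite integral_mkcond; under eq_eseriesr do rewrite integral_mkcond.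
rewrite -integral_nneseries//; last by move=> k; apply: mH.
apply: ge0_le_integral => //.
- exact: mH.
- by apply: ge0_emeasurable_sum => k; [move=> *; exact: H0|move=> _; exact: mH].
move=> x _; rewrite {1}/patch; case: ifPn => [|_]; last first.
  by apply: nneseries_ge0 => k _ _; exact: H0.
rewrite inE => /AF[k _ Fk].
apply: le_trans (nneseries_ge_term k (fun k => H0 (F k) x)).
by rewrite /patch mem_set.
Qed.

End covering.

Section powers_of_comparable.
Variable R : realType.

Lemma powR_exprn (x e : R) n : 0 <= x -> (x ^+ n) `^ e = (x `^ e) ^+ n.
Proof.
move=> x0; rewrite -(powR_mulrn n x0) -(powR_mulrn n (powR_ge0 _ _)) -!powRrM.
by rewrite mulrC.
Qed.

Lemma powR_comparable (e x y : R) : 0 < x -> x / 2 <= y -> y <= 2 * x ->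
  y `^ e <= 2 `^ `|e| * x `^ e.
Proof.
move=> x0 xy yx; have y0 : 0 < y by apply: lt_le_trans xy; rewrite divr_gt0.
have [e0|e0] := leP 0 e.
  rewrite ger0_norm// -powRM// ?(ltW x0)//.
  by rewrite ge0_ler_powR ?nnegrE ?(ltW y0) ?mulr_ge0 ?(ltW x0).
rewrite ltr0_norm//; have -> : y `^ e = (y `^ (- e))^-1 by rewrite -powRN opprK.
have -> : x `^ e = (x `^ (- e))^-1 by rewrite -powRN opprK.
have ne : 0 <= - e by rewrite oppr_ge0 ltW.
rewrite ler_pdivlMr ?powR_gt0// ler_pdivrMl ?powR_gt0// -powRM ?(ltW y0)//.
rewrite ge0_ler_powR ?nnegrE ?(ltW x0) ?mulr_ge0 ?(ltW y0)//.
by move: xy; rewrite ler_pdivrMr// mulrC.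
Qed.

Lemma powR_comparable_ge (e x y : R) : 0 < x -> x / 2 <= y -> y <= 2 * x ->
  x `^ e <= 2 `^ `|e| * y `^ e.
Proof.
move=> x0 xy yx; apply: powR_comparable; last by lra.
- by apply: lt_le_trans xy; rewrite divr_gt0.
- by lra.
Qed.

End powers_of_comparable.

(** * Powers of the depth on dyadic shells of an approach region *)

Section shells.
Variable R : realType.
Implicit Types (z w : R[i]) (t u : R) (A : set R[i]) (h : R[i] -> \bar R).

Lemma area_integral_cover A (F : nat -> set R[i]) h : area_set A ->
  (forall k, area_set (F k)) -> A `<=` \bigcup_k F k ->
  area_fun A h -> (forall k, area_fun (F k) h) -> (forall z, (0 <= h z)%E) ->
  (area_integral A h <= \sum_(0 <= k <oo) area_integral (F k) h)%E.
Proof.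
move=> mA mF AF mAh mFh h0; apply: ge0_integral_cover => //.
by move=> w /AF[k _ wk]; exists k.
Qed.

Definition depth z := 1 - cmod z.

Definition depth_lt (r : R) : set R[i] := [set z | depth z < r].
Definition depth_ge (r : R) : set R[i] := [set z | r <= depth z].

Lemma depth_gt0 z : disk z -> 0 < depth z.
Proof. by rewrite subr_gt0. Qed.

Lemma depth_le1 z : depth z <= 1.
Proof. by rewrite gerBl cmod_ge0. Qed.

Lemma measurable_depth : measurable_fun setT (fun w : R * R => depth (to_complex w)).
Proof.
apply: measurable_funB; first exact: measurable_cst.
by apply: measurable_cmod; exact: cmeasurable_to_complex.
Qed.

Lemma area_fun_depth A (e : R) : area_fun A (fun z => (depth z `^ e)%:E).
Proof.
apply: measurable_funTS; apply/measurable_EFinP.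
by apply: (measurableT_comp (measurable_powR e)); exact: measurable_depth.
Qed.

Lemma area_set_depth_lt (t : R) : area_set (depth_lt t).
Proof.
have := measurable_fun_ltr measurable_depth (measurable_cst t).
by move=> /(_ measurableT [set true] I); rewrite setTI.
Qed.

Lemma area_set_depth_ge (t : R) : area_set (depth_ge t).
Proof.
have := measurable_fun_ler (measurable_cst t) measurable_depth.
by move=> /(_ measurableT [set true] I); rewrite setTI.
Qed.

Definition shell t (r : R) : set R[i] := Gam t `&` [set z | r <= depth z < 2 * r].

Lemma area_set_shell t r : area_set (shell t r).
Proof.
rewrite (_ : shell t r = Gam t `&` depth_ge r `&` depth_lt (2 * r)).
  apply: measurableI; last exact: area_set_depth_lt.
  by apply: measurableI; [exact: area_set_Gam|exact: area_set_depth_ge].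
apply/seteqP; split => z; first by move=> [zt /andP[]].
by move=> [[zt h1] h2]; split => //; apply/andP.
Qed.

(** Points of the shell are within 4r of the vertex, whence an area of at most 4 (4r)^2 = 64 r^2. *)
Lemma shell_integral_le t r (e : R) : 0 < r ->
  (area_integral (shell t r) (fun z => (depth z `^ e)%:E) <=
   (64 * 2 `^ `|e| * r `^ (e + 2))%:E)%E.
Proof.
move=> r0.
have shd : shell t r `<=` disc (cexp_i t) (4 * r).
  move=> z [/Gam_dist h /andP[_ h2]]; rewrite /disc /= cmodB.
  by apply: lt_trans h _; move: h2; rewrite /depth; lra.
apply: (@le_trans _ _ (area_integral (shell t r) (fun=> (2 `^ `|e| * r `^ e)%:E))).
  apply: le_area_integral.
  - exact: area_set_shell.
  - exact: area_fun_depth.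
  - exact: measurable_cst.
  - by move=> z _; rewrite lee_fin powR_ge0.
  - move=> z [_ /andP[h1 h2]]; rewrite lee_fin; apply: powR_comparable => //; lra.
rewrite area_integral_cst; last exact: area_set_shell.
apply: (@le_trans _ _ ((2 `^ `|e| * r `^ e)%:E * (4 * (4 * r) ^+ 2)%:E)%E).
  apply: lee_wpmul2l; first by rewrite lee_fin mulr_ge0 ?powR_ge0.
  apply: le_trans (disc_area_le (cexp_i t) (mulr_gt0 _ r0)) => //.
  apply: le_measure; rewrite ?inE.
  - exact: area_set_shell.
  - exact: measurable_disc.
  - by move=> w; exact: shd.
rewrite -EFinM lee_fin (powRD_gt0 _ _ r0).
rewrite (powR_mulrn 2) ?(ltW r0)//; apply: eq_le_refl; ring.
Qed.

(** A shell at depth r has area of order r^2 and contributes r^(e+2). Dyadic shells thus form a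
    geometric series, summed towards the vertex when e+2 > 0 and away from it when e+2 < 0. *)
Lemma Gam_integral_shells t A (rho : nat -> R) (e K x : R) : area_set A -> 0 <= K -> 0 <= x < 1 ->
  (forall k, 0 < rho k) -> A `<=` \bigcup_k shell t (rho k) ->
  (forall k, rho k `^ (e + 2) <= K * x ^+ k) ->
  (area_integral A (fun z => (depth z `^ e)%:E) <= (64 * 2 `^ `|e| * K / (1 - x))%:E)%E.
Proof.
move=> mA K0 x1 rho0 AF rhoK.
have C0 : 0 <= 64 * 2 `^ `|e| * K by rewrite !mulr_ge0// powR_ge0.
apply: le_trans (nneseries_geometric_le C0 x1).
apply: (@le_trans _ _ (\sum_(0 <= k <oo) area_integral (shell t (rho k)) (fun z => (depth z `^ e)%:E))%E).
  apply: area_integral_cover => //.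
  - by move=> k; exact: area_set_shell.
  - exact: area_fun_depth.
  - by move=> k; exact: area_fun_depth.
  - by move=> z; rewrite lee_fin powR_ge0.
apply: lee_nneseries => k _; first by move=> _; apply: area_integral_ge0 => z _; rewrite lee_fin powR_ge0.
apply: le_trans (shell_integral_le t e (rho0 k)) _.
by rewrite lee_fin -[leRHS]mulrA ler_wpM2l// mulr_ge0// powR_ge0.
Qed.

Lemma Gam_integral_depth_lt (a : R) : 0 < a -> exists2 C, 0 <= C & forall t r, 0 < r ->
  (area_integral (Gam t `&` depth_lt r) (fun z => (depth z `^ (a - 2))%:E) <=
   (C * r `^ a)%:E)%E.
Proof.
move=> a0; have x1 := half_powR_lt1 a0; set x := 2^-1 `^ a in x1.
have x1' : 0 <= 1 - x by case/andP: x1 => _; lra.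
exists (64 * 2 `^ `|a - 2| / (1 - x)); first by rewrite divr_ge0// mulr_ge0// powR_ge0.
move=> t r r0; rewrite mulrAC.
apply: (@Gam_integral_shells t _ (fun k => r * 2^-1 ^+ k.+1)) => //.
- by apply: measurableI; [exact: area_set_Gam|exact: area_set_depth_lt].
- exact: powR_ge0.
- by move=> k; rewrite mulr_gt0// exprn_gt0.
- move=> z [zt zr]; have z0 : 0 < depth z by apply: depth_gt0; exact: Gam_disk zt.
  by have [k hk] := dyadic_below z0 zr; exists k.
move=> k; rewrite subrK powRM ?(ltW r0) ?exprn_ge0// ler_wpM2l ?powR_ge0//.
rewrite /x -powR_exprn// ge0_ler_powR ?nnegrE ?(ltW a0) ?exprn_ge0// exprS ler_piMl ?exprn_ge0//.
by lra.
Qed.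

Lemma Gam_integral_depth_ge (b : R) : 0 < b -> exists2 C, 0 <= C & forall t r, 0 < r ->
  (area_integral (Gam t `&` depth_ge r) (fun z => (depth z `^ (- b - 2))%:E) <=
   (C * r `^ (- b))%:E)%E.
Proof.
move=> b0; have x1 := half_powR_lt1 b0; set x := 2^-1 `^ b in x1.
have x1' : 0 <= 1 - x by case/andP: x1 => _; lra.
exists (64 * 2 `^ `|- b - 2| / (1 - x)); first by rewrite divr_ge0// mulr_ge0// powR_ge0.
move=> t r r0; rewrite mulrAC.
apply: (@Gam_integral_shells t _ (fun k => r * 2 ^+ k)) => //.
- by apply: measurableI; [exact: area_set_Gam|exact: area_set_depth_ge].
- exact: powR_ge0.
- by move=> k; rewrite mulr_gt0// exprn_gt0.
- move=> z [zt zr]; have z0 : 0 < depth z by apply: depth_gt0; exact: Gam_disk zt.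
  have ex : exists k, depth z < r * 2 ^+ k.+1.
    have [||N hN] := @geometric_lt R 2^-1 (depth z) r _ _ r0; [lra|lra|].
    exists N; have := hN N.+1 (leqnSn N).
    by rewrite exprVn ltr_pdivrMr// exprn_gt0.
  case: (ex_minnP ex) => k hk kmin; exists k => //; split => //; apply/andP; split; last first.
    by move: hk; rewrite exprS; lra.
  case: k hk kmin => [|k] hk kmin; first by rewrite expr0 mulr1.
  by rewrite leNgt; apply/negP => /kmin; rewrite ltnn.
move=> k; rewrite subrK powRM ?(ltW r0) ?exprn_ge0// ler_wpM2l ?powR_ge0//.
have k0 : 0 <= (2 : R) ^+ k by rewrite exprn_ge0.
by rewrite /x -powR_exprn// exprVn -(powR_inv1 k0) -powRrM mulN1r.
Qed.

End shells.

(** * The area functional and its pointwise control of the transform *)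

Section tent_norms.
Variable R : realType.
Notation mu := (@lebesgue_measure R).
Implicit Types (z w : R[i]) (t u : R) (G : R[i] -> R[i]) (p q s : R).

(** The function W of the overview: [G] is the transform, and [s] its exponent minus the smoothness
    index of the space. *)
Definition wmod s G z : R := depth z `^ s * cmod (G z).

(** The literal integrand of the tent norm with weight -2. The next lemmas replace 1-|z|^2 by the
    depth, each at the cost of a factor 4. *)
Definition tent_density q s G z : R :=
  cmod (((1 - cmod z) `^ s)%:C * G z) `^ q * (1 - cmod z ^+ 2) `^ (- 2).

Definition tent_area q s G t : \bar R :=
  area_integral (Gam t) (fun z => (tent_density q s G z)%:E).

Lemma tent_normpE p q s G :
  tent_normp p q (- 2) (fun z => ((1 - cmod z) `^ s)%:C * G z) =
  (\int[mu]_(t in `[0%R, (2 * pi)%R[) (tent_area q s G t `^ (p / q)))%E.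
Proof. by []. Qed.

Lemma wmod_ge0 s G z : 0 <= wmod s G z.
Proof. by rewrite mulr_ge0 ?powR_ge0 ?cmod_ge0. Qed.

Lemma tent_densityE q s G z :
  tent_density q s G z = wmod s G z `^ q * (1 - cmod z ^+ 2) `^ (- 2).
Proof. by rewrite /tent_density /wmod cmodM cmod_real ger0_norm ?powR_ge0. Qed.

Lemma tent_density_ge0 q s G z : 0 <= tent_density q s G z.
Proof. by rewrite mulr_ge0 ?powR_ge0. Qed.

Lemma tent_area_ge0 q s G t : (0 <= tent_area q s G t)%E.
Proof. by apply: area_integral_ge0 => z _; rewrite lee_fin tent_density_ge0. Qed.

Lemma depth_comparable z : disk z ->
  depth z / 2 <= 1 - cmod z ^+ 2 /\ 1 - cmod z ^+ 2 <= 2 * depth z.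
Proof.
rewrite /disk /depth /= => z1; have z0 := cmod_ge0 z; split; nra.
Qed.

Lemma powR2_2 : 2 `^ `|- 2| = 4 :> R.
Proof. by rewrite normrN ger0_norm// powR_mulrn//; ring. Qed.

Lemma tent_density_le q s G z : disk z ->
  tent_density q s G z <= 4 * (wmod s G z `^ q * depth z `^ (- 2)).
Proof.
move=> z1; have [h1 h2] := depth_comparable z1.
rewrite tent_densityE mulrCA ler_wpM2l ?powR_ge0// -powR2_2.
by apply: powR_comparable => //; exact: depth_gt0.
Qed.

Lemma tent_density_ge q s G z : disk z ->
  wmod s G z `^ q * depth z `^ (- 2) <= 4 * tent_density q s G z.
Proof.
move=> z1; have [h1 h2] := depth_comparable z1.
rewrite tent_densityE mulrCA ler_wpM2l ?powR_ge0// -powR2_2.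
by apply: powR_comparable_ge => //; exact: depth_gt0.
Qed.

Lemma measurable_wmod s G : measurable_on_disk G ->
  measurable_fun (@to_complex R @^-1` @disk R) (fun w : R * R => wmod s G (to_complex w)).
Proof.
move=> mG; apply: measurable_funM.
- apply: measurable_funTS.
  by apply: (measurableT_comp (measurable_powR s)); exact: measurable_depth.
- by apply: area_fun_cmod => //; exact: area_set_disk.
Qed.

Lemma area_fun_tent_density q s G : measurable_on_disk G ->
  area_fun (@disk R) (fun z => (tent_density q s G z)%:E).
Proof.
move=> mG; apply/measurable_EFinP.
rewrite [X in measurable_fun _ X](_ : _ = (fun w : R * R => wmod s G (to_complex w) `^ q) \*
  (fun w : R * R => (1 - cmod (to_complex w) ^+ 2) `^ (- 2))); last first.
  by apply/funext => w; rewrite /= tent_densityE.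
apply: measurable_funM.
  by apply: (measurableT_comp (measurable_powR q)); exact: measurable_wmod.
apply: measurable_funTS; apply: (measurableT_comp (measurable_powR (- 2))).
apply: measurable_funB; first exact: measurable_cst.
by apply: measurable_funX; apply: measurable_cmod; exact: cmeasurable_to_complex.
Qed.

Lemma area_fun_tent_density_Gam q s G t : measurable_on_disk G ->
  area_fun (Gam t) (fun z => (tent_density q s G z)%:E).
Proof.
move=> mG; apply: area_funS (@Gam_disk _ t) (area_fun_tent_density q s mG).
exact: area_set_disk.
Qed.

Lemma measurable_tent_area q s G : measurable_on_disk G ->
  measurable_fun setT (tent_area q s G).
Proof.
move=> mG; apply: measurable_area_Gam; first exact: area_fun_tent_density.
by move=> z _; rewrite lee_fin tent_density_ge0.
Qed.

Lemma measurable_tent_area_poweR q s G e : measurable_on_disk G ->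
  measurable_fun setT (fun t => tent_area q s G t `^ e)%E.
Proof.
by move=> mG; apply: (measurableT_comp (measurable_poweR e)); exact: measurable_tent_area.
Qed.

(** The disc of radius [depth z / 20] about z lies in every approach region whose vertex belongs to
    the arc, and on it the depth is within a factor 2 of [depth z]. The weights can therefore be
    pulled out of the submean value inequality, with a constant independent of [G]. *)
Lemma wmod_le_tent_area q s : 0 < q -> exists2 C, 0 < C &
  forall a G, power_series_on_disk a G -> forall t z, Gam t z -> 1 / 2 < cmod z ->
  exists2 t0 : R, `|t0 - t| <= 8 * depth z &
    forall u, `|u - t0| < depth z / 20 ->
      ((wmod s G z `^ q)%:E <= C%:E * tent_area q s G u)%E.
Proof.
move=> q0; have [C0 C00 hC] := subharmonic q0.
pose K := 2 `^ `|- (s * q)| : R.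
have K0 : 0 < K by rewrite powR_gt0.
(* [c] undoes the square of the radius. In [C], the factor [K] compares the powers of the depth with
   exponent -sq, one 4 comes from [tent_density_ge], and the other from the square of the depth. *)
pose c : R := 20 ^+ 2.
have c0 : 0 < c by rewrite exprn_gt0.
pose C := C0 * (c * (K * 4 * 4)).
have C'0 : 0 < C.
  by apply: mulr_gt0 => //; apply: mulr_gt0 => //; apply: mulr_gt0 => //; apply: mulr_gt0.
exists C => // a G aG t z zt z2.
have zd := Gam_disk zt; have d0 := depth_gt0 zd.
have [t0 ht0 harc] := Gam_arc zt z2; exists t0 => // u ut.
have {harc} := harc u ut; rewrite -/(depth z) => sub.
have r0 : 0 < depth z / 20 by rewrite divr_gt0.
have zr : cmod z + depth z / 20 < 1 by rewrite /depth; move: d0; rewrite /depth; lra.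
have h := hC a G z _ aG r0 zr.
have mG := power_series_measurable aG.
have ddk : disc z (depth z / 20) `<=` @disk R by apply: disc_sub_disk; exact: ltW.
pose L := K * 4 * 4 * depth z `^ (- (s * q)) * depth z ^+ 2.
have L0 : 0 <= L by rewrite !mulr_ge0 ?powR_ge0 ?exprn_ge0 ?(ltW d0) ?(ltW K0).
have h2 : (area_integral (disc z (depth z / 20)) (fun w => (cmod (G w) `^ q)%:E) <=
    L%:E * tent_area q s G u)%E.
  apply: (@le_trans _ _ (area_integral (disc z (depth z / 20)) (fun w => (L%:E * (tent_density q s G w)%:E)%E))).
    have mt := area_funS (@area_set_disk R) ddk (area_fun_tent_density q s mG).
    apply: le_area_integral.
    - exact: area_set_disc.
    - exact: area_fun_powR aG (area_set_disc _ _) ddk.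
    - by apply: emeasurable_funM => //; exact: measurable_cst.
    - by move=> w _; rewrite lee_fin powR_ge0.
    - move=> w wz; rewrite -EFinM lee_fin.
      have wd := ddk _ wz; have dw0 := depth_gt0 wd.
      have [h3 h4] : depth z / 2 <= depth w /\ depth w <= 2 * depth z.
        have := cmod_sub_le w z; have := cmod_sub_le z w; rewrite (cmodB z w).
        by move: wz r0; rewrite /disc /depth /=; lra.
      have e1 : wmod s G w `^ q = depth w `^ (s * q) * cmod (G w) `^ q.
        by rewrite /wmod powRM ?powR_ge0 ?cmod_ge0// powRrM.
      have h5 := tent_density_ge q s G wd.
      have h6 : depth w `^ (- (s * q)) <= K * depth z `^ (- (s * q)) by exact: powR_comparable.
      have h7 : 1 <= 4 * (depth z ^+ 2 * depth w `^ (- 2)).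
        rewrite powR_invn ?(ltW dw0)// mulrA ler_pdivlMr ?exprn_gt0// mul1r.
        have : depth w ^+ 2 <= (2 * depth z) ^+ 2.
          by rewrite lerXn2r ?nnegrE ?mulr_ge0 ?(ltW dw0) ?(ltW d0).
        by rewrite exprMn; congr (_ <= _ * _); ring.
      have e2 : cmod (G w) `^ q = depth w `^ (- (s * q)) * wmod s G w `^ q.
        rewrite e1 mulrA -(powRD_gt0 _ _ dw0)//.
        by rewrite addNr powRr0 mul1r.
      have g0 : 0 <= wmod s G w `^ q by rewrite powR_ge0.
      have A0 : 0 <= depth z `^ (- (s * q)) by rewrite powR_ge0.
      have h8 : wmod s G w `^ q <= 16 * depth z ^+ 2 * tent_density q s G w.
        have h9 := ler_wpM2l g0 h7; rewrite mulr1 in h9.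
        apply: le_trans h9 _.
        have dz2 : 0 <= 4 * depth z ^+ 2 by rewrite mulr_ge0// exprn_ge0// ltW.
        have := ler_wpM2l dz2 h5; rewrite !mulrA; congr (_ <= _); ring.
      rewrite e2 (le_trans (ler_wpM2r g0 h6))//.
      have KA : 0 <= K * depth z `^ (- (s * q)) by rewrite mulr_ge0// ltW.
      by apply: le_trans (ler_wpM2l KA h8) _; rewrite /L (_ : K * depth z `^ (- (s * q)) * _ = L * tent_density q s G w)// /L; ring.
  rewrite area_integralZl//.
  - apply: lee_wpmul2l; first by rewrite lee_fin.
    apply: area_integral_subset => //.
    + exact: area_set_disc.
    + exact: area_set_Gam.
    + exact: area_fun_tent_density_Gam.
    + by move=> w _; rewrite lee_fin tent_density_ge0.
  - exact: area_set_disc.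
  - exact: area_funS (@area_set_disk R) ddk (area_fun_tent_density q s mG).
  - by move=> w _; rewrite lee_fin tent_density_ge0.
have h3 := le_trans h (lee_wpmul2l (_ : (0 <= C0%:E)%E) h2).
have {}h3 := h3 (ltW C00).
have e1 : wmod s G z `^ q = (c * depth z `^ (s * q) * depth z ^- 2) * (cmod (G z) `^ q * (depth z / 20) ^+ 2).
  rewrite /wmod powRM ?powR_ge0 ?cmod_ge0// -powRrM.
  by rewrite /c; field; rewrite gt_eqF.
rewrite e1 EFinM.
have k0 : 0 <= c * depth z `^ (s * q) * depth z ^- 2.
  rewrite mulr_ge0 ?invr_ge0 ?exprn_ge0 ?(ltW d0)//.
  by rewrite mulr_ge0 ?powR_ge0 ?(ltW c0).
apply: le_trans (lee_wpmul2l (_ : (0 <= (c * depth z `^ (s * q) * depth z ^- 2)%:E)%E) h3) _.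
  by rewrite lee_fin.
rewrite !muleA -!EFinM.
rewrite (_ : _ * C0 * L = C)//.
have e2 : depth z `^ (s * q) * depth z `^ (- (s * q)) = 1.
  by rewrite -(powRD_gt0 _ _ d0)// subrr powRr0.
have e3 : depth z ^- 2 * depth z ^+ 2 = 1 by rewrite mulVf// gt_eqF// exprn_gt0.
rewrite /L /C; transitivity (C0 * (c * (K * 4 * 4)) * (depth z `^ (s * q) * depth z `^ (- (s * q))) * (depth z ^- 2 * depth z ^+ 2)); first by ring.
by rewrite e2 e3 !mulr1.
Qed.

(** Here the depth is between 1/4 and 1, that is, within a factor 2 of 1/2. This takes care of the
    compact part, the arc estimate being reserved for points near the circle. *)
Lemma wmod_bounded s a G : power_series_on_disk a G -> exists2 B, 0 < B &
  forall z, cmod z <= 3 / 4 -> wmod s G z <= B.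
Proof.
move=> aG; have [|B B0 hB] := power_series_bounded aG (_ : 3 / 4 < 1); first by lra.
exists (2 `^ `|s| * (1 / 2) `^ s * (B + 1)).
  by rewrite mulr_gt0 ?ltr_wpDl// mulr_gt0// powR_gt0.
move=> z z2; have z0 := cmod_ge0 z.
rewrite ler_pM ?powR_ge0 ?cmod_ge0//.
  by apply: powR_comparable => //; rewrite /depth; lra.
by rewrite (le_trans (hB _ z2))// lerDl.
Qed.

End tent_norms.

(** * Maximal function *)

Section maximal_function.
Variable R : realType.
Notation mu := (@lebesgue_measure R).
Implicit Types (z w : R[i]) (t u : R) (G : R[i] -> R[i]) (p q s : R).

Definition period_itv : set R := `[0, (2 * pi)[%classic.
(** Arcs attached to vertices of one period may cross its ends; three consecutive periods contain
    them, so that angles are treated as real numbers and not modulo 2 pi. *)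
Definition wide_itv : set R := `](- (2 * pi)), (4 * pi)[%classic.

Lemma measurable_period_itv : measurable period_itv.
Proof. exact: measurable_itv. Qed.

Lemma measurable_wide_itv : measurable wide_itv.
Proof. exact: measurable_itv. Qed.

Lemma integral_cst_mu (A : set R) (c : R) : measurable A ->
  (\int[mu]_(t in A) c%:E = c%:E * mu A)%E.
Proof. by move=> mA; rewrite integral_cst. Qed.

Lemma mu_period_itv : mu period_itv = (2 * pi)%:E.
Proof.
rewrite lebesgue_measure_itv/= lte_fin ifT ?subr0 ?sube0//.
by rewrite mulr_gt0 ?pi_gt0.
Qed.

(** On the three periods [X] is dominated by the sum of its restriction to one period and the two
    translates of that restriction. *)
Lemma periodic_integral_wide (X : R -> \bar R) : measurable_fun setT X ->
  (forall t, (0 <= X t)%E) -> (forall t, X (t + 2 * pi) = X t) ->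
  (\int[mu]_(t in wide_itv) X t <= 3%:E * \int[mu]_(t in period_itv) X t)%E.
Proof.
move=> mX X0 Xp; have pi0 := pi_gt0 R.
pose H := X \_ period_itv.
have mH : measurable_fun setT H.
  apply/(measurable_restrictT _ _).1; first exact: measurable_period_itv.
  exact: measurable_funTS.
have H0 t : (0 <= H t)%E by rewrite /H /patch; case: ifP.
have mHc c : measurable_fun setT (fun t => H (t + c)).
  apply: (measurableT_comp mH); apply: measurable_funD => //; exact: measurable_cst.
have IH : (\int[mu]_(t in period_itv) X t = \int[mu]_t H t)%E by rewrite integral_mkcond.
pose S (t : R) := (H t + (H (t + 2 * pi)%R + H (t - 2 * pi)%R))%E.
have -> : (3%:E * \int[mu]_(t in period_itv) X t = \int[mu]_(t in setT) S t)%E.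
  rewrite ge0_integralD//; last 2 first.
  - by move=> t _; apply: adde_ge0.
  - by apply: emeasurable_funD; exact: mHc.
  rewrite ge0_integralD//; [|exact: mHc|exact: mHc].
  rewrite !ge0_integral_shift// -IH.
  rewrite (_ : 3%:E = 1%:E + (1%:E + 1%:E) :> \bar R)%E; last first.
    by rewrite -!EFinD; congr EFin; ring.
  by rewrite !ge0_muleDl ?adde_ge0 ?lee_fin// !mul1e.
rewrite integral_mkcond; apply: ge0_le_integral => //.
- by move=> t _; rewrite /patch; case: ifP.
- apply/(measurable_restrictT _ _).1; first exact: measurable_wide_itv.
  exact: measurable_funTS.
- by apply: emeasurable_funD => //; apply: emeasurable_funD; exact: mHc.
move=> t _; rewrite /patch; case: ifPn => [|_]; last by rewrite !adde_ge0.
rewrite inE /wide_itv /= in_itv /= => /andP[t1 t2].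
have HE x : 0 <= x -> x < 2 * pi -> H x = X x.
  move=> x0 x1; rewrite /H /patch mem_set// /period_itv /= in_itv /=.
  by rewrite x0 x1.
have [t0|t0] := ltP t 0.
  rewrite -(Xp t) -(HE (t + 2 * pi)); [|lra|lra].
  by rewrite (le_trans _ (leeDr _ (H0 t)))// leeDl.
have [t3|t3] := ltP t (2 * pi).
  by rewrite -(HE t)// leeDl// adde_ge0.
rewrite -{1}(subrK (2 * pi) t) Xp -(HE (t - 2 * pi)); [|lra|lra].
by rewrite (le_trans _ (leeDr _ (H0 t)))// leeDr.
Qed.

Lemma nbhs_Gam t z : Gam t z -> exists2 e, 0 < e & forall u, `|u - t| < e -> Gam u z.
Proof.
move=> /GamE[zd zt]; exists ((1 - cmod z ^+ 2 - cmod (cexp_i t - z)) / 2).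
  by rewrite divr_gt0// subr_gt0.
move=> u ut; apply/GamE; split => //.
apply: le_lt_trans (cmod_dist (cexp_i t) _ _) _.
by have := cexp_i_lipschitz u t; move: ut; lra.
Qed.

(** The nontangential maximal function of [v]. *)
Definition cone_sup (v : R[i] -> R) t : \bar R := ereal_sup [set (v z)%:E | z in Gam t].

Lemma cone_sup_ge (v : R[i] -> R) t z : Gam t z -> ((v z)%:E <= cone_sup v t)%E.
Proof. by move=> zt; apply: ereal_sup_ubound; exists z. Qed.

Lemma cone_sup_ge0 (v : R[i] -> R) t : (forall z, 0 <= v z) -> (0 <= cone_sup v t)%E.
Proof.
(* The midpoint of the radius belongs to the approach region, so the supremum is over a nonempty
   set. *)
move=> v0; apply: (@le_trans _ _ (v (2^-1%:C * cexp_i t))%:E); first by rewrite lee_fin.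
apply: cone_sup_ge; apply/GamE; rewrite /disk /=.
have h2 : 0 <= 2^-1 :> R by rewrite invr_ge0.
have -> : cmod ((2^-1 : R)%:C * cexp_i t) = 2^-1.
  by rewrite cmodM cmod_cexp_i mulr1 cmod_real ger0_norm.
split; first lra.
have -> : cexp_i t - (2^-1 : R)%:C * cexp_i t = (1 - 2^-1 : R)%:C * cexp_i t.
  by rewrite rmorphB mulrBl mul1r.
rewrite cmodM cmod_cexp_i mulr1 cmod_real ger0_norm ?expr2; lra.
Qed.

(** For a fixed point, belonging to the region is an open condition on the vertex. This is what
    makes a supremum over uncountably many points measurable, whatever [v] is. *)
Lemma lower_semicontinuous_cone_sup (v : R[i] -> R) : lower_semicontinuous (cone_sup v).
Proof.
move=> t a /ereal_sup_gt[_ [z zt <-] az].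
have [e e0 he] := nbhs_Gam zt.
exists (ball t e); first exact: nbhsx_ballx.
move=> u; rewrite /ball /= distrC => /he uz.
exact: lt_le_trans az (cone_sup_ge v uz).
Qed.

Lemma measurable_cone_sup (v : R[i] -> R) : measurable_fun setT (cone_sup v).
Proof. by apply: lower_semicontinuous_measurable; exact: lower_semicontinuous_cone_sup. Qed.

(* If X exceeds a level on an arc of length d/10 at distance at most 9d of t,
   then the Hardy-Littlewood maximal function of the indicator of the
   superlevel set is at least 1/180 at t. *)
Lemma maximal_level (E : set R) t t0 (d : R) : measurable E -> 0 < d ->
  `|t0 - t| <= 8 * d -> (forall u, `|u - t0| < d / 20 -> E u) ->
  ((181^-1)%:E < HL_maximal (\1_E : R -> R) t)%E.
Proof.
move=> mE d0 t0t hE; have d20 : 0 < d / 20 by rewrite divr_gt0.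
have d9 : 0 < 9 * d by rewrite mulr_gt0.
apply: (@lt_le_trans _ _ (iavg (\1_E : R -> R) (ball t (9 * d)))); last first.
  by apply: ereal_sup_ubound; exists (9 * d) => //=; rewrite in_itv /= d9.
rewrite /iavg lebesgue_measure_ball ?(ltW d9)//.
have h1 : ((d / 10)%:E <= \int[mu]_(y in ball t (9 * d)) `|(\1_E y)%:E|)%E.
  apply: (@le_trans _ _ (\int[mu]_(y in ball t0 (d / 20)) (1%R%:E))%E).
    rewrite integral_cst_mu; last exact: measurable_ball.
    rewrite mul1e lebesgue_measure_ball ?(ltW d20)// lee_fin.
    by rewrite -mulr_natl; lra.
  have sub : ball t0 (d / 20) `<=` ball t (9 * d).
    move=> y; rewrite /ball /= => h.
    apply: le_lt_trans (ler_distD t0 t y) _; rewrite (distrC t t0).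
    have -> : 9 * d = 8 * d + d by ring.
    by apply: ler_ltD t0t _; apply: lt_trans h _; lra.
  apply: (@le_trans _ _ (\int[mu]_(y in ball t0 (d / 20)) `|(\1_E y : R)%:E|)%E).
    apply: ge0_le_integral => //.
    - exact: measurable_ball.
    - apply: measurable_funTS; apply: measurableT_comp => //.
      exact/measurable_EFinP/measurable_indic.
    - move=> y yb; rewrite indicE mem_set ?normr1//; first by rewrite gee0_abs ?lee_fin.
      by apply: hE; move: yb; rewrite /ball /= distrC.
  apply: ge0_subset_integral => //; try exact: measurable_ball.
  apply: measurable_funTS; apply: measurableT_comp => //.
  exact/measurable_EFinP/measurable_indic.
have d18 : 0 < (9 * d) *+ 2 by rewrite pmulrn_lgt0.
rewrite inver gt_eqF//.
apply: lt_le_trans (lee_wpmul2l _ h1); last by rewrite lee_fin invr_ge0 ltW.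
move: d18; rewrite -EFinM lte_fin -mulr_natl => d18.
by rewrite ltr_pdivlMl//; lra.
Qed.

Lemma locally_integrable_indic (E : set R) : measurable E ->
  locally_integrable setT (\1_E : R -> R).
Proof.
move=> mE; split; [exact: measurable_indic|exact: openT|].
move=> K _ cK; apply: le_lt_trans (compact_finite_measure cK).
have mK : measurable K by exact: compact_measurable.
rewrite -[leRHS]mul1e -integral_cst_mu//; apply: ge0_le_integral => //.
- by apply/measurable_EFinP; apply: measurableT_comp => //; exact: measurable_indic.
- by move=> y _; rewrite indicE lee_fin; case: (y \in E) => /=; rewrite ?normr1 ?normr0.
Qed.

Lemma measure_superlevel_integral (D : set R) (V : R -> \bar R) c : measurable D ->
  measurable_fun setT V ->
  (\int[mu]_(t in D) ebool R (c < V t)%E = mu (D `&` [set t | (c < V t)%E]))%E.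
Proof.
move=> mD mV.
have mE : measurable [set t | (c < V t)%E].
  by rewrite -[X in measurable X]setTI; exact: emeasurable_fun_o_infty.
transitivity (\int[mu]_(t in D) (\1_[set t | (c < V t)%E] t)%:E)%E.
  apply: eq_integral => t _; rewrite /ebool indicE; have -> // : (t \in [set t | (c < V t)%E]) = (c < V t)%E.
  by apply/idP/idP; rewrite inE.
by rewrite integral_indic// setIC.
Qed.

Lemma measurable_ebool (V : R -> \bar R) c : measurable_fun setT V ->
  measurable_fun setT (fun t => ebool R (c < V t)%E).
Proof.
move=> mV.
have mE : measurable [set t | (c < V t)%E].
  by rewrite -[X in measurable X]setTI; exact: emeasurable_fun_o_infty.
rewrite (_ : (fun _ => _) = (fun t => (\1_[set t | (c < V t)%E] t)%:E)).
  exact/measurable_EFinP/measurable_indic.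
apply/funext => t; rewrite /ebool indicE; have -> // : (t \in [set t | (c < V t)%E]) = (c < V t)%E.
by apply/idP/idP; rewrite inE.
Qed.

(** Both integrals are compared with sums of measures of superlevel sets at integer levels. The
    levels below [K] contribute a bounded amount on a bounded interval, so the inequality is only
    asked from [K] on. *)
Lemma integral_of_level_inequality (X V : R -> \bar R) (K : nat) (C : R) :
  measurable_fun setT X -> measurable_fun setT V ->
  (forall t, (0 <= X t)%E) -> (forall t, (0 <= V t)%E) -> 0 <= C ->
  (forall k : nat, (K <= k)%N ->
    (mu (period_itv `&` [set t | (k%:R%:E < V t)%E]) <=
     C%:E * mu (wide_itv `&` [set t | (k%:R%:E < X t)%E]))%E) ->
  (\int[mu]_(t in wide_itv) X t < +oo)%E ->
  (\int[mu]_(t in period_itv) V t < +oo)%E.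
Proof.
move=> mX mV X0 V0 C0 h Xoo.
have eb0 b : (0 <= ebool R b)%E by rewrite lee_fin.
have mVk k : measurable_fun period_itv (fun t => ebool R (k%:R%:E < V t)%E).
  by apply: measurable_funTS; exact: measurable_ebool.
have mXk k : measurable_fun wide_itv (fun t => ebool R (k%:R%:E < X t)%E).
  by apply: measurable_funTS; exact: measurable_ebool.
(* The shift by one makes each level [K' + k] of V at least the level [k.+1] of X that is counted in
   [layers_le]. *)
pose K' := K.+1.
have mW := measurable_wide_itv.
have S0 (u : nat -> \bar R) : (forall k, 0 <= u k)%E -> (0 <= \sum_(0 <= k <oo) u k)%E.
  by move=> u0; apply: nneseries_ge0.
apply: (@le_lt_trans _ _ (\int[mu]_(t in period_itv)
    (K'%:R%:E + \sum_(0 <= k <oo) ebool R ((K' + k)%:R%:E < V t)))%E).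
  apply: ge0_le_integral => //.
  - exact: measurable_period_itv.
  - exact: measurable_funTS.
  - apply: emeasurable_funD; first exact: measurable_cst.
    by apply: ge0_emeasurable_sum => k; [move=> *; exact: eb0|move=> _; exact: mVk].
  - by move=> t _; exact: le_layers.
have mP := measurable_period_itv.
have K0 t : period_itv t -> (0 <= K'%:R%:E :> \bar R)%E by rewrite lee_fin.
have sum0 t : period_itv t -> (0 <= \sum_(0 <= k <oo) ebool R ((K' + k)%:R%:E < V t))%E.
  by move=> _; exact: S0.
have msum : measurable_fun period_itv
    (fun t => \sum_(0 <= k <oo) ebool R ((K' + k)%:R%:E < V t))%E.
  by apply: ge0_emeasurable_sum => k; [move=> *; exact: eb0|move=> _; exact: mVk].
rewrite (ge0_integralD mu mP K0 (measurable_cst _) sum0 msum).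
rewrite integral_cst_mu; last exact: measurable_period_itv.
rewrite mu_period_itv -EFinM; apply: lte_add_pinfty; first exact: ltry.
rewrite integral_nneseries//; last by move=> k; exact: mVk.
apply: (@le_lt_trans _ _ (C%:E * \int[mu]_(t in wide_itv) X t)%E); last first.
  by rewrite lte_mul_pinfty// integral_ge0.
apply: (@le_trans _ _ (\sum_(0 <= k <oo) (C%:E * \int[mu]_(t in wide_itv) ebool R (k.+1%:R%:E < X t)))%E).
  apply: lee_nneseries => k _; first by move=> _; apply: integral_ge0.
  rewrite !measure_superlevel_integral//.
  apply: le_trans (h (K' + k)%N _) _; first by rewrite /K' addSn leqW// leq_addr.
  apply: lee_wpmul2l; first by rewrite lee_fin.
  have ms c : measurable (wide_itv `&` [set t | (c < X t)%E]).
    apply: measurableI; first exact: measurable_wide_itv.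
    by rewrite -[X in measurable X]setTI; exact: emeasurable_fun_o_infty.
  apply: le_measure; rewrite ?inE; [exact: ms|exact: ms|].
  move=> t [tw] /= kX; split => //=; apply: le_lt_trans kX.
  by rewrite lee_fin ler_nat /K' addSn ltnS leq_addl.
rewrite nneseriesZl//; last by move=> k _; apply: integral_ge0.
apply: lee_wpmul2l; first by rewrite lee_fin.
rewrite -integral_nneseries//; last by move=> k; exact: mXk.
apply: ge0_le_integral => //.
- by move=> t _; exact: S0.
- by apply: ge0_emeasurable_sum => k; [move=> *; exact: eb0|move=> _; exact: mXk].
- exact: measurable_funTS.
- by move=> t _; exact: layers_le.
Qed.

End maximal_function.

(** * Growth and nontangential maximal function of the weighted transform *)

Section tent_maximal.
Variable R : realType.
Notation mu := (@lebesgue_measure R).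
Implicit Types (z w : R[i]) (t u : R).
Variables (a : nat -> R[i]) (G : R[i] -> R[i]) (p q s : R).
Hypotheses (p0 : 0 < p) (q0 : 0 < q) (aG : power_series_on_disk a G).
Hypothesis fin : (\int[mu]_(t in @period_itv R) (tent_area q s G t `^ (p / q)) < +oo)%E.

Let tent_power t : \bar R := (tent_area q s G t `^ (p / q))%E.

Lemma tent_power_wide_lty : (\int[mu]_(t in @wide_itv R) tent_power t < +oo)%E.
Proof.
have mG := power_series_measurable aG.
apply: le_lt_trans (periodic_integral_wide _ _ _) _.
- exact: measurable_tent_area_poweR.
- by move=> t; exact: poweR_ge0.
- move=> t; rewrite /tent_power; congr (_ `^ _)%E.
  by rewrite mulr_natl; exact: area_integral_Gam_periodic.
- by rewrite lte_mul_pinfty// ?lee_fin.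
Qed.

Lemma wmod_le_tent_power : exists2 C, 0 < C &
  forall t z, Gam t z -> 3 / 4 < cmod z ->
  exists2 t0 : R, `|t0 - t| <= 8 * depth z &
    forall u, `|u - t0| < depth z / 20 ->
      ((wmod s G z `^ p)%:E <= C%:E * tent_power u)%E.
Proof.
have [C C0 hC] := @wmod_le_tent_area R q s q0.
exists (C `^ (p / q)); first exact: powR_gt0.
move=> t z zt z34; have [|t0 ht0 h] := hC _ _ aG _ _ zt; first by lra.
exists t0 => // u ut; have := h u ut.
have pq : 0 <= p / q by rewrite divr_ge0// ltW.
move=> h2.
have := @gt0_ler_poweR R (p / q) pq (wmod s G z `^ q)%:E (C%:E * tent_area q s G u)%E.
rewrite !in_itv /= !leey !andbT lee_fin powR_ge0 mule_ge0 ?tent_area_ge0 ?lee_fin ?(ltW C0)//.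
move=> /(_ isT isT h2).
rewrite poweRM ?lee_fin ?(ltW C0) ?tent_area_ge0// !poweR_EFin.
by rewrite -powRrM mulrC divfK// gt_eqF.
Qed.

(** For d < 1/4 the point stays within 8d + d/20 < 4 <= 2 pi of [t]. *)
Lemma arc_in_wide t t0 u (d : R) : 0 <= t <= 2 * pi -> 0 < d -> d < 1 / 4 ->
  `|t0 - t| <= 8 * d -> `|u - t0| < d / 20 -> @wide_itv R u.
Proof.
move=> /andP[t1 t2] d0 d4; have pi2 := pi_ge2 R.
rewrite ler_norml ltr_norml => /andP[h1 h2] /andP[h3 h4].
by rewrite /wide_itv /= in_itv /=; apply/andP; split; lra.
Qed.

Lemma tent_growth : exists2 M, 0 <= M & forall t z, 0 <= t <= 2 * pi -> Gam t z ->
  wmod s G z `^ p * depth z <= M.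
Proof.
have [C C0 hC] := wmod_le_tent_power.
have [B B0 hB] := wmod_bounded s aG.
have mG := power_series_measurable aG.
have mW := @measurable_wide_itv R.
have mX : measurable_fun setT tent_power by exact: measurable_tent_area_poweR.
have X0 t : (0 <= tent_power t)%E by exact: poweR_ge0.
have I0 : (0 <= \int[mu]_(t in @wide_itv R) tent_power t)%E by exact: integral_ge0.
have := tent_power_wide_lty; move: I0.
case IE : (\int[mu]_(t in @wide_itv R) tent_power t)%E => [I| |] // I0 _.
rewrite lee_fin in I0.
(* The first term covers |z| <= 3/4; in the second, 10 comes from the length [depth z / 10] of the
   arc. *)
exists (B `^ p + 10 * (C * I)); first by rewrite addr_ge0 ?powR_ge0// !mulr_ge0// ltW.
move=> t z t02 zt; have zd := Gam_disk zt; have d0 := depth_gt0 zd.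
have [z34|z34] := leP (cmod z) (3 / 4).
  apply: (@le_trans _ _ (B `^ p)); last by rewrite lerDl !mulr_ge0// ltW.
  rewrite -[leRHS]mulr1 ler_pM ?powR_ge0 ?(ltW d0) ?depth_le1//.
  by rewrite ge0_ler_powR ?nnegrE ?(ltW p0) ?wmod_ge0 ?(ltW B0)// hB.
apply: (@le_trans _ _ (10 * (C * I))); last by rewrite lerDr powR_ge0.
have [t0 ht0 h] := hC t z zt z34.
have d4 : depth z < 1 / 4 by rewrite /depth; lra.
have d20 : 0 < depth z / 20 by rewrite divr_gt0.
have sub : ball t0 (depth z / 20) `<=` @wide_itv R.
  move=> u; rewrite /ball /= distrC => hu.
  exact: arc_in_wide t02 d0 d4 ht0 hu.
have h1 : ((wmod s G z `^ p * (depth z / 10))%:E <= (C * I)%:E)%E.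
  rewrite EFinM (_ : (depth z / 10)%:E = mu (ball t0 (depth z / 20))); last first.
    rewrite lebesgue_measure_ball ?(ltW d20)//; congr EFin.
    by rewrite -mulr_natl; field.
  rewrite -integral_cst_mu; last exact: measurable_ball.
  rewrite EFinM -IE -ge0_integralZl_EFin//; last 2 first.
  - exact: measurable_funTS.
  - exact: ltW.
  apply: (@le_trans _ _ (\int[mu]_(u in ball t0 (depth z / 20)) (C%:E * tent_power u))%E).
    apply: ge0_le_integral => //.
    - exact: measurable_ball.
    - by move=> u _; rewrite lee_fin powR_ge0.
    - apply: measurable_funTS; apply: emeasurable_funM => //; exact: measurable_cst.
    - by move=> u; rewrite /ball /= distrC; exact: h.
  apply: ge0_subset_integral => //.
  - exact: measurable_ball.
  - apply: measurable_funTS; apply: emeasurable_funM => //; exact: measurable_cst.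
  - by move=> u _; rewrite mule_ge0// lee_fin ltW.
by move: h1; rewrite lee_fin; lra.
Qed.

Lemma tent_maximal :
  (\int[mu]_(t in @period_itv R) cone_sup (fun z => (wmod s G z `^ p)%R) t < +oo)%E.
Proof.
have [C C0 hC] := wmod_le_tent_power.
have [B B0 hB] := wmod_bounded s aG.
have mG := power_series_measurable aG.
have mX : measurable_fun setT tent_power by exact: measurable_tent_area_poweR.
have X0 t : (0 <= tent_power t)%E by exact: poweR_ge0.
have mCX : measurable_fun setT (fun t => C%:E * tent_power t)%E.
  by apply: emeasurable_funM => //; exact: measurable_cst.
have C0' : 0 <= C by exact: ltW.
have BK : B `^ p <= (Num.truncn (B `^ p)).+1%:R by rewrite ltW// truncnS_gt.
(* The constant 543 is 3 * 181: the weak type constant 3 divided by the height [181^-1] given by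
   [maximal_level]. From the chosen level on, the superlevel sets only see points with |z| > 3/4,
   because W^p is at most [B ^ p] on the rest. *)
apply: (@integral_of_level_inequality R (fun t => C%:E * tent_power t)%E _ (Num.truncn (B `^ p)).+1 543).
- exact: mCX.
- exact: measurable_cone_sup.
- by move=> t; rewrite mule_ge0// lee_fin.
- by move=> t; apply: cone_sup_ge0 => z; exact: powR_ge0.
- exact: (ler0n R 543).
- move=> k Kk; set E := @wide_itv R `&` _.
  have mE : measurable E.
    apply: measurableI; first exact: measurable_wide_itv.
    by rewrite -[X in measurable X]setTI; exact: emeasurable_fun_o_infty.
  have c0 : 0 < 181^-1 :> R by rewrite invr_gt0.
  have HL := maximal_inequality (locally_integrable_indic mE) c0.
  apply: le_trans (le_trans _ HL) _.
    apply: le_measure; rewrite ?inE.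
    - apply: measurableI; first exact: measurable_period_itv.
      by rewrite -[X in measurable X]setTI; apply: emeasurable_fun_o_infty => //;
        exact: measurable_cone_sup.
    - rewrite -[X in measurable X]setTI; apply: emeasurable_fun_o_infty => //.
      exact: measurable_HL_maximal (locally_integrable_indic mE).
    - move=> t [tP] /= /ereal_sup_gt[_ [z zt <-]]; rewrite lte_fin => kz.
      have zd := Gam_disk zt; have d0 := depth_gt0 zd.
      have z34 : 3 / 4 < cmod z.
        rewrite ltNge; apply/negP => /hB zB.
        have : wmod s G z `^ p <= B `^ p.
          by rewrite ge0_ler_powR ?nnegrE ?(ltW p0) ?wmod_ge0 ?(ltW B0).
        have : (Num.truncn (B `^ p)).+1%:R <= k%:R :> R by rewrite ler_nat.
        lra.
      have [t0 ht0 h] := hC t z zt z34.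
      have d4 : depth z < 1 / 4 by rewrite /depth; lra.
      apply: (maximal_level mE d0 ht0) => u ut; split.
        apply: arc_in_wide d0 d4 ht0 ut.
        by move: tP; rewrite /period_itv /= in_itv /= => /andP[-> /ltW ->].
      by rewrite /=; apply: lt_le_trans (h u ut); rewrite lte_fin.
  rewrite (_ : \int[mu]_(y in setT) `|(\1_E y)%:E| = mu E)%E.
    apply: lee_wpmul2r; first exact: measure_ge0.
    by rewrite lee_fin invrK; lra.
  transitivity (\int[mu]_(y in setT) (\1_E y)%:E)%E; last first.
    by rewrite integral_indic// setIT.
  by apply: eq_integral => y _; rewrite gee0_abs// lee_fin.
- rewrite ge0_integralZl_EFin//; last 2 first.
  + exact: measurable_wide_itv.
  + exact: measurable_funTS.
  rewrite lte_mul_pinfty ?lee_fin//; exact: tent_power_wide_lty.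
Qed.

End tent_maximal.

(** * Sufficiency *)

Section embeddings.
Variable R : realType.
Notation mu := (@lebesgue_measure R).
Implicit Types (z w : R[i]) (t u : R) (A B : set R[i]).

Lemma area_integral_setU A B (h : R[i] -> \bar R) : area_set A -> area_set B ->
  area_fun (A `|` B) h -> (forall z, (0 <= h z)%E) -> [disjoint A & B] ->
  area_integral (A `|` B) h = (area_integral A h + area_integral B h)%E.
Proof.
move=> mA mB mh h0 dAB; rewrite /area_integral preimage_setU.
apply: ge0_integral_setU => //.
apply/disj_setPS => w []; rewrite /preimage /= => Aw Bw.
by move/disj_setPS: dAB => /(_ (to_complex w)); apply.
Qed.

Lemma wmodD (s e : R) (G : R[i] -> R[i]) z : disk z -> wmod (s + e) G z = depth z `^ e * wmod s G z.
Proof.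
move=> /depth_gt0 d0; rewrite /wmod (powRD_gt0 _ _ d0).
by rewrite mulrAC mulrC mulrA.
Qed.

Lemma powR_le_root (x n p : R) : 0 < p -> 0 <= x -> x `^ p <= n -> x <= n `^ p^-1.
Proof.
move=> p0 x0 xn; have n0 := le_trans (powR_ge0 _ _) xn.
have -> : x = (x `^ p) `^ p^-1 by rewrite -powRrM mulfV ?gt_eqF// powRr1.
by rewrite ge0_ler_powR ?nnegrE ?invr_ge0 ?(ltW p0) ?powR_ge0.
Qed.

Lemma Gam_area_le (t c e u s : R) (G : R[i] -> R[i]) A : measurable_on_disk G -> area_set A ->
  0 <= c ->
  (forall z, Gam t z -> A z -> wmod s G z `^ u * depth z `^ (- 2) <= c * depth z `^ e) ->
  (area_integral (Gam t `&` A) (fun z => (tent_density u s G z)%:E) <=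
   (4 * c)%:E * area_integral (Gam t `&` A) (fun z => (depth z `^ e)%:E))%E.
Proof.
move=> mG mA c0 h.
have mGA : area_set (Gam t `&` A) by apply: measurableI => //; exact: area_set_Gam.
have c40 : 0 <= 4 * c by rewrite mulr_ge0.
rewrite -area_integralZl//; last 2 first.
- exact: area_fun_depth.
- by move=> z _; rewrite lee_fin powR_ge0.
apply: le_area_integral => //.
- apply: (area_funS (area_set_Gam t) (@subIsetl _ (Gam t) A)).
  exact: area_fun_tent_density_Gam.
- by apply: emeasurable_funM; [exact: measurable_cst|exact: area_fun_depth].
- by move=> z _; rewrite lee_fin tent_density_ge0.
- move=> z [zt zA]; rewrite -EFinM lee_fin.
  have := tent_density_le u s G (Gam_disk zt); have := h z zt zA.
  rewrite -mulrA; lra.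
Qed.

Lemma Gam_depth_lt t : Gam t = Gam t `&` depth_lt 2.
Proof.
apply/seteqP; split => z; last by case.
by move=> zt; split => //; rewrite /depth_lt /=; have := @depth_le1 R z; lra.
Qed.

Lemma Gam_depth_split t (r : R) : Gam t = (Gam t `&` depth_lt r) `|` (Gam t `&` depth_ge r).
Proof.
apply/seteqP; split => z; last by case; case.
by move=> zt; have [h|h] := ltP (depth z) r; [left|right].
Qed.

Lemma poweR_le_EFin (x : \bar R) (y e : R) : 0 <= e -> (0 <= x)%E -> 0 <= y -> (x <= y%:E)%E ->
  (x `^ e <= (y `^ e)%:E)%E.
Proof.
move=> e0 x0 y0 xy; rewrite -poweR_EFin.
by apply: gt0_ler_poweR => //; rewrite in_itv /= leey andbT ?lee_fin.
Qed.

Lemma powR_le_1D (m e : R) : 0 <= m -> 0 <= e <= 1 -> m `^ e <= 1 + m.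
Proof.
move=> m0 /andP[e0 e1]; have m1 : 0 <= 1 + m by rewrite addr_ge0.
apply: (@le_trans _ _ ((1 + m) `^ e)).
  by rewrite ge0_ler_powR ?nnegrE// lerDr.
by rewrite -[leRHS]powRr1// ler_powR// lerDl.
Qed.

(** In the application [e] is alpha - beta, so that [s] is the weight exponent in the source and
    [s + e] the one in the target. *)
Variables (a : nat -> R[i]) (G : R[i] -> R[i]) (p q u v s e : R).
Hypotheses (p0 : 0 < p) (q0 : 0 < q) (u0 : 0 < u) (v0 : 0 < v).
Hypothesis aG : power_series_on_disk a G.
Hypothesis fin : (\int[mu]_(t in @period_itv R) (tent_area q s G t `^ (p / q)) < +oo)%E.

Let N := cone_sup (fun z => wmod s G z `^ p).

Let vu0 : 0 <= v / u. Proof. by rewrite divr_ge0// ltW. Qed.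

(** Reduces an embedding to an estimate at one vertex where the maximal function is a real [n] and
    the source functional a real [x]. Elsewhere the majorant is infinite; [C + 1] is used as its
    factor because it is positive even for C = 0. *)
Lemma tent_finite_of_le (C : R) : 0 <= C ->
  (forall t n x, 0 <= t <= 2 * pi -> 0 <= n -> 0 <= x -> N t = n%:E ->
    tent_area q s G t = x%:E ->
    (tent_area u (s + e) G t `^ (v / u) <= (C * (1 + n + x `^ (p / q)))%:E)%E) ->
  (\int[mu]_(t in @period_itv R) (tent_area u (s + e) G t `^ (v / u)) < +oo)%E.
Proof.
move=> C0 h; have mG := power_series_measurable aG.
have mN : measurable_fun setT N by exact: measurable_cone_sup.
have mX := measurable_tent_area_poweR q s (p / q) mG.
have mP := @measurable_period_itv R.
have N0 t : (0 <= N t)%E by apply: cone_sup_ge0 => z; exact: powR_ge0.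
have C1 : 0 < C + 1 by rewrite ltr_wpDl.
pose H t := (1%:E + N t + tent_area q s G t `^ (p / q))%E.
have H0 t : (0 <= H t)%E by rewrite !adde_ge0 ?poweR_ge0 ?lee_fin.
have mH : measurable_fun (@period_itv R) H.
  apply: measurable_funTS; apply: emeasurable_funD => //.
  by apply: emeasurable_funD => //; exact: measurable_cst.
apply: (@le_lt_trans _ _ (\int[mu]_(t in @period_itv R) ((C + 1)%:E * H t))%E).
  apply: ge0_le_integral => //.
  - by move=> t _; exact: poweR_ge0.
  - by apply: measurable_funTS; exact: measurable_tent_area_poweR.
  - by apply: emeasurable_funM => //; exact: measurable_cst.
  move=> t tP; have {tP} tP : 0 <= t <= 2 * pi.
    by move: tP; rewrite /period_itv /= in_itv /= => /andP[-> /ltW ->].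
  have := N0 t; case NE : (N t) => [n| |] // n0; last first.
    rewrite /H NE (_ : 1%:E + +oo = +oo)%E// addye ?gt0_muley ?leey//.
    by rewrite gt_eqF// (lt_le_trans _ (poweR_ge0 _ _))// ltNyr.
  have := tent_area_ge0 q s G t; case AE : (tent_area q s G t) => [x| |] // x0; last first.
    rewrite /H NE AE poweRyr ?gt_eqF ?divr_gt0// -EFinD addey// gt0_muley ?leey//.
  rewrite !lee_fin in n0 x0; apply: le_trans (h t n x tP n0 x0 NE AE) _.
  rewrite /H NE AE poweR_EFin -!EFinD -EFinM lee_fin.
  by rewrite ler_wpM2r ?lerDl// !addr_ge0 ?powR_ge0.
rewrite ge0_integralZl_EFin ?(ltW C1)//.
rewrite lte_mul_pinfty ?lee_fin ?(ltW C1)//.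
have mN' : measurable_fun (@period_itv R) N by exact: measurable_funTS.
have mX' := measurable_funTS mX : measurable_fun (@period_itv R) _.
have m1 : measurable_fun (@period_itv R) (fun=> 1%:E : \bar R) by exact: measurable_cst.
have m1N : measurable_fun (@period_itv R) (fun t => 1%:E + N t)%E by exact: emeasurable_funD.
have p1 t : @period_itv R t -> (0 <= 1%:E :> \bar R)%E by rewrite lee_fin.
have p1N t : @period_itv R t -> (0 <= 1%:E + N t)%E by rewrite adde_ge0// lee_fin.
rewrite (ge0_integralD mu mP p1N m1N (fun t _ => poweR_ge0 _ _) mX').
rewrite (ge0_integralD mu mP p1 m1 (fun t _ => N0 t) mN').
apply: lte_add_pinfty => //; apply: lte_add_pinfty.
- by rewrite integral_cst_mu// mu_period_itv -EFinM ltry.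
- exact: tent_maximal aG fin.
Qed.

Lemma wmod_cone n t z : N t = n%:E -> Gam t z -> wmod s G z `^ p <= n.
Proof. by move=> NE zt; rewrite -lee_fin -NE; exact: (cone_sup_ge (fun z => wmod s G z `^ p)). Qed.

Lemma wmod_powR_le n z : wmod s G z `^ p <= n -> wmod s G z `^ u <= n `^ (u / p).
Proof.
move=> zn; have n0 := le_trans (powR_ge0 _ _) zn.
rewrite mulrC powRrM ge0_ler_powR ?nnegrE ?(ltW u0) ?wmod_ge0 ?powR_ge0//.
exact: powR_le_root p0 (wmod_ge0 _ _ _) zn.
Qed.

(** In the whole region W is at most n^(1/p), and the gained factor, depth to the power eu, is
    integrable against depth^(-2). The result is of order n^(v/p), at most 1 + n because v <= p. *)
Lemma embedding_lt : 0 < e -> v <= p ->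
  (\int[mu]_(t in @period_itv R) (tent_area u (s + e) G t `^ (v / u)) < +oo)%E.
Proof.
move=> e0 vp; have mG := power_series_measurable aG.
have eu0 : 0 < e * u by rewrite mulr_gt0.
have [C C0 hC] := Gam_integral_depth_lt eu0.
pose K := 4 * C * 2 `^ (e * u).
have K0 : 0 <= K by rewrite !mulr_ge0// powR_ge0.
apply: (@tent_finite_of_le (K `^ (v / u))); first exact: powR_ge0.
move=> t n x t02 n0 x0 NE AE.
apply: (@le_trans _ _ ((K * n `^ (u / p)) `^ (v / u))%:E).
  apply: poweR_le_EFin => //; first exact: tent_area_ge0.
    by rewrite mulr_ge0// powR_ge0.
  rewrite /tent_area {1}(Gam_depth_lt t).
  apply: le_trans (@Gam_area_le t (n `^ (u / p)) (e * u - 2) _ _ _ _ mG _ _ _) _.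
  - exact: area_set_depth_lt.
  - exact: powR_ge0.
  - move=> z zt _; have zd := Gam_disk zt.
    rewrite wmodD// powRM ?powR_ge0 ?wmod_ge0// -powRrM.
    have d0 := depth_gt0 zd.
    rewrite (powRD_gt0 _ _ d0).
    rewrite mulrAC mulrC ler_wpM2r ?mulr_ge0 ?powR_ge0//.
    exact: wmod_powR_le (wmod_cone NE zt).
  apply: le_trans (lee_wpmul2l _ (hC t 2 _)) _ => //.
    by rewrite lee_fin mulr_ge0// powR_ge0.
  rewrite -EFinM lee_fin /K [leLHS](_ : _ = 4 * C * 2 `^ (e * u) * n `^ (u / p))//.
  by ring.
rewrite lee_fin powRM ?powR_ge0// ler_wpM2l ?powR_ge0//.
rewrite -powRrM (_ : u / p * (v / u) = v / p); last first.
  by field; rewrite !gt_eqF.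
apply: (@le_trans _ _ (1 + n)); last by rewrite lerDl powR_ge0.
apply: powR_le_1D => //; rewrite divr_ge0 ?(ltW v0) ?(ltW p0)//=.
by rewrite ler_pdivrMr// mul1r.
Qed.

(** Write W^u = W^(u-q) W^q and bound the first factor by n^((u-q)/p). With X = x^(p/q) the product
    n^((u-q)/p) x is at most (n + X)^(u/p), and the outer exponent turns this into (n + X)^(v/p). *)
Lemma embedding_eq : e = 0 -> v <= p -> q <= u ->
  (\int[mu]_(t in @period_itv R) (tent_area u (s + e) G t `^ (v / u)) < +oo)%E.
Proof.
move=> e0 vp qu; have mG := power_series_measurable aG.
apply: (@tent_finite_of_le 1) => // t n x t02 n0 x0 NE AE; rewrite e0 addr0.
pose X := x `^ (p / q); have X0 : 0 <= X by exact: powR_ge0.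
have uq0 : 0 <= (u - q) / p by rewrite divr_ge0 ?subr_ge0// ltW.
apply: (@le_trans _ _ ((n `^ ((u - q) / p) * x) `^ (v / u))%:E).
  apply: poweR_le_EFin => //; first exact: tent_area_ge0.
    by rewrite mulr_ge0// powR_ge0.
  rewrite EFinM -AE /tent_area -area_integralZl ?powR_ge0//; last 3 first.
  - exact: area_set_Gam.
  - exact: area_fun_tent_density_Gam.
  - by move=> z _; rewrite lee_fin tent_density_ge0.
  apply: le_area_integral.
  - exact: area_set_Gam.
  - exact: area_fun_tent_density_Gam.
  - by apply: emeasurable_funM; [exact: measurable_cst|exact: area_fun_tent_density_Gam].
  - by move=> z _; rewrite lee_fin tent_density_ge0.
  - move=> z zt; rewrite -EFinM lee_fin !tent_densityE mulrA ler_wpM2r ?powR_ge0//.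
    have [w0|wn0] := eqVneq (wmod s G z) 0.
      by rewrite w0 [leLHS]powR0 ?gt_eqF// mulr_ge0 ?powR_ge0.
    rewrite -[u in leLHS](subrK q u) powRD; last by rewrite wn0 implybT.
    rewrite ler_wpM2r ?powR_ge0//.
    have /(powR_le_root p0 (wmod_ge0 _ _ _)) h := wmod_cone NE zt.
    rewrite mulrC powRrM ge0_ler_powR ?nnegrE ?subr_ge0 ?wmod_ge0 ?powR_ge0//.
rewrite lee_fin mul1r -/X.
pose m := n + X; have m0 : 0 <= m by rewrite addr_ge0.
have xE : x = X `^ (q / p).
  by rewrite /X -powRrM (_ : p / q * (q / p) = 1) ?powRr1//; field; rewrite !gt_eqF.
have h1 : n `^ ((u - q) / p) * x <= m `^ (u / p).
  have [m00|mn0] := eqVneq m 0.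
    have x00 : x = 0.
      have X00 : X = 0 by apply/eqP; rewrite eq_le X0 andbT; move: m00; rewrite /m; lra.
      by rewrite xE X00 powR0// gt_eqF// divr_gt0.
    by rewrite x00 mulr0 powR_ge0.
  have -> : u / p = (u - q) / p + q / p by rewrite -mulrDl subrK.
  rewrite powRD; last by rewrite mn0 implybT.
  rewrite xE ler_pM ?powR_ge0// ge0_ler_powR ?nnegrE// ?lerDl ?lerDr//.
  by rewrite divr_ge0// ltW.
apply: (@le_trans _ _ ((m `^ (u / p)) `^ (v / u))).
  by apply: ge0_ler_powR => //; rewrite nnegrE ?mulr_ge0 ?powR_ge0.
rewrite -powRrM (_ : u / p * (v / u) = v / p); last by field; rewrite !gt_eqF.
rewrite -addrA; apply: powR_le_1D => //; rewrite divr_ge0 ?(ltW v0) ?(ltW p0)//=.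
by rewrite ler_pdivrMr// mul1r.
Qed.

(* Near the circle W is at most its cone supremum n^(1/p), elsewhere it is at
   most (M / depth)^(1/p); the two bounds agree at depth M / n. *)
Lemma embedding_gt : p < v -> p^-1 - v^-1 <= e ->
  (\int[mu]_(t in @period_itv R) (tent_area u (s + e) G t `^ (v / u)) < +oo)%E.
Proof.
move=> pv e1; have mG := power_series_measurable aG.
pose e0 := p^-1 - v^-1.
have e00 : 0 < e0 by rewrite subr_gt0 ltf_pV2.
have a0 : 0 < e0 * u by rewrite mulr_gt0.
have b0 : 0 < u / v by rewrite divr_gt0.
have [C1 C10 hC1] := Gam_integral_depth_lt a0.
have [C2 C20 hC2] := Gam_integral_depth_ge b0.
have [M' M'0 hM'] := tent_growth p0 q0 aG fin.
pose M := M' + 1; have M0 : 0 < M by rewrite ltr_wpDl.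
have hM t z : 0 <= t <= 2 * pi -> Gam t z -> wmod s G z `^ p * depth z <= M.
  by move=> t02 zt; rewrite (le_trans (hM' t z t02 zt))// lerDl.
pose K := (4 * C1 + 4 * C2) * M `^ (e0 * u).
have K0 : 0 <= K by rewrite mulr_ge0 ?powR_ge0// addr_ge0// mulr_ge0.
have wle z : disk z -> wmod (s + e) G z `^ u * depth z `^ (- 2) <=
    wmod s G z `^ u * depth z `^ (e0 * u - 2).
  move=> zd; have d0 := depth_gt0 zd.
  rewrite wmodD// powRM ?powR_ge0 ?wmod_ge0// -powRrM.
  rewrite [depth z `^ (e0 * u - 2)](powRD_gt0 _ _ d0).
  rewrite mulrAC mulrC ler_wpM2l ?powR_ge0// ler_wpM2r ?powR_ge0//.
  by rewrite ger_powR ?d0 ?depth_le1// ler_wpM2r// ltW.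
apply: (@tent_finite_of_le (K `^ (v / u))); first exact: powR_ge0.
move=> t n x t02 n0 x0 NE AE.
have [n00|nn0] := eqVneq n 0.
  have -> : tent_area u (s + e) G t = 0%E.
    apply/eqP; rewrite eq_le tent_area_ge0 andbT /tent_area {1}(Gam_depth_lt t).
    apply: le_trans (@Gam_area_le t 0 0 _ _ _ _ mG _ _ _) _ => //.
    - exact: area_set_depth_lt.
    - move=> z zt _; apply: le_trans (wle z (Gam_disk zt)) _.
      have := wmod_cone NE zt; rewrite n00 => w0.
      have {w0} : wmod s G z `^ p = 0 by apply/eqP; rewrite eq_le w0 powR_ge0.
      by move=> /powR_eq0_eq0 ->; rewrite powR0 ?gt_eqF// !mul0r.
    - by rewrite mulr0 mul0e.
  by rewrite poweR0r ?gt_eqF ?divr_gt0// lee_fin mulr_ge0 ?powR_ge0// !addr_ge0 ?powR_ge0.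
have ngt0 : 0 < n by rewrite lt0r nn0.
pose r := M / n; have r0 : 0 < r by rewrite divr_gt0.
have ue : u / p - u / v = e0 * u by rewrite /e0; field; rewrite !gt_eqF.
apply: (@le_trans _ _ ((K * n `^ (u / v)) `^ (v / u))%:E).
  apply: poweR_le_EFin => //; first exact: tent_area_ge0.
    by rewrite mulr_ge0// powR_ge0.
  rewrite /tent_area {1}(Gam_depth_split t r) area_integral_setU//; last 5 first.
  - by apply: measurableI; [exact: area_set_Gam|exact: area_set_depth_lt].
  - by apply: measurableI; [exact: area_set_Gam|exact: area_set_depth_ge].
  - by rewrite -Gam_depth_split; exact: area_fun_tent_density_Gam.
  - by move=> z; rewrite lee_fin tent_density_ge0.
  - apply/disj_setPS => z [[_]]; rewrite /depth_lt /= => h [_]; rewrite /depth_ge /=.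
    by rewrite leNgt h.
  have h1 : (area_integral (Gam t `&` depth_lt r) (fun z => (tent_density u (s + e) G z)%:E) <=
      (4 * C1 * (M `^ (e0 * u) * n `^ (u / v)))%:E)%E.
    apply: le_trans (@Gam_area_le t (n `^ (u / p)) (e0 * u - 2) _ _ _ _ mG _ _ _) _.
    - exact: area_set_depth_lt.
    - exact: powR_ge0.
    - move=> z zt _; apply: le_trans (wle z (Gam_disk zt)) _.
      by rewrite ler_wpM2r ?powR_ge0//; exact: wmod_powR_le (wmod_cone NE zt).
    apply: le_trans (lee_wpmul2l _ (hC1 t r r0)) _.
      by rewrite lee_fin mulr_ge0// powR_ge0.
    rewrite -EFinM lee_fin.
    have -> : r `^ (e0 * u) = M `^ (e0 * u) * n `^ (- (e0 * u)).
      by rewrite /r -powR_inv1// powRM ?powR_ge0 ?(ltW M0)// -powRrM mulN1r.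
    have -> : n `^ (u / v) = n `^ (u / p) * n `^ (- (e0 * u)).
      rewrite -powRD; last by rewrite nn0 implybT.
      by rewrite -ue opprB addrCA subrr addr0.
    rewrite [leLHS](_ : _ = 4 * C1 * (M `^ (e0 * u) * (n `^ (u / p) * n `^ (- (e0 * u)))))//.
    by ring.
  have h2 : (area_integral (Gam t `&` depth_ge r) (fun z => (tent_density u (s + e) G z)%:E) <=
      (4 * C2 * (M `^ (e0 * u) * n `^ (u / v)))%:E)%E.
    apply: le_trans (@Gam_area_le t (M `^ (u / p)) (- (u / v) - 2) _ _ _ _ mG _ _ _) _.
    - exact: area_set_depth_ge.
    - exact: powR_ge0.
    - move=> z zt _; have zd := Gam_disk zt; have d0 := depth_gt0 zd.
      apply: le_trans (wle z zd) _.
      have h3 : wmod s G z `^ p <= M / depth z.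
        by rewrite ler_pdivlMr//; exact: hM t02 zt.
      have h4 : wmod s G z `^ u <= M `^ (u / p) * depth z `^ (- (u / p)).
        apply: le_trans (wmod_powR_le h3) _.
        by rewrite -powR_inv1 ?(ltW d0)// powRM ?powR_ge0 ?(ltW M0)// -powRrM mulN1r.
      apply: le_trans (ler_wpM2r (powR_ge0 _ _) h4) _.
      rewrite -mulrA -(powRD_gt0 _ _ d0).
      by rewrite (_ : - (u / p) + (e0 * u - 2) = - (u / v) - 2)// -ue; ring.
    apply: le_trans (lee_wpmul2l _ (hC2 t r r0)) _.
      by rewrite lee_fin mulr_ge0// powR_ge0.
    rewrite -EFinM lee_fin.
    have -> : r `^ (- (u / v)) = M `^ (- (u / v)) * n `^ (u / v).
      rewrite /r -(powR_inv1 n0) powRM ?powR_ge0 ?(ltW M0)// -[(n `^ -1) `^ _]powRrM.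
      by rewrite mulrNN mul1r.
    have -> : M `^ (e0 * u) = M `^ (u / p) * M `^ (- (u / v)).
      by rewrite -(powRD_gt0 _ _ M0)// ue.
    rewrite [leLHS](_ : _ = 4 * C2 * (M `^ (u / p) * M `^ (- (u / v)) * n `^ (u / v)))//.
    by ring.
  apply: le_trans (leeD h1 h2) _; rewrite -EFinD lee_fin /K.
  by rewrite -mulrDl mulrA.
rewrite lee_fin powRM ?powR_ge0// ler_wpM2l ?powR_ge0//.
rewrite -powRrM (_ : u / v * (v / u) = 1); last by field; rewrite !gt_eqF.
by rewrite powRr1//; have := powR_ge0 x (p / q); lra.
Qed.

End embeddings.

(** * The spaces in terms of coefficients *)

Section triebel_lizorkin_theory.
Variable R : realType.
Notation mu := (@lebesgue_measure R).
Implicit Types (a : nat -> R[i]) (f G : R[i] -> R[i]) (p q u v s alpha beta : R).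

(** Sign convention: these are the coefficients of the transform of order -s, which differentiates
    when s > 0. *)
Definition flett_coef s a n : R[i] := (n.+1%:R `^ s)%:C * a n.

Lemma flettE s f G : flett (- s%:C) f G <->
  exists2 a, power_series_on_disk a f & power_series_on_disk (flett_coef s a) G.
Proof.
have -> // : flett (- s%:C) f G = (exists2 a, power_series_on_disk a f &
    power_series_on_disk (flett_coef s a) G).
rewrite /flett; congr ex2; apply/funext => a.
have -> // : (fun n => succn_cpow n (- - s%:C) * a n) = flett_coef s a.
apply/funext => n; rewrite /flett_coef /succn_cpow opprK /= mul0r cexp_i0 mulr1.
by rewrite /powR pnatr_eq0.
Qed.

Lemma tentE p q s G : measurable_on_disk G ->
  tent p q (- 2) (fun z => ((1 - cmod z) `^ s)%:C * G z) <->
  (\int[mu]_(t in @period_itv R) (tent_area q s G t `^ (p / q)) < +oo)%E.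
Proof.
move=> mG; rewrite /tent /= tent_normpE; split => [[]//|h]; split => //.
apply: (@cmeasurableM R _ _ _ (fun w : R * R => ((1 - cmod (to_complex w)) `^ s)%:C)
  (fun w => G (to_complex w))) mG.
apply: cmeasurable_real; apply: measurable_funTS.
by apply: (measurableT_comp (measurable_powR s)); exact: measurable_depth.
Qed.

(** For sums of power series on the disk, analyticity and measurability are automatic, so membership
    becomes the finiteness of one integral. *)
Lemma triebel_lizorkinP p q alpha f : triebel_lizorkin p q alpha f <->
  exists a s G, [/\ alpha < s, power_series_on_disk a f,
    power_series_on_disk (flett_coef s a) G &
    (\int[mu]_(t in @period_itv R) (tent_area q (s - alpha) G t `^ (p / q)) < +oo)%E].
Proof.
split.
  move=> [_ [s [als [G [/flettE[a af aG] /tentE tG]]]]].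
  exists a, s, G; split => //; apply: tG; exact: power_series_measurable aG.
move=> [a [s [G [als af aG fin]]]]; split; first exact: power_series_analytic af.
exists s; split => //; exists G; split; first by apply/flettE; exists a.
by apply/tentE => //; exact: power_series_measurable aG.
Qed.

(** The coefficients, the order and the transform stay the same; only the weight changes, by the
    depth to the power alpha - beta. The order remains admissible because each of the conditions
    forces beta <= alpha. *)
Lemma triebel_lizorkin_subset p q u v alpha beta :
  0 < p -> 0 < q -> 0 < u -> 0 < v ->
  (p < v /\ 1 / p - 1 / v - alpha + beta <= 0) \/
   (v <= p /\ (- alpha + beta < 0 \/ (- alpha + beta = 0 /\ q <= u))) ->
  triebel_lizorkin p q alpha `<=` triebel_lizorkin v u beta.
Proof.
move=> p0 q0 u0 v0 h f /triebel_lizorkinP[a [s [G [als af aG fin]]]].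
apply/triebel_lizorkinP; exists a, s, G.
have -> : s - beta = (s - alpha) + (alpha - beta) by rewrite addrA subrK.
case: h => [[pv e0]|[vp [e0|[e0 qu]]]].
- have e1 : p^-1 - v^-1 <= alpha - beta by move: e0; rewrite !div1r; lra.
  split => //; last exact: (embedding_gt p0 q0 u0 v0 aG fin).
  have : 0 < p^-1 - v^-1 by rewrite subr_gt0 ltf_pV2.
  lra.
- by split => //; [lra|apply: (embedding_lt p0 q0 u0 v0 aG fin) => //; lra].
- by split => //; [lra|apply: (embedding_eq p0 q0 u0 v0 aG fin) => //; lra].
Qed.

End triebel_lizorkin_theory.

(** * Necessity of the index condition *)

Section point_singularity.
Variable R : realType.
Implicit Types (z w : R[i]) (t u : R) (n k : nat).

(** The coefficients of (1-z)^(-k-1). Integer exponents suffice because the Flett transform supplies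
    any real shift of the order. *)
Definition binom_coef k n : R[i] := 'C(n + k, k)%:R.

Lemma cmod_nat n : cmod (n%:R : R[i]) = n%:R.
Proof. by rewrite -(rmorph_nat (@real_complex R)) cmod_real ger0_norm. Qed.

Lemma bin_le_expn n k : ('C(n + k, k) <= n.+1 ^ k)%N.
Proof.
elim: k => [|k ih]; first by rewrite bin0.
rewrite -(leq_pmul2l (ltn0Sn k)) addnS -mul_bin_diag /= expnS mulnA leq_mul//.
by rewrite mulSn mulnS addSn ltnS leq_add2l leq_addr.
Qed.

Lemma bin_ge_expn n k : (n.+1 ^ k <= k`! * 'C(n + k, k))%N.
Proof.
elim: k => [|k ih]; first by rewrite bin0.
rewrite factS addnS -mulnA mulnCA -mul_bin_diag /= expnS mulnCA leq_mul//.
by rewrite ltnS leq_addr.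
Qed.

Lemma fast_decay_binom k : fast_decay (binom_coef k).
Proof.
apply: (@fast_decay_le R (fun n => (n.+1%:R `^ k%:R)%:C * 1) _ 1); last first.
  apply: fast_decay_powR => r r0 r1; exists 1 => n.
  by rewrite cmod1 mul1r exprn_ile1// ltW.
move=> n; rewrite mul1r mulr1 cmod_nat cmod_real ger0_norm ?powR_ge0// powR_mulrn//.
by rewrite -natrX ler_nat bin_le_expn.
Qed.

(** Pascal's rule: multiplication by 1 - z lowers [k] up to one boundary term, which tends to 0 in
    the disk. It drives the induction of [power_series_binom]. *)
Lemma psum_binom k n z :
  (1 - z) * psum (binom_coef k.+1) n.+1 z = psum (binom_coef k) n.+1 z - binom_coef k.+1 n * z ^+ n.+1.
Proof.
elim: n => [|n ih].
  by rewrite /psum !big_nat1 /binom_coef !add0n !binn expr0 expr1; ring.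
rewrite psumS mulrDr ih [in RHS]psumS.
have -> : binom_coef k.+1 n.+1 = binom_coef k n.+1 + binom_coef k.+1 n.
  by rewrite /binom_coef addSn binS natrD addSnnS [in RHS]addrC.
rewrite !exprS; ring.
Qed.

Lemma cvg_term0 (a : nat -> R[i]) z : fast_decay a -> disk z ->
  forall e, 0 < e -> exists N, forall n, (N <= n)%N -> cmod (a n * z ^+ n) < e.
Proof.
move=> da zd e e0; have [f af] := fast_decay_power_series da.
move/power_seriesP: af => /(_ z zd (e / 2)) []; first by rewrite divr_gt0.
move=> N hN; exists N => n Nn.
have -> : a n * z ^+ n = (psum a n.+1 z - f z) - (psum a n z - f z) by rewrite psumS; ring.
have h1 := hN _ Nn; have h2 := hN n.+1 (leqW Nn).
by rewrite (le_lt_trans (cmodD _ _))// cmodN; lra.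
Qed.

Lemma power_series_binom k : power_series_on_disk (binom_coef k) (fun z => (1 - z) ^- k.+1).
Proof.
elim: k => [|k ih].
  apply/power_seriesP => z zd e e0.
  have z1 : 1 - z != 0.
    by rewrite subr_eq0; apply/eqP => h; move: zd; rewrite /disk /= -h cmod1 ltxx.
  have c1 : 0 < cmod (1 - z) by rewrite lt0r cmod_eq0 z1 cmod_ge0.
  have [N hN] := @geometric_lt R (cmod z) (cmod (1 - z))^-1 e (cmod_ge0 z) zd e0.
  exists N => n Nn; apply: le_lt_trans (hN n Nn).
  have -> : psum (binom_coef 0) n z - (1 - z) ^- 1 = - (z ^+ n / (1 - z)).
    apply: (mulfI z1); rewrite mulrBr expr1 mulfV// mulrN mulrCA mulfV// mulr1.
    have -> : psum (binom_coef 0) n z = \sum_(i < n) z ^+ i.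
      rewrite /psum big_mkord; apply: eq_bigr => i _.
      by rewrite /binom_coef bin0 mul1r.
    have := subrX1 z n => h; rewrite -(opprB z 1) mulNr -h; ring.
  by rewrite cmodN cmodM cmodV cmodX mulrC.
apply/power_seriesP => z zd e e0.
have z1 : 1 - z != 0.
  by rewrite subr_eq0; apply/eqP => h; move: zd; rewrite /disk /= -h cmod1 ltxx.
have c1 : 0 < cmod (1 - z) by rewrite lt0r cmod_eq0 z1 cmod_ge0.
have e1 : 0 < e * cmod (1 - z) / 2 by rewrite divr_gt0// mulr_gt0.
have [N1 h1] := (power_seriesP _ _).1 ih z zd _ e1.
have [N2 h2] := cvg_term0 (fast_decay_binom k.+1) zd e1.
exists (maxn N1 N2).+1 => -[//|n]; rewrite ltnS geq_max => /andP[n1 n2].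
rewrite -(ltr_pM2l c1) -cmodM mulrBr psum_binom.
have -> : (1 - z) * (1 - z) ^- k.+2 = (1 - z) ^- k.+1.
  by rewrite [in LHS]exprS invfM mulVKf.
rewrite addrAC (le_lt_trans (cmodD _ _))// cmodN.
have h3 : cmod (binom_coef k.+1 n * z ^+ n.+1) <= cmod (binom_coef k.+1 n * z ^+ n).
  rewrite exprSr mulrA [leLHS]cmodM ler_piMr ?cmod_ge0// ltW//.
rewrite [ltRHS]mulrC (splitr (e * _)) ltrD//; first exact: h1 (leqW n1).
exact: le_lt_trans h3 (h2 n n2).
Qed.

End point_singularity.

(** * Integrals of powers of the distance to the point 1 *)

Section circle_singularity.
Variable R : realType.
Notation mu := (@lebesgue_measure R).
Implicit Types (z w : R[i]) (t u x : R) (n k : nat).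

(** A weak form of Jordan's inequality. Up to 1 the cosine is at least 1/2, which gives sin y >=
    y/2; beyond 1, monotonicity gives sin x >= sin 1 >= 1/2, while x/4 <= 1/2. *)
Lemma sin_ge_quarter x : 0 <= x -> x <= pi / 2 -> x / 4 <= sin x.
Proof.
move=> x0 xpi.
have small (y : R) : 0 <= y -> y <= 1 -> y / 2 <= sin y.
  move=> y0 y1.
  have [|c /itvP cy] := @MVT_segment R sin cos 0 y y0 (fun (x : R) _ => is_derive_sin x).
    by apply: continuous_subspaceT => z; exact: continuous_sin.
  rewrite sin0 !subr0 => ->.
  have c0 : 0 <= c by rewrite cy.
  have c1 : c <= 1 by apply: le_trans y1; rewrite cy.
  have -> : cos c = 1 - sin (c / 2) ^+ 2 *+ 2.
    have -> : cos c = cos ((c / 2) *+ 2) by rewrite -[_ *+ 2]mulr_natr divfK.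
    rewrite cos_mulr2n cos2sin2; ring.
  have := sin_contraction (c / 2) 0; rewrite sin0 !subr0 => h.
  have : sin (c / 2) ^+ 2 <= (c / 2) ^+ 2.
    by rewrite -[_ ^+ 2]real_normK ?num_real// -[leRHS]real_normK ?num_real// lerXn2r ?nnegrE.
  by move=> h2; rewrite mulrC ler_wpM2r//; move: h2; rewrite -[sin _ ^+ 2 *+ 2]mulr_natl; nra.
have [x1|x1] := leP x 1; first by have := small x x0 x1; lra.
have pi2 := @pihalf_lt2 R; have pi1 := @pihalf_ge1 R.
apply: (@le_trans _ _ (sin 1)).
  by have := small 1 ler01 (lexx _); lra.
by rewrite leNgt ltr_sin -?leNgt ?(ltW x1)// in_itv /=; apply/andP; split; lra.
Qed.

(** Distance on the circle rather than the angle: it is small at both ends of the period, where the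
    vertex is close to 1. *)
Definition chord t : R := cmod (1 - cexp_i t).

Lemma chordE t : chord t = 2 * `|sin (t / 2)|.
Proof.
rewrite /chord -[1]/(1 +i* 0) /cexp_i; simpc.
have tE : t = (t / 2) *+ 2 by rewrite -mulr_natr divfK.
rewrite cmodE sqrrN {1 2}tE cos_mulr2n sin_mulr2n.
have -> : (1 - (cos (t / 2) ^+ 2 *+ 2 - 1)) ^+ 2 + (cos (t / 2) * sin (t / 2) *+ 2) ^+ 2 =
   4 * ((1 - cos (t / 2) ^+ 2) ^+ 2 + cos (t / 2) ^+ 2 * sin (t / 2) ^+ 2) by ring.
rewrite -sin2cos2 cos2sin2.
rewrite (_ : 4 * _ = (2 * sin (t / 2)) ^+ 2); last by ring.
by rewrite sqrtr_sqr normrM ger0_norm.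
Qed.

Definition chord_lt (r : R) : set R := [set t | chord t < r].
Definition chord_ge (r : R) : set R := [set t | r <= chord t].

Lemma chord_lt_sub (r : R) : @period_itv R `&` chord_lt r `<=`
  `[0, (4 * r)]%classic `|` `[(2 * pi - 4 * r), (2 * pi)]%classic.
Proof.
move=> t []; rewrite /period_itv /chord_lt /= in_itv /= => /andP[t0 t1]; rewrite chordE => h.
have pi0 := pi_gt0 R; rewrite !in_itv /=.
have s0 : 0 <= sin (t / 2) by apply: sin_ge0_pi; apply/andP; split; lra.
rewrite ger0_norm// in h.
have [tp|tp] := leP t pi.
  left; rewrite t0/=; have : t / 2 / 4 <= sin (t / 2) by apply: sin_ge_quarter; lra.
  by lra.
right; apply/andP; split; last by lra.
have : (pi - t / 2) / 4 <= sin (pi - t / 2) by apply: sin_ge_quarter; lra.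
have -> : sin (pi - t / 2) = sin (t / 2).
  by rewrite addrC sinDpi sinN opprK.
lra.
Qed.

Lemma continuous_chord_measurable : measurable_fun setT chord.
Proof.
apply: measurable_cmod; apply: cmeasurableD; first exact: cmeasurable_cst.
apply: cmeasurableN; split; apply: continuous_measurable_fun.
- exact: continuous_cos.
- exact: continuous_sin.
Qed.

Lemma measurable_chord_lt (r : R) : measurable (chord_lt r).
Proof.
have := measurable_fun_ltr continuous_chord_measurable (measurable_cst r).
by move=> /(_ measurableT [set true] I); rewrite setTI.
Qed.

Lemma measurable_chord_ge (r : R) : measurable (chord_ge r).
Proof.
have := measurable_fun_ler (measurable_cst r) continuous_chord_measurable.
by move=> /(_ measurableT [set true] I); rewrite setTI.
Qed.

Lemma mu_chord_lt (r : R) : 0 < r ->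
  (mu (@period_itv R `&` chord_lt r) <= (8 * r)%:E)%E.
Proof.
move=> r0.
have m1 : measurable (`[0, (4 * r)]%classic : set R) by exact: measurable_itv.
have m2 : measurable (`[(2 * pi - 4 * r), (2 * pi)]%classic : set R) by exact: measurable_itv.
apply: (@le_trans _ _ (mu (`[0, (4 * r)]%classic `|` `[(2 * pi - 4 * r), (2 * pi)]%classic))).
  apply: le_measure; rewrite ?inE.
  - by apply: measurableI; [exact: measurable_period_itv|exact: measurable_chord_lt].
  - exact: measurableU.
  - exact: chord_lt_sub.
rewrite [leRHS](_ : _ = (4 * r)%:E + (4 * r)%:E)%E; last by rewrite -EFinD; congr EFin; ring.
have mU := @measureU2 _ _ _ mu _ _ m1 m2; apply: le_trans mU _; apply: leeD.
  by rewrite [leLHS](lebesgue_measure_itv `[0, (4 * r)]) /= lte_fin mulr_gt0// -EFinB subr0.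
rewrite [leLHS](lebesgue_measure_itv `[(2 * pi - 4 * r), (2 * pi)]) /=.
rewrite lte_fin ifT; last by lra.
by rewrite -EFinB lee_fin; lra.
Qed.

Lemma integral_chord_power (T : R -> \bar R) (K b : R) : measurable_fun setT T ->
  (forall t, (0 <= T t)%E) -> 0 <= K -> 0 <= b -> b < 1 ->
  (forall t, 0 < chord t -> (T t <= (K * chord t `^ (- b))%:E)%E) ->
  (\int[mu]_(t in @period_itv R) T t < +oo)%E.
Proof.
move=> mT T0 K0 b0 b1 TK; have pi0 := pi_gt0 R.
(* The endpoint 0, where the chord vanishes and no bound on T is assumed, is removed. *)
rewrite /period_itv -integral_itv_obnd_cbnd; last exact: measurable_funTS.
pose F k := @period_itv R `&` chord_ge (4 * 2^-1 ^+ k.+1) `&`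
  chord_lt (2 * (4 * 2^-1 ^+ k.+1)).
have mF k : measurable (F k).
  apply: measurableI; last exact: measurable_chord_lt.
  by apply: measurableI; [exact: measurable_period_itv|exact: measurable_chord_ge].
have h2 k : 0 < 2^-1 ^+ k :> R by rewrite exprn_gt0// invr_gt0.
have AF : `]0, (2 * pi)[%classic `<=` \bigcup_k F k.
  move=> t /=; rewrite in_itv /= => /andP[t0 t1].
  have c0 : 0 < chord t.
    rewrite chordE mulr_gt0// normr_gt0 gt_eqF// sin_gt0_pi//; apply/andP; split; lra.
  have c4 : chord t < 4.
    by rewrite chordE; have := sin_max (t / 2); lra.
  have [k /andP[k1 k2]] := dyadic_below c0 c4.
  by exists k => //; split => //; split => //; rewrite /period_itv /= in_itv /= t1 ltW.
apply: le_lt_trans (ge0_integral_cover mu _ mF AF _ _ T0) _.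
- exact: measurable_itv.
- exact: measurable_funTS.
- by move=> k; exact: measurable_funTS.
pose x : R := 2^-1 `^ (1 - b).
have x1 : 0 <= x < 1 by apply: half_powR_lt1; rewrite subr_gt0.
pose C := K * 2 `^ (- b) * 32.
have C0 : 0 <= C by apply: mulr_ge0 => //; apply: mulr_ge0 => //; exact: powR_ge0.
apply: (@le_lt_trans _ _ (\sum_(0 <= k <oo) (C * x ^+ k)%:E)%E); last first.
  exact: le_lt_trans (nneseries_geometric_le C0 x1) (ltry _).
apply: lee_nneseries => k _; first by move=> _; apply: integral_ge0.
apply: (@le_trans _ _ (\int[mu]_(t in F k) (K * (2 * 2^-1 ^+ k) `^ (- b))%:E)%E).
  apply: ge0_le_integral => //.
  - exact: mF.
  - exact: measurable_funTS.
  - move=> t [[_ /= c1] _].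
    have e2 : 4 * 2^-1 ^+ k.+1 = 2 * 2^-1 ^+ k :> R by rewrite exprS; field.
    rewrite e2 in c1; have k0 : 0 < 2 * 2^-1 ^+ k :> R by rewrite mulr_gt0.
    have c0 := lt_le_trans k0 c1.
    apply: le_trans (TK t c0) _; rewrite lee_fin ler_wpM2l//.
    rewrite !powRN lef_pV2 ?posrE ?powR_gt0//.
    by rewrite ge0_ler_powR ?nnegrE ?(ltW k0) ?(ltW c0).
rewrite integral_cst_mu//.
have P0 : 0 <= K * (2 * 2^-1 ^+ k) `^ (- b) by rewrite mulr_ge0// powR_ge0.
have r0 : 0 < 2 * (4 * 2^-1 ^+ k.+1) :> R by rewrite mulr_gt0// mulr_gt0.
apply: (@le_trans _ _ ((K * (2 * 2^-1 ^+ k) `^ (- b))%:E * (8 * (2 * (4 * 2^-1 ^+ k.+1)))%:E)%E).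
  apply: lee_wpmul2l; first by rewrite lee_fin.
  apply: le_trans (mu_chord_lt r0); apply: le_measure; rewrite ?inE; [exact: mF| |by move=> t [[tp _] tr]].
  by apply: measurableI; [exact: measurable_period_itv|exact: measurable_chord_lt].
rewrite -EFinM lee_fin powRM ?(ltW (h2 _))//.
have -> : x ^+ k = (2^-1 ^+ k) `^ (- b) * 2^-1 ^+ k.
  rewrite /x -powR_exprn ?invr_ge0// powRD ?(gt_eqF (h2 k)) ?implybT//.
  by rewrite powRr1 ?(ltW (h2 _))// mulrC.
rewrite /C exprS; by apply: eq_le_refl; field.
Qed.

End circle_singularity.

(** * Test functions with a singularity at 1 *)

Section necessity_of_index.
Variable R : realType.
Notation mu := (@lebesgue_measure R).
Implicit Types (z w : R[i]) (t : R) (n k : nat) (p q u v s alpha beta : R).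

Definition point_pole k z : R[i] := (1 - z) ^- k.+1.

Lemma chord_le t z : Gam t z -> chord t <= 3 * cmod (1 - z).
Proof.
move=> zt; have h := Gam_dist zt.
have e1 : chord t <= cmod (cexp_i t - z) + cmod (1 - z).
  by rewrite (cmodB _ z) addrC; exact: cmod_dist.
have e2 : 1 - cmod z <= cmod (1 - z) by have := cmod_sub_le 1 z; rewrite cmod1.
lra.
Qed.

(** The pole is split as |1-z|^(-(k+1-b)) |1-z|^(-b). The first factor is bounded through depth z <=
    |1-z|, the second through the distance from the vertex to 1, with [b] left free to share the
    singularity between depth and vertex. *)
Lemma wmod_point_pole_le k t z (l b : R) : 0 <= b <= k.+1%:R -> Gam t z -> 0 < chord t ->
  wmod (k.+1%:R - l) (point_pole k) z <= depth z `^ (b - l) * (3 `^ b * chord t `^ (- b)).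
Proof.
move=> /andP[b0 bk] zt c0; have zd := Gam_disk zt; have d0 := depth_gt0 zd.
have e2 : depth z <= cmod (1 - z) by have := cmod_sub_le 1 z; rewrite cmod1.
have e3 := chord_le zt.
have x0 : 0 < cmod (1 - z) by exact: lt_le_trans d0 e2.
rewrite /wmod /point_pole cmodV cmodX.
have -> : (cmod (1 - z) ^+ k.+1)^-1 =
    cmod (1 - z) `^ (- (k.+1%:R - b)) * cmod (1 - z) `^ (- b).
  rewrite -(powRD_gt0 _ _ x0).
  by rewrite opprB addrAC subrr add0r powRN powR_mulrn// ltW.
have -> : depth z `^ (b - l) = depth z `^ (k.+1%:R - l) * depth z `^ (- (k.+1%:R - b)).
  rewrite -(powRD_gt0 _ _ d0).
  by congr (_ `^ _); ring.
rewrite -mulrA ler_wpM2l ?powR_ge0// ler_pM ?powR_ge0//.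
  rewrite !powRN lef_pV2 ?posrE ?powR_gt0//.
  have kb : 0 <= k.+1%:R - b by rewrite subr_ge0.
  by rewrite ge0_ler_powR ?nnegrE ?(ltW d0) ?(ltW x0).
have -> : 3 `^ b * chord t `^ (- b) = (chord t / 3) `^ (- b).
  rewrite powRM ?(ltW c0) ?invr_ge0// mulrC; congr (_ * _).
  by rewrite powRN -[in RHS](powR_inv1 (_ : 0 <= 3))// -powRrM mulN1r powRN invrK.
rewrite !powRN lef_pV2 ?posrE ?powR_gt0 ?divr_gt0//.
by rewrite ge0_ler_powR ?nnegrE ?(ltW x0) ?divr_ge0 ?(ltW c0)//; lra.
Qed.

Lemma power_series_point_pole k : power_series_on_disk (binom_coef R k) (point_pole k).
Proof. exact: power_series_binom. Qed.

Lemma tent_point_pole p q (l : R) k : 0 < p -> 0 < q -> 0 < l -> l < p^-1 -> p^-1 <= k.+1%:R ->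
  (\int[mu]_(t in @period_itv R) (tent_area q (k.+1%:R - l) (point_pole k) t `^ (p / q)) < +oo)%E.
Proof.
move=> p0 q0 l0 lp pk.
have mG := power_series_measurable (@power_series_point_pole k).
(* b > l leaves a positive power of the depth, integrable over the region, and b p < 1 makes the
   remaining power of the chord integrable over the circle. *)
pose b := (l + p^-1) / 2; pose e := b - l.
have b0 : 0 <= b by rewrite /b; lra.
have bk : b <= k.+1%:R by rewrite /b; lra.
have e0 : 0 < e by rewrite /e /b; lra.
have bp1 : b * p < 1 by rewrite -ltr_pdivlMr// div1r /b; lra.
have eq0 : 0 < e * q by rewrite mulr_gt0.
have [C C0 hC] := Gam_integral_depth_lt eq0.
pose K0 := 4 * (C * 2 `^ (e * q)).
have K00 : 0 <= K0 by rewrite mulr_ge0// mulr_ge0// powR_ge0.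
apply: (@integral_chord_power _ _ (K0 `^ (p / q) * 3 `^ (b * p)) (b * p)) => //.
- exact: measurable_tent_area_poweR.
- by move=> t; exact: poweR_ge0.
- by rewrite mulr_ge0// powR_ge0.
- by rewrite mulr_ge0// ltW.
move=> t c0; pose m := 3 `^ b * chord t `^ (- b).
have m0 : 0 <= m by rewrite mulr_ge0// powR_ge0.
have -> : K0 `^ (p / q) * 3 `^ (b * p) * chord t `^ (- (b * p)) = (K0 * m `^ q) `^ (p / q).
  have mp : (m `^ q) `^ (p / q) = 3 `^ (b * p) * chord t `^ (- (b * p)).
    rewrite -powRrM (_ : q * (p / q) = p); last by field; rewrite gt_eqF.
    by rewrite powRM ?powR_ge0// -!powRrM mulNr.
  by rewrite [RHS](powRM _ K00 (powR_ge0 _ _)) mp mulrA.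
apply: poweR_le_EFin; first by rewrite divr_ge0 ?ltW.
- exact: tent_area_ge0.
- by rewrite mulr_ge0// powR_ge0.
rewrite /tent_area {1}(Gam_depth_lt t).
apply: le_trans (@Gam_area_le _ t (m `^ q) (e * q - 2) _ _ _ _ mG _ _ _) _.
- exact: area_set_depth_lt.
- exact: powR_ge0.
- move=> z zt _; have d0 := depth_gt0 (Gam_disk zt).
  rewrite (powRD_gt0 _ _ d0).
  rewrite mulrA ler_wpM2r ?powR_ge0// mulrC powRrM -powRM ?powR_ge0//.
  rewrite ge0_ler_powR ?nnegrE ?(ltW q0) ?wmod_ge0 ?mulr_ge0 ?powR_ge0//.
  by apply: wmod_point_pole_le => //; rewrite b0.
apply: le_trans (lee_wpmul2l _ (hC t 2 _)) _ => //.
  by rewrite lee_fin mulr_ge0// powR_ge0.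
by rewrite -EFinM lee_fin /K0; apply: eq_le_refl; ring.
Qed.

Lemma flett_coefK s a : flett_coef s (flett_coef (- s) a) = a :> (nat -> R[i]).
Proof.
apply/funext => n; rewrite /flett_coef mulrA -rmorphM -powRD; last by rewrite pnatr_eq0 implybT.
by rewrite subrr powRr0 mul1r.
Qed.

Lemma flett_coefD s s' a : flett_coef s (flett_coef s' a) = flett_coef (s + s') a :> (nat -> R[i]).
Proof.
apply/funext => n; rewrite /flett_coef mulrA -rmorphM -powRD//.
by rewrite pnatr_eq0 implybT.
Qed.

(** At a real point all terms are nonnegative, so the value dominates every block of the series. *)
Lemma psum_le_nonneg (c : nat -> R) (G : R[i] -> R[i]) (r : R) N M :
  (forall n, 0 <= c n) -> 0 <= r -> r < 1 -> power_series_on_disk (fun n => (c n)%:C) G ->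
  (N <= M)%N -> \sum_(N <= i < M) c i * r ^+ i <= cmod (G r%:C).
Proof.
move=> c0 r0 r1 /power_seriesP hG NM; apply/ler_addgt0Pr => e e0.
have rd : disk r%:C by rewrite /disk /= cmod_real ger0_norm.
have [N' hN] := hG _ rd e e0; pose n := maxn N' M.
have h := hN n (leq_maxl _ _).
have pE : psum (fun n => (c n)%:C) n r%:C = (\sum_(0 <= i < n) c i * r ^+ i)%:C.
  by rewrite /psum rmorph_sum; apply: eq_bigr => i _; rewrite rmorphM rmorphXn.
have t0 i : 0 <= c i * r ^+ i by rewrite mulr_ge0// exprn_ge0.
have h1 : \sum_(N <= i < M) c i * r ^+ i <= \sum_(0 <= i < n) c i * r ^+ i.
  rewrite (big_cat_nat (leq0n N) (leq_trans NM (leq_maxr _ _)))/=.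
  rewrite (big_cat_nat NM (leq_maxr _ _))/= addrCA lerDl addr_ge0//; exact: sumr_ge0.
apply: le_trans h1 _; have s0 : 0 <= \sum_(0 <= i < n) c i * r ^+ i by exact: sumr_ge0.
rewrite -[leLHS]ger0_norm// -cmod_real -pE.
have -> : psum (fun n => (c n)%:C) n r%:C = G r%:C + (psum (fun n => (c n)%:C) n r%:C - G r%:C) by ring.
by rewrite (le_trans (cmodD _ _))// lerD2l ltW.
Qed.

Lemma powR_unbounded (c M d : R) : 0 < c -> 0 < d -> exists n, M < c * n.+1%:R `^ d.
Proof.
move=> c0 d0; pose m := `|M| / c + 1; have m0 : 0 < m by rewrite ltr_wpDl// divr_ge0// ltW.
have [n hn] : exists n : nat, m `^ d^-1 <= n%:R.
  by exists (Num.bound (m `^ d^-1)); rewrite ltW// archi_boundP// powR_ge0.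
exists n; apply: (@lt_le_trans _ _ (c * m)).
  rewrite /m mulrDr mulr1 mulrCA mulfV ?gt_eqF// mulr1 ltr_pwDr//; exact: ler_norm.
have -> : m = (m `^ d^-1) `^ d by rewrite -powRrM mulVf ?gt_eqF// powRr1// ltW.
rewrite ler_pM2l//.
rewrite ge0_ler_powR ?nnegrE ?powR_ge0 ?(ltW d0)//.
by rewrite (le_trans hn)// ler_nat.
Qed.

Lemma Gam0_real (r : R) : 0 < r -> r < 1 -> Gam 0 r%:C.
Proof.
move=> r0 r1; apply/GamE; rewrite /disk /= cexp_i0 cmod_real ger0_norm ?ltW//; split => //.
rewrite -[1]/(1%:C) -rmorphB cmod_real ger0_norm ?subr_ge0 ?ltW//.
by rewrite ltrD2l ltrN2 expr2 gtr_pMr.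
Qed.

(** With N = n+1 and r = 1 - 1/(4N), the block N <= i < 2N alone has N terms of order N^x. In the
    constant, 2 comes from r^i >= 1/2, the factorial from the lower bound on the binomial
    coefficient, and the power of 2 from i+1 <= 2N. *)
Lemma point_pole_growth k (x : R) : exists2 c, 0 < c & forall G n,
  power_series_on_disk (flett_coef (x - k%:R) (binom_coef R k)) G ->
  c * n.+1%:R `^ (x + 1) <= cmod (G (1 - (4 * n.+1%:R)^-1)%:C).
Proof.
exists ((2 * k`!%:R * 2 `^ `|x|)^-1).
  by rewrite invr_gt0 !mulr_gt0 ?powR_gt0// ltr0n fact_gt0.
move=> G n hG; pose N := n.+1; pose r : R := 1 - (4 * N%:R)^-1.
have N0 : 0 < N%:R :> R by rewrite ltr0n.
have N1 : 1 <= N%:R :> R by rewrite ler1n.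
have i0 : 0 < (4 * N%:R)^-1 :> R by rewrite invr_gt0 mulr_gt0.
have i1 : (4 * N%:R)^-1 <= 4^-1 :> R by rewrite lef_pV2 ?posrE ?mulr_gt0// ler_peMr.
have r0 : 0 <= r by rewrite /r; lra.
have r1 : r < 1 by rewrite /r; lra.
pose c i : R := i.+1%:R `^ (x - k%:R) * 'C(i + k, k)%:R.
have c0 i : 0 <= c i by rewrite mulr_ge0 ?powR_ge0.
have hG' : power_series_on_disk (fun i => (c i)%:C) G.
  have <- // : flett_coef (x - k%:R) (binom_coef R k) = (fun i => (c i)%:C).
  by apply/funext => i; rewrite /flett_coef /binom_coef /c rmorphM rmorph_nat.
apply: le_trans (psum_le_nonneg c0 r0 r1 hG' (_ : N <= N + N)%N); last exact: leq_addr.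
have rN : 2^-1 <= r ^+ (N + N).
  pose y : R := (4 * N%:R)^-1; have y1 : y <= 1 by rewrite /y; lra.
  have y01 : 0 <= y <= 1 by rewrite (ltW i0).
  apply: le_trans (bernoulli _ y01); rewrite natrD /y.
  have -> : (N%:R + N%:R) * (4 * N%:R)^-1 = 2^-1 :> R by field; rewrite gt_eqF.
  lra.
have k0 : 0 < k`!%:R :> R by rewrite ltr0n fact_gt0.
have P0 : 0 < 2 `^ `|x| :> R by rewrite powR_gt0.
have term i : (N <= i < N + N)%N ->
    (2 * k`!%:R * 2 `^ `|x|)^-1 * N%:R `^ x <= c i * r ^+ i.
  move=> /andP[Ni iN].
  have ri : 2^-1 <= r ^+ i.
    by apply: le_trans rN _; apply: ler_wiXn2l => //; [exact: ltW|exact: ltnW].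
  have h1 : N%:R `^ x <= 2 `^ `|x| * i.+1%:R `^ x.
    apply: powR_comparable_ge => //.
      rewrite ler_pdivrMr// (le_trans (_ : N%:R <= i.+1%:R))//; first by rewrite ler_nat leqW.
      by rewrite ler_peMr// ler1n.
    by rewrite -natrM ler_nat mul2n -addnn.
  have h2 : i.+1%:R `^ x <= k`!%:R * c i.
    rewrite -[x](subrK k%:R) powRD; last by rewrite pnatr_eq0 implybT.
    rewrite /c mulrCA ler_wpM2l ?powR_ge0// powR_mulrn// -natrX -natrM ler_nat.
    exact: bin_ge_expn.
  rewrite mulrC ler_pdivrMr; last by rewrite !mulr_gt0.
  apply: le_trans h1 _; apply: (@le_trans _ _ (2 `^ `|x| * (k`!%:R * c i))).
    by rewrite ler_wpM2l// ltW.
  have y0 : 0 <= 2 `^ `|x| * (k`!%:R * c i).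
    by apply: mulr_ge0; [exact: ltW|apply: mulr_ge0; [exact: ltW|exact: c0]].
  rewrite [leRHS](_ : _ = (2 `^ `|x| * (k`!%:R * c i)) * (2 * r ^+ i)); last by ring.
  by rewrite ler_peMr//; lra.
rewrite powRD; last by rewrite pnatr_eq0 implybT.
rewrite powRr1//.
rewrite mulrA; apply: (@le_trans _ _ (\sum_(N <= i < N + N) (2 * k`!%:R * 2 `^ `|x|)^-1 * N%:R `^ x)).
  by rewrite sumr_const_nat addnK -[leRHS]mulr_natr.
by rewrite big_nat [leRHS]big_nat; apply: ler_sum => i /term.
Qed.

(** If the index were positive, some g would satisfy 1/v - beta < g < 1/p - alpha. A function with
    coefficients of order n^(g-1) then lies in the source, while on the radius to 1 its transforms
    of every order break the growth bound W^v (1-|z|) <= M of the target. *)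
Lemma triebel_lizorkin_subset_index p q u v alpha beta : 0 < p -> 0 < q -> 0 < u -> 0 < v ->
  triebel_lizorkin p q alpha `<=` triebel_lizorkin v u beta ->
  1 / p - 1 / v - alpha + beta <= 0.
Proof.
move=> p0 q0 u0 v0 sub; rewrite leNgt; apply/negP => gap; rewrite !div1r in gap.
have ip0 : 0 < p^-1 by rewrite invr_gt0.
(* Besides 1/v - beta, g also has to exceed -alpha, so that l = g + alpha is positive. *)
pose m := Num.max (v^-1 - beta) (- alpha).
have m1 : v^-1 - beta <= m by rewrite le_max lexx.
have m2 : - alpha <= m by rewrite le_max lexx orbT.
have mp : m < p^-1 - alpha by rewrite /m gt_max; apply/andP; split; lra.
pose g := (m + (p^-1 - alpha)) / 2; pose l := g + alpha.
have g1 : v^-1 - beta < g by rewrite /g; lra.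
have l0 : 0 < l by rewrite /l /g; lra.
have lp : l < p^-1 by rewrite /l /g; lra.
have [k pk] : exists k : nat, p^-1 <= k.+1%:R.
  exists (Num.bound p^-1); rewrite (le_trans (ltW (archi_boundP (ltW ip0))))//.
  by rewrite ler_nat.
pose s := k.+1%:R - g.
have [f hf] := fast_decay_power_series (fast_decay_powR (- s) (@fast_decay_binom R k)).
have : triebel_lizorkin p q alpha f.
  apply/triebel_lizorkinP; exists (flett_coef (- s) (binom_coef R k)), s, (point_pole k); split.
  - by rewrite /s; move: lp pk; rewrite /l; lra.
  - exact: hf.
  - by rewrite flett_coefK; exact: power_series_point_pole.
  - have -> : s - alpha = k.+1%:R - l by rewrite /s /l; ring.
    exact: tent_point_pole.
move=> /sub /triebel_lizorkinP[a [s' [G [bs af aG fin]]]].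
have aE := power_series_unique af hf.
rewrite aE flett_coefD in aG.
have [M M0 hM] := tent_growth v0 u0 aG fin.
(* The transform of order -s' has coefficients of order n^x, hence grows like N^(x+1) at depth
   1/(4N). The weight with exponent s' - beta leaves N^(g + beta), and v (g + beta) > 1. *)
pose x := s' + g - 1.
have xE : s' + - s = x - k%:R by rewrite /x /s -natr1; ring.
rewrite xE in aG; have [c c0 hc] := point_pole_growth k x.
pose d := v * (g + beta) - 1.
have d0 : 0 < d.
  by rewrite subr_gt0 -(@mulfV _ v) ?gt_eqF// ltr_pM2l//; lra.
pose c1 := (4^-1 `^ (s' - beta) * c) `^ v * 4^-1.
have c10 : 0 < c1 by apply: mulr_gt0 => //; apply: powR_gt0; apply: mulr_gt0 => //; exact: powR_gt0.
have [n] := powR_unbounded M c10 d0; apply/negP; rewrite -leNgt.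
pose N : R := n.+1%:R; have N0 : 0 < N by rewrite ltr0n.
have N1 : 1 <= N by rewrite ler1n.
have i0 : 0 < (4 * N)^-1 by rewrite invr_gt0 mulr_gt0.
have i1 : (4 * N)^-1 <= 4^-1 by rewrite lef_pV2 ?posrE ?mulr_gt0// ler_peMr.
pose r : R := 1 - (4 * N)^-1.
have r0 : 0 < r by rewrite subr_gt0 (le_lt_trans i1)// invf_lt1// ltr1n.
have r1 : r < 1 by rewrite gtrBl.
have dE : depth r%:C = 4^-1 / N.
  by rewrite /depth cmod_real ger0_norm ?(ltW r0)// /r opprB addrC subrK invfM.
have zz : 0 <= (0 : R) <= 2 * pi by have pi0 := pi_gt0 R; apply/andP; split; lra.
apply: le_trans (hM 0 _ zz (Gam0_real r0 r1)).
have iN0 : 0 < N^-1 by rewrite invr_gt0.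
have h1 : (4^-1 `^ (s' - beta) * c) * N `^ (g + beta) <= wmod (s' - beta) G r%:C.
  rewrite /wmod dE powRM ?invr_ge0 ?(ltW N0)// -!mulrA ler_wpM2l ?powR_ge0// [leRHS]mulrC.
  apply: le_trans (ler_wpM2r _ (hc G n aG)); last exact: powR_ge0.
  rewrite -mulrA ler_wpM2l ?(ltW c0)// -(powR_inv1 (ltW N0)) -powRrM.
  rewrite -(powRD_gt0 _ _ N0).
  by apply: eq_le_refl; congr (_ `^ _); rewrite /x; ring.
have h2 : ((4^-1 `^ (s' - beta) * c) * N `^ (g + beta)) `^ v <= wmod (s' - beta) G r%:C `^ v.
  have A0 : 0 <= 4^-1 `^ (s' - beta) * c by rewrite mulr_ge0 ?powR_ge0// ltW.
  by rewrite ge0_ler_powR ?nnegrE ?(ltW v0) ?wmod_ge0// mulr_ge0// powR_ge0.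
rewrite dE; apply: le_trans (ler_wpM2r _ h2); last by rewrite mulr_ge0// ?invr_ge0// ltW.
have -> : n.+1%:R `^ d = (N `^ (g + beta)) `^ v / N.
  by rewrite -powRrM -/N -(powR_inv1 (ltW N0)) -(powRD_gt0 _ _ N0)// /d [v * _]mulrC.
have A0 : 0 <= 4^-1 `^ (s' - beta) * c by rewrite mulr_ge0 ?powR_ge0// ltW.
rewrite (powRM _ A0 (powR_ge0 _ _)).
by rewrite /c1; apply: eq_le_refl; ring.
Qed.

End necessity_of_index.

(** * Necessity of q <= u *)

Section lacunary_series.
Variable R : realType.
Implicit Types (b c : nat -> R) (z : R[i]) (n k j K : nat).

(* The ratios of consecutive frequencies tend to infinity, so that for every
   order of the transform a single term dominates where the depth is comparable
   to the inverse of its frequency. *)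
Definition lac_index k := (2 ^ (k * k))%N.

Lemma lac_index_gt0 k : (0 < lac_index k)%N.
Proof. by rewrite expn_gt0. Qed.

Lemma lac_indexK k : (lac_index k).-1.+1 = lac_index k.
Proof. by rewrite prednK// lac_index_gt0. Qed.

Lemma lac_index_gt k : (k < lac_index k)%N.
Proof. by apply: leq_ltn_trans (ltn_expl _ _) => //; case: k => // k; exact: leq_pmulr. Qed.

Lemma lac_indexS k : lac_index k.+1 = (lac_index k * 2 ^ k.*2.+1)%N.
Proof.
rewrite /lac_index -expnD; congr (2 ^ _)%N.
by rewrite mulSn mulnS addSn -addnn addnS addnA; congr _.+1; exact: addnC.
Qed.

Lemma lac_index_ltS k : (lac_index k < lac_index k.+1)%N.
Proof. by rewrite lac_indexS ltn_Pmulr ?lac_index_gt0// expnS leq_pmulr// expn_gt0. Qed.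

Lemma lac_index_le k j : (k <= j)%N -> (lac_index k <= lac_index j)%N.
Proof. by move=> kj; rewrite leq_exp2l// leq_mul. Qed.

Lemma lac_index_inj : injective lac_index.
Proof.
move=> k j /eqP; rewrite eqn_exp2l// => /eqP h.
by apply/eqP; rewrite -eqn_sqr -!mulnn h.
Qed.

(** The k-th value is placed at n = [(lac_index k).-1], so that n+1 is exactly a frequency and the
    Flett transform multiplies by an exact power of it. The range of the sum is wide enough because
    k < [lac_index k]. *)
Definition lacunary b n : R := \sum_(k < n.+1 | lac_index k == n.+1) b k.

Lemma lacunary_index b k : lacunary b (lac_index k).-1 = b k.
Proof.
have kn : (k < (lac_index k).-1.+1)%N by rewrite lac_indexK lac_index_gt.
rewrite /lacunary (big_pred1 (Ordinal kn))// => i /=; apply/eqP/eqP => [h|->].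
  by apply: val_inj; apply: lac_index_inj; exact: etrans h (lac_indexK k).
exact/esym/lac_indexK.
Qed.

Lemma lacunary_gap b n : (forall k, lac_index k != n.+1) -> lacunary b n = 0.
Proof. by move=> h; rewrite /lacunary big_pred0// => i; exact/negbTE. Qed.

Lemma lacunary_le1 b n : (forall k, `|b k| <= 1) -> `|lacunary b n| <= 1.
Proof.
move=> b1; have [/existsP[k /eqP h]|/existsPn h] := boolP [exists k : 'I_n.+1, lac_index k == n.+1].
  have -> : n = (lac_index k).-1 by rewrite h.
  by rewrite lacunary_index.
rewrite lacunary_gap ?normr0// => k; apply/eqP => hk.
have kn : (k < n.+1)%N by rewrite -hk lac_index_gt.
by have := h (Ordinal kn); rewrite /= hk eqxx.
Qed.

Lemma psum_lacunary b K z : psum (fun n => (lacunary b n)%:C) (lac_index K) z =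
  \sum_(0 <= k < K.+1) (b k)%:C * z ^+ (lac_index k).-1.
Proof.
elim: K => [|K ih].
  by rewrite /psum -[lac_index 0]/1%N !big_nat1 (lacunary_index b 0).
have h : (lac_index K <= (lac_index K.+1).-1)%N by rewrite -ltnS lac_indexK lac_index_ltS.
rewrite big_nat_recr//= -ih /psum -[in LHS](lac_indexK K.+1) big_nat_recr//= lacunary_index.
congr (_ + _); rewrite (big_cat_nat (leq0n _) h)/= -[RHS]addr0; congr (_ + _).
rewrite big_nat big1// => n /andP[n1 n2].
rewrite lacunary_gap ?mul0r// => j; apply/eqP => jn.
have [jK|Kj] := leqP j K.
  by have := lac_index_le jK; rewrite jn ltnNge n1.
by have := lac_index_le Kj; rewrite jn -lac_indexK leqNgt ltnS n2.
Qed.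

(** For lacunary series only the partial sums that end at a frequency are convenient to estimate,
    hence the subsequence. *)
Lemma power_series_le_subseq (a : nat -> R[i]) (f : R[i] -> R[i]) z (m : nat -> nat) (B : R) :
  power_series_on_disk a f -> disk z -> (forall K, (K <= m K)%N) ->
  (forall K, cmod (psum a (m K) z) <= B) -> cmod (f z) <= B.
Proof.
move=> /power_seriesP af zd mK h; apply/ler_addgt0Pr => e e0.
have [N hN] := af z zd e e0; have h1 := h N; have h2 := hN (m N) (mK N).
have -> : f z = psum a (m N) z - (psum a (m N) z - f z) by ring.
by apply: le_trans (cmodD _ _) _; rewrite cmodN; lra.
Qed.

Lemma power_series_ge_subseq (a : nat -> R[i]) (f : R[i] -> R[i]) z (m : nat -> nat) (B : R) K0 :
  power_series_on_disk a f -> disk z -> (forall K, (K <= m K)%N) ->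
  (forall K, (K0 <= K)%N -> B <= cmod (psum a (m K) z)) -> B <= cmod (f z).
Proof.
move=> /power_seriesP af zd mK h; apply/ler_addgt0Pr => e e0.
have [N hN] := af z zd e e0; pose K := maxn K0 N.
have h1 := h K (leq_maxl _ _).
have h2 := hN (m K) (leq_trans (leq_maxr _ _) (mK K)).
apply: le_trans h1 _.
have -> : psum a (m K) z = f z + (psum a (m K) z - f z) by ring.
by apply: le_trans (cmodD _ _) _; lra.
Qed.

Variable u : R.
Hypothesis u0 : 0 < u.

(* In l^q for every q > u, but not in l^u. *)
Definition lac_weight k : R := k.+1%:R `^ (- u^-1).
Definition lac_coef (s : R) k : R := (lac_index k)%:R `^ s * lac_weight k.
Definition lac_series (s : R) n : R[i] := (lacunary (lac_coef s) n)%:C.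

Lemma lac_weight_gt0 k : 0 < lac_weight k.
Proof. by rewrite powR_gt0. Qed.

Lemma lac_weight_le1 k : lac_weight k <= 1.
Proof.
rewrite -(powRr0 (k.+1%:R : R)) ler_powR ?ler1n// oppr_le0 invr_ge0 ltW//.
Qed.

Lemma lac_index_R_gt0 k : 0 < (lac_index k)%:R :> R.
Proof. by rewrite ltr0n lac_index_gt0. Qed.

Lemma flett_lac_series s s' : flett_coef s (lac_series s') = lac_series (s + s').
Proof.
apply/funext => n; rewrite /flett_coef /lac_series -rmorphM; congr (_%:C).
rewrite /lacunary mulr_sumr; apply: eq_bigr => k /eqP kn.
have -> : n.+1%:R = (lac_index k)%:R :> R by rewrite kn.
by rewrite /lac_coef mulrA -powRD// (gt_eqF (lac_index_R_gt0 k)) implybT.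
Qed.

Lemma fast_decay_lac_series s : fast_decay (lac_series s).
Proof.
rewrite -[s]addr0 -flett_lac_series; apply: fast_decay_powR.
apply: (@fast_decay_le _ (fun=> 1) _ 1) => [n|r r0 r1]; last first.
  by exists 1 => n; rewrite cmod1 mul1r exprn_ile1// ltW.
rewrite cmod1 mulr1 cmod_real lacunary_le1// => k.
by rewrite /lac_coef powRr0 mul1r ger0_norm ?lac_weight_le1// ltW// lac_weight_gt0.
Qed.

Lemma lac_term_le (s : R) k z : disk z ->
  depth z `^ s * ((lac_index k)%:R `^ s * cmod z ^+ (lac_index k).-1) <=
  expR 1 * (((lac_index k)%:R * depth z) `^ s * expR (- ((lac_index k)%:R * depth z))).
Proof.
move=> zd; have d0 := depth_gt0 zd; have N0 := lac_index_R_gt0 k.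
rewrite powRM ?(ltW d0) ?(ltW N0)//.
set A := _ `^ s; set B := _ `^ s.
rewrite [leLHS](_ : _ = B * A * cmod z ^+ (lac_index k).-1); last by ring.
rewrite [leRHS](_ : _ = B * A * (expR 1 * expR (- ((lac_index k)%:R * depth z)))); last by ring.
rewrite ler_wpM2l ?mulr_ge0 ?powR_ge0//.
have := expr_le_expR (lac_index k).-1 (cmod_ge0 z) (ltW zd).
by rewrite lac_indexK.
Qed.

End lacunary_series.

(** * The lacunary series lies in the source when u < q *)

Section lacunary_membership.
Variable R : realType.
Notation mu := (@lebesgue_measure R).
Implicit Types (z : R[i]) (t : R) (n k j K : nat) (G : R[i] -> R[i]).
Variable u : R.
Hypothesis u0 : 0 < u.

Local Notation c := (lac_weight u).

(** Profile of the k-th term, concentrated where the depth is the inverse of its frequency. The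
    inverse is written as a real power, which is measurable as such; in the disk it is the
    reciprocal. *)
Definition lac_bump k z : R :=
  Num.min ((lac_index k)%:R * depth z) (((lac_index k)%:R * depth z) `^ (- 1)).

Lemma lac_index_depth_gt0 k z : disk z -> 0 < (lac_index k)%:R * depth z.
Proof. by move=> zd; rewrite mulr_gt0 ?depth_gt0// lac_index_R_gt0. Qed.

Lemma lac_bumpE k z : disk z -> lac_bump k z =
  Num.min ((lac_index k)%:R * depth z) ((lac_index k)%:R * depth z)^-1.
Proof. by move=> zd; rewrite /lac_bump powR_inv1// ltW// lac_index_depth_gt0. Qed.

Lemma lac_bump_ge0 k z : disk z -> 0 <= lac_bump k z.
Proof. by move=> zd; rewrite le_min powR_ge0 ltW// lac_index_depth_gt0. Qed.

Lemma sum_lac_bump_le n z : disk z -> \sum_(0 <= k < n) lac_bump k z <= 4.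
Proof.
move=> zd; under eq_bigr do rewrite lac_bumpE//.
apply: (@sum_min_inv_le _ (fun k => (lac_index k)%:R * depth z)) => k.
  exact: lac_index_depth_gt0.
rewrite mulrA ler_wpM2r ?(ltW (depth_gt0 zd))// -natrM ler_nat lac_indexS mulnC.
by rewrite leq_mul// expnS leq_pmulr// expn_gt0.
Qed.

(** 256 is 4^4, from [powR_expRN_le] with exponent 4, used when 1/x is the minimum. The square of
    the minimum leaves one factor to be summed over the terms and one to be raised to the power
    q. *)
Lemma powR2_expRN_le (x : R) : 0 < x -> x `^ 2 * expR (- x) <= 256 * Num.min x x^-1 ^+ 2.
Proof.
move=> x0; have E0 := expR_ge0 (- x).
have E1 : expR (- x) <= 1 by rewrite -[leRHS]expR0 ler_expR oppr_le0 ltW.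
have x20 : 0 <= x ^+ 2 by exact: sqr_ge0.
rewrite powR_mulrn ?(ltW x0)//; have [x1|x1] := leP x x^-1.
  by apply: (@le_trans _ _ (x ^+ 2 * 1)); [rewrite ler_wpM2l|lra].
have h : x ^+ 4 * expR (- x) <= 256.
  have := @powR_expRN_le R 4 x ltac:(lra) x0.
  rewrite !powR_mulrn ?(ltW x0)// => h; apply: le_trans h _.
  by apply: eq_le_refl; ring.
rewrite exprVn -[leRHS]/(256 / x ^+ 2) ler_pdivlMr ?exprn_gt0//.
by rewrite (_ : x ^+ 2 * expR (- x) * x ^+ 2 = x ^+ 4 * expR (- x)); [exact: h|ring].
Qed.

Definition lac_const : R := expR 1 * 256.

Lemma lac_const_gt0 : 0 < lac_const.
Proof. by apply: mulr_gt0; [exact: expR_gt0|rewrite ltr0n]. Qed.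

Lemma wmod_psum_lac_le K z : disk z ->
  depth z `^ 2 * cmod (psum (lac_series u 2) (lac_index K) z) <=
  lac_const * \sum_(0 <= k < K.+1) c k * lac_bump k z ^+ 2.
Proof.
move=> zd; rewrite psum_lacunary.
apply: (@le_trans _ _ (\sum_(0 <= k < K.+1) depth z `^ 2 * ((lac_index k)%:R `^ 2 * cmod z ^+ (lac_index k).-1) * c k)).
  rewrite [leRHS](eq_bigr (fun k => depth z `^ 2 * (cmod ((lac_coef u 2 k)%:C * z ^+ (lac_index k).-1)))); last first.
    move=> k _; rewrite cmodM cmodX cmod_real ger0_norm; last first.
      by apply: mulr_ge0; exact: powR_ge0.
    by rewrite /lac_coef; ring.
  by rewrite -mulr_sumr ler_wpM2l ?powR_ge0// cmod_sum.
rewrite mulr_sumr; apply: ler_sum => k _; have c0 := lac_weight_gt0 u k.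
rewrite [leRHS](_ : _ = expR 1 * (256 * lac_bump k z ^+ 2) * c k); last by rewrite /lac_const; ring.
rewrite ler_wpM2r ?(ltW c0)//; apply: le_trans (lac_term_le 2 k zd) _.
rewrite ler_wpM2l ?expR_ge0// lac_bumpE// powR2_expRN_le// mulr_gt0 ?depth_gt0//.
exact: lac_index_R_gt0.
Qed.

(** Valid for every q > 0, also below 1: one factor c_k times the bump is bounded by its l^q norm,
    and the bumps that remain sum to at most 4. *)
Lemma sum_lac_weight_le q n z : 0 < q -> disk z ->
  \sum_(0 <= k < n) c k * lac_bump k z ^+ 2 <=
  4 * (\sum_(0 <= k < n) (c k * lac_bump k z) `^ q) `^ q^-1.
Proof.
move=> q0 zd; set S := \sum_(0 <= k < n) _ `^ q.
have S0 : 0 <= S by apply: sumr_ge0 => k _; exact: powR_ge0.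
have y0 k : 0 <= c k * lac_bump k z.
  by rewrite mulr_ge0 ?lac_bump_ge0// ltW// lac_weight_gt0.
have yS k : (k < n)%N -> c k * lac_bump k z <= S `^ q^-1.
  move=> kn; apply: powR_le_root => //; rewrite /S (bigD1_seq k) ?mem_index_iota ?iota_uniq//=.
  by rewrite lerDl sumr_ge0// => j _; exact: powR_ge0.
apply: (@le_trans _ _ (\sum_(0 <= k < n) S `^ q^-1 * lac_bump k z)).
  rewrite big_nat [leRHS]big_nat; apply: ler_sum => k /andP[_ kn].
  by rewrite expr2 mulrA ler_wpM2r ?lac_bump_ge0// yS.
by rewrite -mulr_sumr mulrC ler_wpM2r ?powR_ge0// sum_lac_bump_le.
Qed.

Lemma wmod_lac_le q G z : 0 < q -> power_series_on_disk (lac_series u 2) G -> disk z ->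
  ((wmod 2 G z `^ q)%:E <= ((lac_const * 4) `^ q)%:E *
    \sum_(0 <= k <oo) ((c k * lac_bump k z) `^ q)%:E)%E.
Proof.
move=> q0 hG zd; set A := lac_const * 4; set X := (\sum_(0 <= k <oo) _)%E.
have A0 : 0 < A by rewrite mulr_gt0// lac_const_gt0.
have A1 : 0 < A `^ q by rewrite powR_gt0.
have d0 := depth_gt0 zd.
pose y k := (c k * lac_bump k z) `^ q.
have y0 k : (0 <= (y k)%:E)%E by rewrite lee_fin powR_ge0.
have hX n : ((\sum_(0 <= k < n) y k)%:E <= X)%E.
  by rewrite -sumEFin; exact: nneseries_ge_partial.
have X0 : (0 <= X)%E by apply: nneseries_ge0 => k _ _; exact: y0.
case XE : X hX X0 => [x| |] // hX x0; last by rewrite gt0_muley ?leey// lte_fin.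
rewrite lee_fin in x0.
rewrite -EFinM lee_fin.
have h : wmod 2 G z <= A * x `^ q^-1.
  rewrite /wmod mulrC -ler_pdivlMr ?powR_gt0//.
  apply: (power_series_le_subseq (m := lac_index) hG zd) => K; first exact/ltnW/lac_index_gt.
  rewrite ler_pdivlMr ?powR_gt0// mulrC; apply: le_trans (wmod_psum_lac_le K zd) _.
  rewrite /A -[leRHS]mulrA ler_wpM2l ?(ltW lac_const_gt0)//.
  apply: le_trans (sum_lac_weight_le K.+1 q0 zd) _; rewrite ler_wpM2l//.
  have hK := hX K.+1; rewrite lee_fin in hK.
  rewrite ge0_ler_powR ?nnegrE ?invr_ge0 ?(ltW q0)//.
  by apply: sumr_ge0 => k _; exact: powR_ge0.
have -> : A `^ q * x = (A * x `^ q^-1) `^ q.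
  by rewrite powRM ?(ltW A0) ?powR_ge0// -powRrM mulVf ?gt_eqF// powRr1.
by rewrite ge0_ler_powR ?nnegrE ?(ltW q0) ?wmod_ge0// mulr_ge0 ?powR_ge0// ltW.
Qed.

Lemma measurable_lac_bump k : measurable_fun setT (fun w : R * R => lac_bump k (to_complex w)).
Proof.
have mx : measurable_fun setT (fun w : R * R => (lac_index k)%:R * depth (to_complex w)).
  by apply: measurable_funM; [exact: measurable_cst|exact: measurable_depth].
apply: measurable_minr => //.
exact: (measurableT_comp (measurable_powR (- 1)) mx).
Qed.

Lemma area_fun_lac_bump k q e A : area_fun A (fun z => (lac_bump k z `^ q * depth z `^ e)%:E).
Proof.
apply: measurable_funTS; apply/measurable_EFinP; apply: measurable_funM.
  by apply: (measurableT_comp (measurable_powR q)); exact: measurable_lac_bump.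
by apply: (measurableT_comp (measurable_powR e)); exact: measurable_depth.
Qed.

(** The measure depth^(-2) dA on an approach region is invariant under scaling up to constants, so
    the bound does not depend on the frequency. The region is cut at depth 1/N, where the minimum in
    the bump changes branch. *)
Lemma Gam_lac_bump_le q : 0 < q -> exists2 C, 0 <= C & forall t k,
  (area_integral (Gam t) (fun z => (lac_bump k z `^ q * depth z `^ (- 2))%:E) <= C%:E)%E.
Proof.
move=> q0; have [C1 C10 h1] := Gam_integral_depth_lt q0.
have [C2 C20 h2] := Gam_integral_depth_ge q0.
exists (C1 + C2) => [|t k]; first exact: addr_ge0.
pose N : R := (lac_index k)%:R; have N0 : 0 < N by exact: lac_index_R_gt0.
have iN0 : 0 < N^-1 by rewrite invr_gt0.
have Nq e : 0 <= N `^ e by exact: powR_ge0.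
have f0 z : (0 <= (lac_bump k z `^ q * depth z `^ (- 2))%:E)%E.
  by rewrite lee_fin mulr_ge0// powR_ge0.
have mlt : area_set (Gam t `&` depth_lt N^-1).
  by apply: measurableI; [exact: area_set_Gam|exact: area_set_depth_lt].
have mge : area_set (Gam t `&` depth_ge N^-1).
  by apply: measurableI; [exact: area_set_Gam|exact: area_set_depth_ge].
have g0 (e : R) z : (0 <= (depth z `^ e)%:E)%E by rewrite lee_fin powR_ge0.
rewrite {1}(Gam_depth_split t N^-1) area_integral_setU//; last 2 first.
- exact: area_fun_lac_bump.
- apply/disj_setPS => z [[_ a] [_ b]]; move: a b; rewrite /depth_lt /depth_ge /=.
  by move=> a b; have := lt_le_trans a b; rewrite ltxx.
rewrite EFinD; apply: leeD.
  apply: (@le_trans _ _ ((N `^ q)%:E * area_integral (Gam t `&` depth_lt N^-1) (fun z => (depth z `^ (q - 2))%:E))%E).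
    rewrite -area_integralZl//; last exact: area_fun_depth.
    apply: le_area_integral => //.
    - exact: area_fun_lac_bump.
    - by apply: emeasurable_funM; [exact: measurable_cst|exact: area_fun_depth].
    - move=> z [zt _]; have zd := Gam_disk zt; have d0 := depth_gt0 zd.
      rewrite -EFinM lee_fin (powRD_gt0 _ _ d0).
      rewrite mulrA ler_wpM2r ?powR_ge0// -powRM ?(ltW N0) ?(ltW d0)//.
      rewrite ge0_ler_powR ?nnegrE ?(ltW q0) ?lac_bump_ge0 ?mulr_ge0 ?(ltW N0) ?(ltW d0)//.
      by rewrite ge_min lexx.
  apply: le_trans (lee_wpmul2l _ (h1 t N^-1 iN0)) _; first by rewrite lee_fin.
  rewrite -EFinM lee_fin mulrCA -powRM ?(ltW N0) ?(ltW iN0)// mulfV ?gt_eqF// powR1 mulr1//.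
apply: (@le_trans _ _ ((N `^ (- q))%:E * area_integral (Gam t `&` depth_ge N^-1) (fun z => (depth z `^ (- q - 2))%:E))%E).
  rewrite -area_integralZl//; last exact: area_fun_depth.
  apply: le_area_integral => //.
  - exact: area_fun_lac_bump.
  - by apply: emeasurable_funM; [exact: measurable_cst|exact: area_fun_depth].
  - move=> z [zt _]; have zd := Gam_disk zt; have d0 := depth_gt0 zd.
    rewrite -EFinM lee_fin (powRD_gt0 _ _ d0).
    rewrite mulrA ler_wpM2r ?powR_ge0// -powRM ?(ltW N0) ?(ltW d0)//.
    have x0 : 0 < N * depth z by rewrite mulr_gt0.
    have -> : (N * depth z) `^ (- q) = ((N * depth z)^-1) `^ q.
      by rewrite -(powR_inv1 (ltW x0)) -powRrM mulN1r.
    rewrite -(powR_inv1 (ltW x0)) ge0_ler_powR ?nnegrE ?(ltW q0) ?lac_bump_ge0 ?powR_ge0//.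
    by rewrite ge_min lexx orbT.
apply: le_trans (lee_wpmul2l _ (h2 t N^-1 iN0)) _; first by rewrite lee_fin.
by rewrite -EFinM lee_fin mulrCA -powRM ?(ltW N0) ?(ltW iN0)// mulfV ?gt_eqF// powR1 mulr1.
Qed.

Lemma area_fun_nneseries (A : set R[i]) (f : nat -> R[i] -> \bar R) :
  (forall k, area_fun A (f k)) -> (forall k z, (0 <= f k z)%E) ->
  area_fun A (fun z => (\sum_(0 <= k <oo) f k z)%E).
Proof.
by move=> mf f0; apply: ge0_emeasurable_sum => k; [move=> *; exact: f0|move=> _; exact: mf].
Qed.

Lemma area_integral_nneseries (A : set R[i]) (f : nat -> R[i] -> \bar R) : area_set A ->
  (forall k, area_fun A (f k)) -> (forall k z, (0 <= f k z)%E) ->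
  area_integral A (fun z => (\sum_(0 <= k <oo) f k z)%E) =
  (\sum_(0 <= k <oo) area_integral A (f k))%E.
Proof.
by move=> mA mf f0; rewrite /area_integral integral_nneseries// => k w _; exact: f0.
Qed.

(** The area functional is bounded uniformly in the vertex by a multiple of the sum of the
    (k+1)^(-q/u), which converges since q > u. Boundedness in the vertex is why the exponent p is
    arbitrary. *)
Lemma tent_lac_finite p q G : 0 < p -> u < q -> power_series_on_disk (lac_series u 2) G ->
  (\int[mu]_(t in @period_itv R) (tent_area q 2 G t `^ (p / q)) < +oo)%E.
Proof.
move=> p0 uq hG; have q0 := lt_trans u0 uq; have mG := power_series_measurable hG.
have [C C0 hC] := Gam_lac_bump_le q0.
have [|B B0 hB] := @sum_powR_bounded R (q / u); first by rewrite ltr_pdivlMr// mul1r.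
pose A := (lac_const * 4) `^ q; have A0 : 0 <= A by exact: powR_ge0.
pose f k z : \bar R := ((c k * lac_bump k z) `^ q * depth z `^ (- 2))%:E.
have f0 k z : (0 <= f k z)%E by rewrite lee_fin mulr_ge0// powR_ge0.
have fE k z : disk z -> f k z = ((c k `^ q)%:E * (lac_bump k z `^ q * depth z `^ (- 2))%:E)%E.
  move=> zd; rewrite -EFinM /f powRM ?lac_bump_ge0 ?mulrA//.
  by rewrite ltW// lac_weight_gt0.
have mf k t : area_fun (Gam t) (f k).
  apply: measurable_funTS; apply/measurable_EFinP; apply: measurable_funM.
    apply: (measurableT_comp (measurable_powR q)); apply: measurable_funM.
      exact: measurable_cst.
    exact: measurable_lac_bump.
  by apply: (measurableT_comp (measurable_powR (- 2))); exact: measurable_depth.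
have bound t : (tent_area q 2 G t <= (4 * A * (C * B))%:E)%E.
  apply: (@le_trans _ _ ((4 * A)%:E * \sum_(0 <= k <oo) area_integral (Gam t) (f k))%E).
    have mS := area_fun_nneseries (fun k => mf k t) f0.
    rewrite -area_integral_nneseries//; last exact: area_set_Gam.
    rewrite -area_integralZl//; last 3 first.
    - exact: area_set_Gam.
    - by rewrite mulr_ge0.
    - by move=> z _; apply: nneseries_ge0 => k _ _; exact: f0.
    apply: le_area_integral.
    - exact: area_set_Gam.
    - exact: area_fun_tent_density_Gam.
    - by apply: emeasurable_funM; [exact: measurable_cst|exact: mS].
    - by move=> z _; rewrite lee_fin tent_density_ge0.
    - move=> z zt; have zd := Gam_disk zt.
      apply: (@le_trans _ _ (4 * (wmod 2 G z `^ q * depth z `^ (- 2)))%:E).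
        by rewrite lee_fin tent_density_le.
      have -> : (\sum_(0 <= k <oo) f k z = (depth z `^ (- 2))%:E *
          \sum_(0 <= k <oo) ((c k * lac_bump k z) `^ q)%:E)%E.
        rewrite -nneseriesZl//; last by move=> k _; rewrite lee_fin powR_ge0.
        by apply: eq_eseriesr => k _; rewrite -EFinM mulrC.
      rewrite !EFinM -muleA; apply: lee_wpmul2l; first by rewrite lee_fin.
      rewrite muleC [leRHS]muleCA; apply: lee_wpmul2l; first by rewrite lee_fin powR_ge0.
      exact: wmod_lac_le.
  rewrite [leRHS]EFinM; apply: lee_wpmul2l; first by rewrite lee_fin mulr_ge0.
  apply: nneseries_le_bound => [k|n].
    by apply: area_integral_ge0 => z _; exact: f0.
  apply: (@le_trans _ _ (\sum_(0 <= k < n) (k.+1%:R `^ (- (q / u)) * C)%:E)%E).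
    apply: lee_sum => k _; rewrite (eq_area_integral (k := fun z => ((c k `^ q)%:E * (lac_bump k z `^ q * depth z `^ (- 2))%:E)%E)); last first.
      by move=> z /(@Gam_disk _ t); exact: fE.
    rewrite area_integralZl ?powR_ge0//; last 3 first.
    - exact: area_set_Gam.
    - exact: area_fun_lac_bump.
    - by move=> z _; rewrite lee_fin mulr_ge0// powR_ge0.
    have -> : k.+1%:R `^ (- (q / u)) = c k `^ q.
      by rewrite /lac_weight -powRrM mulNr mulrC.
    by rewrite EFinM; apply: lee_wpmul2l; rewrite ?lee_fin ?powR_ge0.
  by rewrite sumEFin lee_fin -mulr_suml mulrC ler_wpM2l.
pose K := (4 * A * (C * B)) `^ (p / q).
apply: (@le_lt_trans _ _ (\int[mu]_(t in @period_itv R) K%:E)%E).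
  apply: ge0_le_integral => //.
  - exact: measurable_period_itv.
  - by move=> t _; exact: poweR_ge0.
  - by apply: measurable_funTS; exact: measurable_tent_area_poweR.
  - move=> t _; apply: poweR_le_EFin => //; first by rewrite divr_ge0 ?ltW.
    + exact: tent_area_ge0.
    + by rewrite !mulr_ge0.
rewrite integral_cst_mu; last exact: measurable_period_itv.
by rewrite mu_period_itv -EFinM ltry.
Qed.

End lacunary_membership.

(** * The lacunary series has infinite area functional with exponent u *)

Section lacunary_divergence.
Variable R : realType.
Notation mu := (@lebesgue_measure R).
Implicit Types (z : R[i]) (t s : R) (n k j K : nat) (G : R[i] -> R[i]).
Variable u : R.
Hypothesis u0 : 0 < u.

Local Notation c := (lac_weight u).
Local Notation N k := ((lac_index k)%:R : R).

Lemma lac_index_double k : 2 * N k <= N k.+1.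
Proof.
by rewrite -natrM ler_nat lac_indexS mulnC leq_mul// expnS leq_pmulr// expn_gt0.
Qed.

Lemma sum_inv_lac_index_le m M : (m <= M)%N -> \sum_(m <= j < M) (N j)^-1 <= 2 * (N m)^-1.
Proof.
move=> mM; suff h : \sum_(m <= j < M) (N j)^-1 <= 2 * ((N m)^-1 - (N M)^-1).
  have : 0 < (N M)^-1 by rewrite invr_gt0 lac_index_R_gt0.
  by lra.
elim: M mM => [|M ih]; first by rewrite leqn0 => /eqP ->; rewrite big_geq// subrr mulr0.
rewrite leq_eqVlt => /orP[/eqP <-|mM]; first by rewrite big_geq// subrr mulr0.
rewrite big_nat_recr//=; apply: le_trans (lerD (ih mM) (lexx _)) _.
have : (N M.+1)^-1 <= (2 * N M)^-1.
  by rewrite lef_pV2 ?posrE ?mulr_gt0 ?lac_index_R_gt0// lac_index_double.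
rewrite invfM; lra.
Qed.

(** The ratio of the frequency k to the previous one is 2^(2k-1) = 4^k / 2. Its exponential growth
    in k is what later beats the polynomial weights. *)
Lemma lac_index_lt_le j k : (j < k)%N -> N j <= 2 * 4^-1 ^+ k * N k.
Proof.
case: k => // k jk; apply: (@le_trans _ _ (N k)); first by rewrite ler_nat lac_index_le.
rewrite lac_indexS natrM natrX mulrCA ler_peMr ?(ltW (lac_index_R_gt0 _ _))//.
apply: eq_le_refl.
rewrite exprVn (_ : 4 = 2 ^+ 2); last by rewrite expr2; ring.
rewrite -exprM -[in RHS]mulrA.
have -> : (2 * k.+1 = k.*2.+1.+1)%N by rewrite mul2n doubleS.
by rewrite [in RHS]exprS invfM mulrA mulrA mulfV ?mul1r ?mulVf ?expf_neq0// pnatr_eq0.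
Qed.

(** Depth 3/(4 N_k) up to an error 1/(16 N_k). The upper bound below 1 keeps the Bernoulli estimate
    of the main term positive, and 13/16 < 2 (11/16) makes the zones of different frequencies
    disjoint. *)
Definition lac_zone k z := 11 / 16 <= N k * depth z <= 13 / 16.

Lemma lac_zone_disk k z : lac_zone k z -> disk z.
Proof.
move=> /andP[h _]; have N0 := lac_index_R_gt0 R k.
have : 0 < N k * depth z by lra.
by rewrite pmulr_rgt0// /depth subr_gt0.
Qed.

Lemma lac_main_term k z : lac_zone k z -> 3 / 16 <= cmod z ^+ (lac_index k).-1.
Proof.
move=> zk; have zd := lac_zone_disk zk; have d0 := depth_gt0 zd.
have z0 := cmod_ge0 z; case/andP: zk => _ zk.
have d01 : 0 <= depth z <= 1 by rewrite (ltW d0) depth_le1.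
have -> : cmod z = 1 - depth z by rewrite /depth; ring.
apply: le_trans (bernoulli _ d01); apply: (@le_trans _ _ (1 - N k * depth z)); first by lra.
by rewrite lerD2l lerN2 ler_wpM2r ?(ltW d0)// ler_nat leq_pred.
Qed.

(** Using the exponent s+1 in [powR_expRN_le] gains a factor 1/x with x = N_j depth, that is N_k /
    N_j up to a constant, which is summable over the higher frequencies. *)
Lemma lac_high_term (s : R) k j z : 0 < s -> lac_zone k z ->
  N j `^ s * cmod z ^+ (lac_index j).-1 <=
  expR 1 * 2 `^ s * (s + 1) `^ (s + 1) * 2 * N k `^ s * (N k / N j).
Proof.
move=> s0 zk; have zd := lac_zone_disk zk; have d0 := depth_gt0 zd.
have Nk := lac_index_R_gt0 R k; have Nj := lac_index_R_gt0 R j.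
case/andP: (zk) => zk1 _; pose x := N j * depth z; have x0 : 0 < x by rewrite mulr_gt0.
have s1 : 0 < s + 1 by rewrite addr_gt0.
have h1 := lac_term_le s j zd; rewrite -/x in h1.
have h2 := powR_expRN_le s1 x0.
rewrite powRD in h2; last by rewrite (gt_eqF x0) implybT.
rewrite (powRr1 (ltW x0)) in h2.
have h3 : x `^ s * expR (- x) <= (s + 1) `^ (s + 1) / x by rewrite ler_pdivlMr// mulrAC.
set S := (s + 1) `^ (s + 1) in h2 h3 *; have S0 : 0 < S by rewrite powR_gt0.
have P0 : 0 < depth z `^ s by rewrite powR_gt0.
have E0 := expR_gt0 (1 : R).
have h4 : (depth z `^ s)^-1 <= 2 `^ s * N k `^ s.
  rewrite -powRM ?(ltW Nk)// -powRN.
  have -> : depth z `^ (- s) = ((depth z)^-1) `^ s.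
    by rewrite -(powR_inv1 (ltW d0)) -powRrM mulN1r.
  rewrite ge0_ler_powR ?nnegrE ?(ltW s0) ?invr_ge0 ?(ltW d0) ?mulr_ge0 ?(ltW Nk)//.
  by rewrite -div1r ler_pdivrMr// -mulrA; lra.
have h5 : x^-1 <= 2 * (N k / N j).
  rewrite -div1r ler_pdivrMr// /x.
  have -> : 2 * (N k / N j) * (N j * depth z) = 2 * (N k * depth z) by field; rewrite gt_eqF.
  by lra.
apply: (@le_trans _ _ ((depth z `^ s)^-1 * (expR 1 * (S / x)))).
  rewrite [leRHS]mulrC ler_pdivlMr// mulrC; apply: le_trans h1 _.
  by rewrite ler_wpM2l// ltW.
rewrite [leRHS](_ : _ = (2 `^ s * N k `^ s) * (expR 1 * (S * (2 * (N k / N j))))); last by ring.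
apply: ler_pM => //.
- by rewrite invr_ge0 ltW.
- by rewrite mulr_ge0 ?(ltW E0)// mulr_ge0 ?(ltW S0)// invr_ge0 ltW.
- by rewrite ler_wpM2l ?(ltW E0)// ler_wpM2l ?(ltW S0).
Qed.

Lemma lac_low_term (s : R) k j z : 0 < s -> disk z -> (j < k)%N ->
  N j `^ s * cmod z ^+ (lac_index j).-1 <= 2 `^ s * (4^-1 `^ s) ^+ k * N k `^ s.
Proof.
move=> s0 zd jk; have Nk := lac_index_R_gt0 R k.
apply: (@le_trans _ _ (N j `^ s)).
  by rewrite ler_piMr ?powR_ge0// exprn_ile1 ?cmod_ge0// ltW.
rewrite -powR_exprn ?invr_ge0// -!powRM ?exprn_ge0 ?invr_ge0 ?mulr_ge0 ?exprn_ge0 ?invr_ge0 ?(ltW Nk)//.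
by rewrite ge0_ler_powR ?nnegrE ?(ltW s0)//; last exact: lac_index_lt_le.
Qed.

(** The main term is at least 3/16 of c_k N_k^s, and the lower and the higher terms are each at most
    1/16 of it once k is large: both are N_k^s times an exponentially small factor, whereas c_k only
    decays like a power. *)
Lemma psum_lac_ge (s : R) : 0 < s -> exists k0 : nat, forall k K z, (k0 <= k)%N -> (k <= K)%N ->
  lac_zone k z -> 16^-1 * (c k * N k `^ s) <= cmod (psum (lac_series u s) (lac_index K) z).
Proof.
move=> s0; pose q : R := 4^-1 `^ s.
have q0 : 0 <= q by exact: powR_ge0.
have q1 : q < 1.
  have := gt0_ltr_powR s0 (x := 4^-1) (y := 1); rewrite !nnegrE powR1; apply; lra.
have P0 : 0 < 2 `^ s :> R by rewrite powR_gt0.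
have [E E0 EE] : exists2 E, 0 < E & expR 1 * 2 `^ s * (s + 1) `^ (s + 1) * 2 = E.
  eexists; last by [].
  by apply: mulr_gt0 => //; apply: mulr_gt0; [apply: mulr_gt0; rewrite ?expR_gt0|rewrite powR_gt0// addr_gt0].
(* In the exponent, 1/u compensates the weight c_k and the added 1 the number k of lower terms. *)
have [|k1 h1] := @powR_geometric_lt R (u^-1 + 1) q (16 * 2 `^ s)^-1 q0 q1.
  by rewrite invr_gt0 mulr_gt0.
have [|||k2 h2] := @powR_geometric_lt R u^-1 4^-1 (16 * (2 * (2 * E)))^-1; [lra|lra| |].
  by rewrite invr_gt0; do 3 apply: mulr_gt0 => //.
exists (maxn k1 k2) => k K z; rewrite geq_max => /andP[kk1 kk2] kK zk.
have zd := lac_zone_disk zk; have Nk := lac_index_R_gt0 R k.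
have c0 := lac_weight_gt0 u k.
have NP : 0 < N k `^ s by rewrite powR_gt0.
pose T j := cmod z ^+ (lac_index j).-1 * (N j `^ s * c j).
have T0 j : 0 <= T j.
  by apply: mulr_ge0; [rewrite exprn_ge0 ?cmod_ge0|rewrite mulr_ge0 ?powR_ge0].
have TE j : cmod ((lac_coef u s j)%:C * z ^+ (lac_index j).-1) = T j.
  rewrite cmodM cmodX cmod_real ger0_norm 1?mulrC//.
  by apply: mulr_ge0; rewrite powR_ge0.
have Tle j : T j <= N j `^ s * cmod z ^+ (lac_index j).-1.
  rewrite /T mulrCA mulrA ler_piMr ?lac_weight_le1//; first by rewrite mulr_ge0 ?powR_ge0// exprn_ge0 ?cmod_ge0.
have cV : (k.+1%:R `^ u^-1)^-1 = c k by rewrite /lac_weight powRN.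
have kP : 0 < k.+1%:R `^ u^-1 :> R by rewrite powR_gt0.
have low : \sum_(0 <= j < k) T j <= 16^-1 * (c k * N k `^ s).
  apply: (@le_trans _ _ (\sum_(0 <= j < k) 2 `^ s * q ^+ k * N k `^ s)).
    rewrite big_nat [leRHS]big_nat; apply: ler_sum => j /andP[_ jk].
    by apply: le_trans (Tle j) _; exact: lac_low_term.
  rewrite sumr_const_nat subn0 -[leLHS]mulr_natr mulrA [leLHS]mulrAC ler_wpM2r ?(ltW NP)//.
  have := h1 k kk1; rewrite powRD; last by rewrite pnatr_eq0 implybT.
  rewrite powRr1// invfM => h.
  rewrite -cV -[leRHS]invfM -div1r ler_pdivlMr ?mulr_gt0//.
  have k1' : k%:R <= k.+1%:R :> R by rewrite ler_nat.
  apply: (@le_trans _ _ ((16 * 2 `^ s) * (k.+1%:R `^ u^-1 * k.+1%:R * q ^+ k))).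
    rewrite [leLHS](_ : _ = (16 * 2 `^ s * k.+1%:R `^ u^-1 * q ^+ k) * k%:R); last by ring.
    rewrite [leRHS](_ : _ = (16 * 2 `^ s * k.+1%:R `^ u^-1 * q ^+ k) * k.+1%:R); last by ring.
    by rewrite ler_wpM2l// !mulr_ge0 ?powR_ge0 ?exprn_ge0.
  rewrite -[leRHS](@mulfV _ (16 * 2 `^ s)); last by rewrite gt_eqF// mulr_gt0.
  by rewrite ler_pM2l ?mulr_gt0// invfM ltW.
have high : \sum_(k.+1 <= j < K.+1) T j <= 16^-1 * (c k * N k `^ s).
  apply: (@le_trans _ _ (\sum_(k.+1 <= j < K.+1) (E * N k `^ s * N k) * (N j)^-1)).
    apply: ler_sum => j _; apply: le_trans (Tle j) _; apply: le_trans (lac_high_term j s0 zk) _.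
    by rewrite EE mulrA.
  rewrite -mulr_sumr; apply: le_trans (ler_wpM2l _ (sum_inv_lac_index_le _)) _ => //.
    by rewrite !mulr_ge0 ?(ltW E0) ?(ltW NP) ?(ltW Nk).
  have hN : N k * (N k.+1)^-1 <= 4^-1 ^+ k * 2.
    rewrite ler_pdivrMr ?lac_index_R_gt0//.
    have := lac_index_lt_le (ltnSn k); rewrite exprS => hh; apply: le_trans hh _.
    rewrite ler_wpM2r ?(ltW (lac_index_R_gt0 _ _))//.
    have : 0 <= 4^-1 ^+ k :> R by rewrite exprn_ge0 ?invr_ge0.
    by lra.
  apply: (@le_trans _ _ (2 * (2 * E) * 4^-1 ^+ k * N k `^ s)).
    rewrite [leLHS](_ : _ = (2 * E * N k `^ s) * (N k * (N k.+1)^-1)); last by ring.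
    rewrite [leRHS](_ : _ = (2 * E * N k `^ s) * (4^-1 ^+ k * 2)); last by ring.
    by rewrite ler_wpM2l// !mulr_ge0 ?(ltW E0) ?(ltW NP).
  have F0 : 0 < 2 * (2 * E) by do 2 apply: mulr_gt0 => //.
  rewrite [leRHS]mulrA ler_wpM2r ?(ltW NP)// -cV; set F := 2 * (2 * E) in F0 h2 *.
  have F16 : 0 < 16 * F by apply: mulr_gt0.
  have := h2 k kk2; rewrite -[X in _ < X]div1r ltr_pdivlMr// => h.
  rewrite -[leRHS]invfM -[leRHS]div1r ler_pdivlMr; last exact: mulr_gt0.
  by apply/ltW; rewrite [ltLHS](_ : _ = k.+1%:R `^ u^-1 * 4^-1 ^+ k * (16 * F))//; ring.
rewrite psum_lacunary (big_cat_nat (leq0n k) (leqW kK))/= (big_ltn (_ : (k < K.+1)%N))//=.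
set A := \sum_(0 <= j < k) _; set B := \sum_(k.+1 <= j < K.+1) _; set D := (lac_coef u s k)%:C * _.
have hA : cmod A <= \sum_(0 <= j < k) T j.
  by rewrite -(eq_bigr _ (fun j _ => TE j)) cmod_sum.
have hB : cmod B <= \sum_(k.+1 <= j < K.+1) T j.
  by rewrite -(eq_bigr _ (fun j _ => TE j)) cmod_sum.
have hD : 3 / 16 * (c k * N k `^ s) <= cmod D.
  rewrite TE /T [N k `^ s * _]mulrC ler_wpM2r ?lac_main_term//.
  by rewrite mulr_ge0 ?(ltW c0) ?(ltW NP).
have e1 : cmod D <= cmod (A + (D + B)) + cmod A + cmod B.
  have DE : D = (A + (D + B)) - A - B by ring.
  rewrite {1}DE.
  apply: le_trans (cmodD _ _) _; rewrite cmodN lerD2r.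
  by apply: le_trans (cmodD _ _) _; rewrite cmodN.
lra.
Qed.

Definition lac_center t k : R[i] := (1 - 3 / 4 / N k)%:C * cexp_i t.
Definition lac_disc t k := disc (lac_center t k) (1 / 16 / N k).

Lemma lac_disc_zone t k : lac_disc t k `<=` lac_zone k.
Proof.
move=> z; rewrite /lac_disc /disc /lac_zone /=; have N0 := lac_index_R_gt0 R k.
have N1 : 1 <= N k by rewrite ler1n lac_index_gt0.
set r := _ / N k => zr.
have i1 : (N k)^-1 <= 1 by rewrite invf_le1.
have wE : cmod (lac_center t k) = 1 - 3 / 4 / N k.
  by rewrite cmodM cmod_cexp_i mulr1 cmod_real ger0_norm//; lra.
have h1 := cmod_sub_le z (lac_center t k).
have h2 := cmod_sub_le (lac_center t k) z; rewrite cmodB in h2.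
rewrite wE in h1 h2; rewrite /depth.
have e1 : N k * (3 / 4 / N k - r) = 11 / 16 by rewrite /r; field; rewrite gt_eqF.
have e2 : N k * (3 / 4 / N k + r) = 13 / 16 by rewrite /r; field; rewrite gt_eqF.
by rewrite -e1 -e2 !ler_pM2l//; apply/andP; split; lra.
Qed.

(** Points of the disc are at distance less than 13/(16 N) from the vertex, whereas 1-|z|^2 is at
    least 7/4 of the depth, hence at least (7/4)(11/16)/N; k >= 2 makes the depth small enough for
    the factor 7/4. *)
Lemma lac_disc_Gam t k : (2 <= k)%N -> lac_disc t k `<=` Gam t.
Proof.
move=> k2 z zk; have /andP[zz1 zz2] := lac_disc_zone zk.
have zd := lac_zone_disk (lac_disc_zone zk); have d0 := depth_gt0 zd.
have N0 := lac_index_R_gt0 R k.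
have N4 : 4 <= N k.
  by rewrite ler_nat -[4%N]/(2 ^ 2)%N leq_exp2l// (leq_trans _ (leq_mul k2 k2)).
apply/GamE; split => //.
have h1 : cmod (cexp_i t - z) <= 3 / 4 / N k + 1 / 16 / N k.
  apply: le_trans (cmod_dist (lac_center t k) _ _) _; apply: lerD; last first.
    by rewrite cmodB ltW.
  rewrite /lac_center (_ : cexp_i t - _ = (3 / 4 / N k)%:C * cexp_i t); last first.
    by rewrite rmorphB rmorph1; ring.
  by rewrite cmodM cmod_cexp_i mulr1 cmod_real ger0_norm// !mulr_ge0// invr_ge0 ltW.
apply: le_lt_trans h1 _.
have -> : 1 - cmod z ^+ 2 = depth z * (2 - depth z) by rewrite /depth; ring.
have d4 : depth z <= 1 / 4.
  have : 4 * depth z <= N k * depth z by rewrite ler_wpM2r// ltW.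
  lra.
apply: (@lt_le_trans _ _ (depth z * (7 / 4))); last by rewrite ler_wpM2l ?(ltW d0)//; lra.
rewrite -(ltr_pM2l N0).
have -> : N k * (3 / 4 / N k + 1 / 16 / N k) = 13 / 16 by field; rewrite gt_eqF.
by rewrite mulrA; lra.
Qed.

Lemma lac_zone_inj k j z : lac_zone k z -> lac_zone j z -> k = j.
Proof.
suff h k' j' : lac_zone k' z -> lac_zone j' z -> (j' <= k')%N.
  by move=> a b; apply/eqP; rewrite eqn_leq (h j k)// (h k j).
move=> ka ja; have d0 := depth_gt0 (lac_zone_disk ka).
rewrite leqNgt; apply/negP => kj; case/andP: ka => ka _; case/andP: ja => _ ja.
have h : 2 * N k' <= N j' by rewrite (le_trans (lac_index_double _))// ler_nat lac_index_le.
have := ler_wpM2r (ltW d0) h; rewrite -mulrA; lra.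
Qed.

(** On the disc W is at least B c_k, so that W^u is at least a multiple of c_k^u = 1/(k+1). The
    weight depth^(-2) and the area of the disc compensate each other, which leaves a harmonic
    term. *)
Lemma lac_disc_integral_ge (s : R) G : 0 < s -> power_series_on_disk (lac_series u s) G ->
  exists k0 : nat, exists2 C, 0 < C & forall t k, (k0 <= k)%N ->
    ((C / k.+1%:R)%:E <= area_integral (lac_disc t k) (fun z => (tent_density u s G z)%:E))%E.
Proof.
move=> s0 hG; have mG := power_series_measurable hG.
have [k0 hk0] := psum_lac_ge s0; exists k0.
have [B B0 BE] : exists2 B, 0 < B & 16^-1 * 2^-1 `^ s = B.
  by eexists; last by []; apply: mulr_gt0; [rewrite invr_gt0|apply: powR_gt0; rewrite invr_gt0].
exists (4^-1 * B `^ u * 16^-1 ^+ 2).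
  by apply: mulr_gt0; [apply: mulr_gt0; rewrite ?powR_gt0 ?invr_gt0|rewrite exprn_gt0 ?invr_gt0].
move=> t k kk; have N0 := lac_index_R_gt0 R k; have iN0 : 0 < (N k)^-1 by rewrite invr_gt0.
have c0 := lac_weight_gt0 u k.
have ck : c k `^ u = k.+1%:R^-1.
  by rewrite /lac_weight -powRrM mulNr mulVf ?gt_eqF// powR_inv1.
pose m := 4^-1 * (B * c k) `^ u * N k ^+ 2.
have m0 : 0 <= m by rewrite !mulr_ge0 ?powR_ge0// sqr_ge0.
have sub : lac_disc t k `<=` @disk R by move=> z /lac_disc_zone /lac_zone_disk.
apply: (@le_trans _ _ (area_integral (lac_disc t k) (fun=> m%:E))).
  rewrite area_integral_cst; last exact: area_set_disc.
  have r0 : 0 < 1 / 16 / N k by rewrite mulr_gt0.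
  apply: le_trans (lee_wpmul2l _ (disc_area_ge _ r0)); last by rewrite lee_fin.
  rewrite -EFinM lee_fin /m powRM ?(ltW B0) ?(ltW c0)// ck.
  by apply: eq_le_refl; field; rewrite gt_eqF//= addrC natr1 pnatr_eq0.
apply: le_area_integral.
- exact: area_set_disc.
- exact: measurable_cst.
- by apply: area_funS sub (area_fun_tent_density _ _ mG); exact: area_set_disk.
- by move=> z _; rewrite lee_fin.
move=> z zk; have zz := lac_disc_zone zk; have zd := lac_zone_disk zz; have d0 := depth_gt0 zd.
have Gz : 16^-1 * (c k * N k `^ s) <= cmod (G z).
  apply: (power_series_ge_subseq (m := lac_index) (K0 := k) hG zd) => K.
    exact/ltnW/lac_index_gt.
  by move=> kK; exact: hk0.
have w : B * c k <= wmod s G z.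
  rewrite /wmod; apply: (@le_trans _ _ ((2^-1 / N k) `^ s * (16^-1 * (c k * N k `^ s)))).
    rewrite powRM ?invr_ge0 ?(ltW N0)//.
    rewrite [leRHS](_ : _ = B * c k * (N k `^ s * (N k)^-1 `^ s)); last by rewrite -BE; ring.
    by rewrite -powRM ?invr_ge0 ?(ltW N0)// mulfV ?gt_eqF// powR1 mulr1.
  apply: ler_pM; rewrite ?powR_ge0//.
    by rewrite mulr_ge0// mulr_ge0 ?powR_ge0.
  rewrite ge0_ler_powR ?nnegrE ?(ltW s0) ?(ltW d0) ?divr_ge0 ?(ltW N0)//.
  by rewrite ler_pdivrMr// mulrC; case/andP: zz; lra.
have : wmod s G z `^ u * depth z `^ (- 2) <= 4 * tent_density u s G z by exact: tent_density_ge.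
have h2 : (B * c k) `^ u * N k ^+ 2 <= wmod s G z `^ u * depth z `^ (- 2).
  apply: ler_pM; rewrite ?powR_ge0 ?sqr_ge0//.
    by rewrite ge0_ler_powR ?nnegrE ?(ltW u0) ?wmod_ge0// mulr_ge0// ltW.
  rewrite powRN powR_mulrn ?(ltW d0)// -exprVn lerXn2r ?nnegrE ?invr_ge0 ?(ltW N0) ?(ltW d0)//.
  by rewrite -[leRHS]div1r ler_pdivlMr//; case/andP: zz; lra.
by rewrite lee_fin /m -mulrA; lra.
Qed.

Lemma harmonic_unbounded (M : R) : exists n, M < \sum_(0 <= k < n) k.+1%:R^-1.
Proof.
apply: contrapT => h; apply: (@dvg_harmonic R); apply: nondecreasing_is_cvgn.
  by apply: nondecreasing_series => n _ _; rewrite /harmonic invr_ge0.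
exists M => _ [n _ <-]; rewrite leNgt; apply/negP => hn; apply: h; exists n.
exact: hn.
Qed.

Lemma tent_area_lac (s : R) G t : 0 < s -> power_series_on_disk (lac_series u s) G ->
  tent_area u s G t = +oo%E.
Proof.
move=> s0 hG; have mG := power_series_measurable hG.
have [k0 [C C0 hC]] := lac_disc_integral_ge s0 hG.
(* From m on the discs lie in the approach region and the lower bound of their integrals holds. *)
pose m := maxn 2 k0; pose F k := lac_disc t (m + k).
have FG k : F k `<=` Gam t.
  by apply: lac_disc_Gam; rewrite (leq_trans (leq_maxl 2 k0))// leq_addr.
have h0 z : (0 <= (tent_density u s G z)%:E)%E by rewrite lee_fin tent_density_ge0.
have mU : area_set (\bigcup_k F k).
  by rewrite /area_set preimage_bigcup; apply: bigcup_measurable => k _; exact: area_set_disc.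
have UG : \bigcup_k F k `<=` Gam t by move=> z [k _]; exact: FG.
have mT : area_fun (Gam t) (fun z => (tent_density u s G z)%:E).
  exact: area_fun_tent_density_Gam.
have le1 : (\sum_(0 <= k <oo) area_integral (F k) (fun z => (tent_density u s G z)%:E) <= tent_area u s G t)%E.
  apply: le_trans (area_integral_subset mU (area_set_Gam t) mT UG (fun z _ => h0 z)).
  rewrite /area_integral preimage_bigcup ge0_integral_bigcup//.
  - by move=> k; exact: area_set_disc.
  - rewrite -preimage_bigcup; apply: area_funS UG mT; exact: area_set_Gam.
  - apply/trivIsetP => i j _ _ ij; apply/seteqP; split => // w [wi wj].
    have := lac_zone_inj (lac_disc_zone wi) (lac_disc_zone wj).
    by move/eqP; rewrite eqn_add2l (negbTE ij).
case TE : (tent_area u s G t) (tent_area_ge0 u s G t) le1 => [x| |]// x0 le1.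
have m1 : 0 < m.+1%:R :> R by rewrite ltr0n.
(* Since (m+k)+1 <= (m+1)(k+1), the harmonic sum starting at m is at least 1/(m+1) of the full
   one. *)
have [n] := harmonic_unbounded (x * m.+1%:R / C); rewrite ltr_pdivrMr// ltNge => /negP[].
have := le_trans (nneseries_ge_partial n _) le1.
have a0 k : (0 <= area_integral (F k) (fun z => (tent_density u s G z)%:E))%E.
  by apply: area_integral_ge0 => z _; exact: h0.
move=> /(_ a0) h.
have {}h : (\sum_(0 <= k < n) (C / (m + k).+1%:R)%:E <= x%:E)%E.
  apply: le_trans h; apply: lee_sum => k _; apply: hC.
  by rewrite (leq_trans (leq_maxr 2 k0))// leq_addr.
rewrite sumEFin lee_fin in h.
apply: le_trans (ler_wpM2r (ltW m1) h).
rewrite mulr_suml big_distrl/=; apply: ler_sum => k _.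
have k1 : 0 < k.+1%:R :> R by rewrite ltr0n.
have mk : 0 < (m + k).+1%:R :> R by rewrite ltr0n.
rewrite mulrC -!mulrA ler_wpM2l ?(ltW C0)// -div1r ler_pdivrMr// mulrC mulrA.
rewrite mulrAC ler_pdivlMr// mul1r -natrM ler_nat mulSn mulnS.
by rewrite addSn ltnS [leqRHS]addnA leq_addr.
Qed.

Lemma tent_lac_infinite (s v : R) G : 0 < s -> 0 < v -> power_series_on_disk (lac_series u s) G ->
  ~ (\int[mu]_(t in @period_itv R) (tent_area u s G t `^ (v / u)) < +oo)%E.
Proof.
move=> s0 v0 hG; have vu : 0 < v / u by rewrite divr_gt0.
rewrite (eq_integral (cst +oo%E)); last first.
  by move=> t _; rewrite tent_area_lac// poweRyr ?gt_eqF.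
rewrite integral_cst; last exact: measurable_period_itv.
by rewrite [X in (_ * X)%E]mu_period_itv gt0_mulye ?lte_fin ?mulr_gt0 ?pi_gt0.
Qed.

End lacunary_divergence.

(** * Comparison of q and u, and the equivalence *)

Section corollary.
Variable R : realType.
Implicit Types p q u v alpha beta : R.

(** The target may use an order s different from that of the source. By uniqueness of the
    coefficients the corresponding transform is the lacunary series with exponent s - alpha, and the
    divergence holds for each positive exponent. *)
Lemma triebel_lizorkin_subset_fine p q u v alpha : 0 < p -> 0 < u -> 0 < v ->
  triebel_lizorkin p q alpha `<=` triebel_lizorkin v u alpha -> q <= u.
Proof.
move=> p0 u0 v0 sub; rewrite leNgt; apply/negP => uq.
have [f hf] := fast_decay_power_series (fast_decay_lac_series u0 (- alpha)).
have [G hG] := fast_decay_power_series (fast_decay_lac_series u0 2).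
have : triebel_lizorkin p q alpha f.
  apply/triebel_lizorkinP; exists (lac_series u (- alpha)), (alpha + 2), G.
  have e2 : alpha + 2 - alpha = 2 by rewrite addrAC subrr add0r.
  split; [by rewrite ltrDl|exact: hf| |].
    by rewrite flett_lac_series [alpha + 2]addrC addrK.
  by rewrite e2; exact: (tent_lac_finite u0 p0 uq hG).
move=> /sub /triebel_lizorkinP[a [s [G' [als af aG' fin]]]].
have aE := power_series_unique af hf; rewrite aE flett_lac_series in aG'.
by apply: (tent_lac_infinite u0 _ v0 aG' fin); rewrite subr_gt0.
Qed.

End corollary.

Theorem corollary1p4 (R : realType) (p q u v alpha beta : R)
    (hp : 0 < p) (hq : 0 < q) (hu : 0 < u) (hv : 0 < v) :
  triebel_lizorkin p q alpha `<=` triebel_lizorkin v u beta <->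
  ((p < v /\ 1 / p - 1 / v - alpha + beta <= 0) \/
   (v <= p /\
     (- alpha + beta < 0 \/ (- alpha + beta = 0 /\ q <= u)))).
Proof.
split=> [sub|]; last exact: triebel_lizorkin_subset.
have [pv|vp] := ltP p v; first by left; split => //; exact: triebel_lizorkin_subset_index sub.
right; split => //; have [ab|ba|ab] := ltgtP (- alpha + beta) 0; first by left.
- have q2 : 0 < q / 2 by rewrite divr_gt0.
  have sub' : triebel_lizorkin v u beta `<=` triebel_lizorkin v (q / 2) alpha.
    apply: triebel_lizorkin_subset => //; right; split => //; left; lra.
  have := triebel_lizorkin_subset_fine hp q2 hv (subset_trans sub sub').
  lra.
- right; split => //; have ba : beta = alpha by lra.
  by move: sub; rewrite ba; exact: triebel_lizorkin_subset_fine.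
Qed.
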